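(* Let $(\bar u,\bar\mu)\in\mathcal D$, and let $\bar x$, $f$, $y$, $z_1,z_2$, $A_t^{L,pp}$, $A_t^{L,sc}$, $B_t^L$, $B_0^L$ be as in the context. For any $t\in\mathbb R$ define $$u(x,t)=\frac{\partial}{\partial t}y(\alpha,t)=\bar u(\bar x(\alpha))+\frac t2(\alpha-\bar x(\alpha))\ \text{ for } x=y(\alpha,t),\qquad \mu(t)=y(\cdot,t)\#(f\,d\alpha).$$ Let $\mu(t)=\mu_{ac}(t)+\mu_{pp}(t)+\mu_{sc}(t)$, where $\mu_{ac}(t)$, $\mu_{pp}(t)$, $\mu_{sc}(t)$ are the absolutely continuous part, the pure point part and the singular continuous part of $\mu(t)$ respectively. Then: Properties of $\mu(t)$: (i) Energy conservation: $\mu\in C(\mathbb R;\mathcal M_+(\mathbb R))$ and $\mu(t)(\mathbb R)=\bar\mu(\mathbb R)$ for $t\in\mathbb R$. (ii) $\mu_{pp}(t)=y(\cdot,t)\#(f|_{A_t^{L,pp}}d\alpha)$, $\ \mu_{sc}(t)=y(\cdot,t)\#(f|_{A_t^{L,sc}}d\alpha)$, $\ \mu_{ac}(t)=y(\cdot,t)\#(f|_{B_t^{L}}d\alpha)$. Moreover, for any $t\neq0$, $$A_t^{L,pp}\cup A_t^{L,sc}=\Big\{\alpha\in B_0^L:\ \bar u_x(\bar x(\alpha))=-\frac2t\Big\}=:A_t^L.$$ This implies that for any $t\neq0$, $\mu_{pp}(t)$ and $\mu_{sc}(t)$ are determined by the absolutely continuous part $\bar\mu_{ac}$, i.e. by $\bar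 u_x$. Moreover, $$\mathrm{supp}\big(\mu_{pp}(t)+\mu_{sc}(t)\big)\subset\Big\{x+\bar u(x)t+\frac{t^2}{4}\bar\mu((-\infty,x)):\ x\in A_t^E\Big\},\qquad A_t^E=\Big\{x:\ \bar u_x(x)=-\frac2t\Big\}.$$ (iii) There are at most countably many times $t\in\mathbb R$ such that either the pure point part or the singular continuous part of $\mu(t)$ is not zero; in other words, both sets $T_p:=\{t:\mu_{pp}(t)\ne0\}$ and $T_s:=\{t:\mu_{sc}(t)\neq0\}$ are (at most) countable. Properties of $u(x,t)$: (iv) For all $t\in\mathbb R$, the function $u(\cdot,t)$ is globally absolutely continuous and $d\mu_{ac}(t)=u_x^2(x,t)\,dx$. Moreover $u\in C(\mathbb R;C_b(\mathbb R))\cap C^{1/2}_{loc}(\mathbb R\times\mathbb R)$, $u_x\in L^\infty(\mathbb R;L^2(\mathbb R))$, $u_t\in L^2_{loc}(\mathbb R\times\mathbb R)$. (v) If $\bar u(-\infty):=\lim_{x\to-\infty}\bar u(x)$ exists, then $\lim_{x\to-\infty}u(x,t)=\bar u(-\infty)$. If $\bar u(+\infty):=\lim_{x\to+\infty}\bar u(x)$ exists, then $\lim_{x\to+\infty}u(x,t)=\bar u(+\infty)+\frac12\bar\mu(\mathbb R)t$. Relations with the absolutely continuous part: (vi) Consider a time $s\in\mathbb R$ such that $\mu(s)$ is absolutely continuous with respect to Lebesgue measure. Let $\tilde u(x)=u(x,s)$, $\tilde F(\xi)=\int_{(-\infty,\xi)}\tilde u_x^2(z)\,dz$ and $X(\xi,t)=\xi+\tilde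 u(\xi)t+\frac{t^2}4\tilde F(\xi)$. Then $\tilde u\in C_b(\mathbb R)$, $\tilde u_x\in L^2(\mathbb R)$, $\|\tilde u_x\|_{L^2}^2=\bar\mu(\mathbb R)$. For any $t\in\mathbb R$ we also have $y(\cdot,t)=X(\cdot,t-s)\circ y(\cdot,s)$, $\ \mu(t)=X(\cdot,t-s)\#(\tilde u_x^2\,dx)$, and $$u(x,t)=\frac{\partial}{\partial t}X(\xi,t-s)=\tilde u(\xi)+\frac{t-s}2\tilde F(\xi)\quad\text{for } x=X(\xi,t-s).$$
   Context: $\mathcal M_+(\mathbb R)$ is the set of finite positive Radon measures on $\mathbb R$ endowed with the weak topology (testing against bounded continuous functions). $C_b(\mathbb R)$ is the space of bounded continuous functions with the sup norm. $\mathrm{supp}$ denotes the support of a measure. $\mathcal D$ is the set of pairs $(u,\mu)$ with $u\in C_b(\mathbb R)$, $u_x\in L^2(\mathbb R)$, $\mu\in\mathcal M_+(\mathbb R)$, and $d\mu_{ac}=u_x^2\,dx$, where $\mu_{ac}$ is the absolutely continuous part of $\mu$ with respect to Lebesgue measure. $(T\#\nu)(E)=\nu(T^{-1}(E))$ is the push-forward; $f|_A$ denotes $f$ times the indicator function of $A$. For $\alpha\in\mathbb R$, $\bar x(\alpha)$ is the unique real number with $\bar x(\alpha)+\bar\mu((-\infty,\bar x(\alpha)))\le\alpha\le\bar x(\alpha)+\bar\mu((-\infty,\bar x(\alpha)])$ (the function $\bar x$ is nondecreasing and 1-Lipschitz); $f(\alpha)=1-\bar x'(\alpha)$; $B_0^L=\{\alpha:\bar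 x'(\alpha)>0\}$; and $y(\alpha,t)=\bar x(\alpha)+\bar u(\bar x(\alpha))t+\frac{t^2}{4}(\alpha-\bar x(\alpha))$. For each $t$ the map $y(\cdot,t)$ is nondecreasing; $z_1(x,t)=\inf\{\alpha:y(\alpha,t)=x\}$ and $z_2(x,t)=\sup\{\alpha:y(\alpha,t)=x\}$ are its two pseudo-inverses, and $A_t^{L,pp}=\{\alpha: y_\alpha(\alpha,t)=0,\ z_1(y(\alpha,t),t)<z_2(y(\alpha,t),t)\}$, $A_t^{L,sc}=\{\alpha: y_\alpha(\alpha,t)=0,\ z_1(y(\alpha,t),t)=z_2(y(\alpha,t),t)\}$, $B_t^L=\{\alpha: y_\alpha(\alpha,t)>0\}$. Here $A_t^{L,pp}$ is defined pointwise, while $A_t^{L,sc}$, $B_t^L$ and $B_0^L$ are defined in the a.e. sense, so identities involving these sets are understood up to Lebesgue null sets.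
   Formalization: The inclusion of supp(μ_pp(t)+μ_sc(t)) in the set {x+ū(x)t+(t²/4)μ̄((-∞,x)) : x∈A_t^E} is false for the closed support; it is proved instead that this set carries μ_pp(t)+μ_sc(t) (its complement is negligible) and that supp lies in its closure. *)

(* Defs.v *)
From HB Require Import structures.
From mathcomp Require Import all_boot all_order all_algebra.
From mathcomp Require Import all_classical all_reals all_analysis.
Set Implicit Arguments.
Unset Strict Implicit.
Unset Printing Implicit Defensive.
Import Order.TTheory GRing.Theory Num.Theory.
Import numFieldNormedType.Exports.
Local Open Scope ring_scope.
Local Open Scope classical_set_scope.

(* A finite Borel measure on R is automatically a Radon measure. *)
Notation "'{finmeas' R }" :=
  {finite_measure set (measurableTypeR R) -> \bar R}
  (at level 0, format "'{finmeas'  R }") : type_scope.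

Section MeasuresOnTheLine.
Context {R : realType}.
Local Notation leb := (@lebesgue_measure R).

(* the measure g dx, as a set function *)
Definition density (g : R -> R) (E : set (measurableTypeR R)) : \bar R :=
  (\int[leb]_(x in E) (g x)%:E)%E.

Definition pure_point (m : {finmeas R}) :=
  exists C : set R, countable C /\ m (~` C) = 0%E.

Definition singular_continuous (m : {finmeas R}) :=
  (forall x : R, m [set x] = 0%E) /\
  exists N : set (measurableTypeR R),
    [/\ measurable N, leb N = 0%E & m (~` N) = 0%E].

Definition lebesgue_decomposition (m ac pp sc : {finmeas R}) :=
  [/\ ac `<< leb, pure_point pp, singular_continuous sc &
      forall A : set (measurableTypeR R), measurable A ->
        m A = (ac A + pp A + sc A)%E].

Definition msupport (m : set (measurableTypeR R) -> \bar R) : set R :=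
  [set x | forall e : R, 0 < e -> (0 < m (ball x e))%E].

End MeasuresOnTheLine.

Section FunctionSpaces.
Context {R : realType}.
Local Notation leb := (@lebesgue_measure R).
Local Notation leb2 := (leb \x leb)%E.

Definition Cb (u : R -> R) := continuous u /\ bounded_fun u.

Definition L2 (g : R -> R) := (g : measurableTypeR R -> R) \in Lfun leb 2%:E.

Definition compactly_supported (V : topologicalType) (phi : V -> R) :=
  compact (closure [set p | phi p != 0]).

Definition C1c (phi : R -> R) :=
  [/\ forall x, derivable phi x 1, continuous (derive1 phi) &
      compactly_supported phi].

(* [g] is a representative of the weak derivative of [u]; as in Brezis'
   treatment of W^{1,p} in dimension one, test functions are C^1_c. *)
Definition weak_derivative (u g : R -> R) :=
  locally_integrable setT g /\
  forall phi : R -> R, C1c phi ->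
    \int[leb]_x (u x * derive1 phi x) = - \int[leb]_x (g x * phi x).

(* Points of the plane are pairs (x, t). *)
Definition C1c2 (phi : R * R -> R) :=
  [/\ forall p v, v \in [:: (1, 0); (0, 1)] -> derivable phi p v,
      continuous (fun p => 'D_(1, 0) phi p),
      continuous (fun p => 'D_(0, 1) phi p) &
      compactly_supported phi].

Definition L2loc2 (g : R * R -> R) :=
  measurable_fun setT (g : measurableTypeR R * measurableTypeR R -> R) /\
  forall K : set (R * R), compact K ->
    (\int[leb2]_(p in K) (g p ^+ 2)%:E < +oo)%E.

Definition weak_time_derivative (u : R -> R -> R) (g : R * R -> R) :=
  forall phi : R * R -> R, C1c2 phi ->
    \int[leb2]_p (u p.1 p.2 * 'D_(0, 1) phi p) =
    - \int[leb2]_p (g p * phi p).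

Definition globally_absolutely_continuous (u : R -> R) :=
  forall e : R, 0 < e -> exists2 d : R, 0 < d &
    forall (n : nat) (a b : 'I_n -> R), (forall i, a i <= b i) ->
      trivIset setT (fun i => `]a i, b i[%classic) ->
      \sum_(i < n) (b i - a i) < d ->
      \sum_(i < n) `|u (b i) - u (a i)| < e.

Definition holder_half_loc (u : R -> R -> R) :=
  forall K : set (R * R), compact K -> exists C : R,
    forall p q : R * R, K p -> K q ->
      `|u p.1 p.2 - u q.1 q.2| <= C * Num.sqrt `|p - q|.

End FunctionSpaces.

Section HunterSaxton.
Context {R : realType}.
Local Notation leb := (@lebesgue_measure R).

(* [(ubar, mubar)] belongs to the set D, and [ubarx] is a (Borel)
   representative of the L^2 class of the derivative of [ubar]. *)
Definition calD (ubar ubarx : R -> R) (mubar : {finmeas R}) :=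
  [/\ Cb ubar, weak_derivative ubar ubarx, L2 ubarx &
      exists ac pp sc : {finmeas R}, lebesgue_decomposition mubar ac pp sc /\
        forall A : set (measurableTypeR R), measurable A ->
          ac A = density (fun x => ubarx x ^+ 2) A].

Variables (ubar ubarx : R -> R) (mubar : {finmeas R}).

Definition xbar (a : R) : R :=
  xget 0 [set x : R | x + fine (mubar `]-oo, x[%classic) <= a
                        <= x + fine (mubar `]-oo, x]%classic)].

Definition f (a : R) : R := 1 - derive1 xbar a.

Definition y (a t : R) : R :=
  xbar a + ubar (xbar a) * t + t ^+ 2 / 4 * (a - xbar a).

Definition z1 (x t : R) : R := inf [set a | y a t = x].
Definition z2 (x t : R) : R := sup [set a | y a t = x].

(* [derive1] is a total operator, hence the explicit differentiability. *)
Definition y_flat (t : R) : set R :=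
  [set a | derivable (y ^~ t) a 1 /\ derive1 (y ^~ t) a = 0].

Definition ALpp (t : R) : set R :=
  [set a | y_flat t a /\ z1 (y a t) t < z2 (y a t) t].

Definition ALsc (t : R) : set R :=
  [set a | y_flat t a /\ z1 (y a t) t = z2 (y a t) t].

Definition BL (t : R) : set R :=
  [set a | derivable (y ^~ t) a 1 /\ 0 < derive1 (y ^~ t) a].

Definition BL0 : set R :=
  [set a | derivable xbar a 1 /\ 0 < derive1 xbar a].

Definition AL (t : R) : set R :=
  [set a | BL0 a /\ ubarx (xbar a) = - (2 / t)].

Definition AE (t : R) : set R := [set x | ubarx x = - (2 / t)].

Definition XE (t x : R) : R :=
  x + ubar x * t + t ^+ 2 / 4 * fine (mubar `]-oo, x[%classic).

Definition is_velocity (u : R -> R -> R) :=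
  forall a t, u (y a t) t = ubar (xbar a) + t / 2 * (a - xbar a).

Definition is_energy (mu : R -> {finmeas R}) :=
  forall t (A : set (measurableTypeR R)), measurable A ->
    mu t A = pushforward (density f) (y ^~ t) A.

End HunterSaxton.

(* the generalized characteristics issued from the datum [(v, vx^2 dx)] *)
Definition Fac {R : realType} (vx : R -> R) (xi : R) : R :=
  \int[@lebesgue_measure R]_(z in `]-oo, xi[%classic) (vx z ^+ 2).

Definition Xac {R : realType} (v vx : R -> R) (xi t : R) : R :=
  xi + v xi * t + t ^+ 2 / 4 * Fac vx xi.

(* Main.v *)
(* In the Lagrangian variable [a] everything is absolutely continuous. Let
   [X = xbar] and let [S] be a Lebesgue null Borel set that carries the singular
   part of [mubar]. Put [g a = 1 / (1 + ubarx (X a) ^ 2)] if [X a] is not in [S]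
   and [g a = 0] otherwise, [v = ubarx (X a) * g] and [e = 1 - g]. Then
   [v ^ 2 = g * e], the map [X] pushes [g da] to [dx] and [e da] to [mubar], and
   [X] and [ubar \o X] have the derivatives [g] and [v]. Hence [y ^~ t] has the
   derivative [h = g + t v + t ^ 2 / 4 e], the velocity along the flow has the
   derivative [w = v + t / 2 e], and [w ^ 2 = e * h], so that [h >= 0].

   As [y ^~ t] pushes [h da] to [dx], the energy [e da] splits into the part on
   [h > 0], which is pushed to [ux ^ 2 dx] with [ux = w / h], the part on the
   plateaus of [y ^~ t], which gives the atoms, and the part on [h = 0] off the
   plateaus, which gives the singular continuous measure. For [t != 0], [h a = 0]
   means that [X a] is not in [S] and [ubarx (X a) = - 2 / t]: the flat sets of
   distinct times are disjoint, and only countably many of them carry energy.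

   The weak time derivative is [(a - X a) / 2 - u * ux] at [x = y a t]. In the
   variables [(a, t)] the identity that defines it says that the integral in time
   of [d/dt (u phi h)] vanishes along every characteristic. *)
Require Import Defs.
From HB Require Import structures.
From mathcomp Require Import all_boot all_order all_algebra.
From mathcomp Require Import all_classical all_reals all_analysis.
From mathcomp Require Import ess_sup_inf measurable_realfun ring lra.
Set Implicit Arguments.
Unset Strict Implicit.
Unset Printing Implicit Defensive.
Import Order.TTheory GRing.Theory Num.Theory.
Import numFieldNormedType.Exports.
Local Open Scope ring_scope.
Local Open Scope classical_set_scope.

(** * Integration on the line *)

(** The statement uses [derive1], a total operator, and sets cut out by it whose measurability is
    not given. The computations are therefore made with Borel densities that agree with these
    derivatives almost everywhere, and they rest on comparison lemmas for integrals in which one of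
    the two functions is arbitrary. The basic images, that of [da] under [X] and that of [h da]
    under [y ^~ t], are checked on intervals []a, b]], whose preimages are intervals, and extended
    by uniqueness of measures. The relation [v ^ 2 = g * e] says that [h], as a quadratic polynomial
    in [t], has discriminant zero; this is why it never becomes negative and why each point is flat
    at no more than one time. The remaining difficulty is that an Eulerian function has to choose a
    preimage of [x] under [y ^~ t]. The left end of the fibre is a Borel choice; it differs from the
    given point [a] only on plateaus, and there the weight [h] vanishes almost everywhere. *)

Section NonnegativeIntegral.
Context d (T : measurableType d) (R : realType).
Local Open Scope ereal_scope.
Variable mu : {measure set T -> \bar R}.

Import HBNNSimple.

(* The integral of a nonnegative function is a supremum over simple minorants,
   so it is monotone even on functions that are not measurable. *)
Lemma le_nnintegral (D : set T) (p q : T -> \bar R) :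
  (forall x, D x -> 0 <= p x) -> (forall x, D x -> p x <= q x) ->
  \int[mu]_(x in D) p x <= \int[mu]_(x in D) q x.
Proof.
move=> p0 pq; rewrite integral_mkcond [leRHS]integral_mkcond.
have p0' x : 0 <= (p \_ D) x by apply: erestrict_ge0.
have q0' x : 0 <= (q \_ D) x.
  by apply: erestrict_ge0 => // t Dt; exact: le_trans (p0 _ Dt) (pq _ Dt).
rewrite !ge0_integralTE//; apply: le_ereal_sup => _ [h hp <-].
by exists h => // x; apply: le_trans (hp x) _; exact: lee_restrict.
Qed.

Lemma le_nnintegral_subset (D E : set T) (p : T -> \bar R) :
  D `<=` E -> (forall x, 0 <= p x) -> \int[mu]_(x in D) p x <= \int[mu]_(x in E) p x.
Proof.
move=> DE p0; rewrite integral_mkcond [leRHS]integral_mkcond.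
apply: le_nnintegral => x _; rewrite !patchE; first by case: ifP.
by case: ifPn => [/set_mem/DE/mem_set -> //|_]; case: ifP.
Qed.

(** Since [q] is arbitrary on the null set [N], it is squeezed: its integral is at least that of [p]
    over [D] minus [N], and at most that of [p] with the value [+oo] put on [N]; both equal the
    integral of [p]. *)
Lemma ge0_ae_eq_integral_any (D : set T) (p q : T -> \bar R) :
  measurable D -> measurable_fun D p ->
  (forall x, D x -> 0 <= p x) -> (forall x, D x -> 0 <= q x) ->
  {ae mu, forall x, D x -> p x = q x} ->
  \int[mu]_(x in D) q x = \int[mu]_(x in D) p x.
Proof.
move=> mD mp p0 q0 [N [mN N0 pqN]].
have mDN : measurable (D `\` N) by exact: measurableD.
have eqDN x : D x -> ~ N x -> p x = q x.
  by move=> Dx nNx; apply: contrapT => npq; apply: nNx; apply: pqN => /(_ Dx).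
have pE : \int[mu]_(x in D) p x = \int[mu]_(x in D `\` N) p x.
  exact: ge0_negligible_integral.
apply/eqP; rewrite eq_le; apply/andP; split; last first.
  rewrite pE [leLHS](eq_integral q); last first.
    by move=> x; rewrite inE => -[? ?]; apply: eqDN.
  rewrite integral_mkcond [leRHS]integral_mkcond; apply: le_nnintegral => x _.
    by apply: erestrict_ge0 => t [Dt _]; exact: q0.
  rewrite !patchE; case: ifPn => [|_].
    by rewrite inE => -[Dx _]; rewrite mem_set.
  by case: ifPn => [|//]; rewrite inE => Dx; exact: q0.
have Ny x : x \in (N : set T) \/ x \notin (N : set T).
  by case: (boolP (x \in _)); [left|right].
pose r x := if x \in N then +oo else p x.
have mr : measurable_fun D r.
  apply: measurable_fun_if => //; last by apply: measurable_funS mp => // x [].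
  apply: (@measurable_fun_bool _ _ _ _ true).
  rewrite (_ : _ @^-1` _ = N); first exact: measurableI.
  by apply/seteqP; split => t; [exact: set_mem|exact: mem_set].
apply: (@le_trans _ _ (\int[mu]_(x in D) r x)).
  apply: le_nnintegral => // x Dx; rewrite /r; case: ifPn => [_|]; first exact: leey.
  by rewrite notin_setE => nNx; rewrite eqDN.
rewrite (@ge0_negligible_integral _ _ _ mu D N)//; last first.
  by move=> x Dx; rewrite /r; case: ifPn => // _; exact: p0.
rewrite pE (eq_integral p)// => x; rewrite inE => -[_ nNx].
by rewrite /r memNset.
Qed.

End NonnegativeIntegral.

(** * Measures given by a density *)

Section DensityMeasure.
Context d (T : measurableType d) (R : realType).
Local Open Scope ereal_scope.
Variable mu : {measure set T -> \bar R}.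
Variable w : T -> R.

(** The two proofs are arguments so that the measure instance, which is built from them, can be
    inferred from the term. *)
Definition weighted of measurable_fun setT w & (forall x, (0 <= w x)%R) :=
  fun A : set T => \int[mu]_(x in A) (w x)%:E.

Hypotheses (mw : measurable_fun setT w) (w0 : forall x, (0 <= w x)%R).

Local Notation nu := (weighted mw w0).

Let wE x := (w x)%:E.
Let mwE : measurable_fun setT wE. Proof. exact/measurable_EFinP. Qed.
Let wE0 x : 0 <= wE x. Proof. by rewrite lee_fin. Qed.

Let nu0 : nu set0 = 0. Proof. by rewrite /weighted integral_set0. Qed.

Let nu_ge0 A : 0 <= nu A.
Proof. by apply: integral_ge0 => x _; rewrite lee_fin. Qed.

Let nu_sigma_additive : semi_sigma_additive nu.
Proof.
exact: (@semi_sigma_additive_nng_induced _ _ _ mu (EFin \o w)).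
Qed.

HB.instance Definition _ := isMeasure.Build _ _ _ nu nu0 nu_ge0 nu_sigma_additive.

Import HBNNSimple.

Let simple_integral_weighted (h : {nnsfun T >-> R}) :
  \int[nu]_x (h x)%:E = \int[mu]_x ((h x)%:E * wE x).
Proof.
have hE x : (h x)%:E * wE x =
    \sum_(r \in range h) (r%:E * (wE \_ (h @^-1` [set r])) x).
  rewrite -(fsbig_widen [set h x]); first by rewrite fsbig_set1 patchE mem_set.
    by move=> _ ->; exists x.
  by move=> r [_ /= rh]; rewrite patchE memNset ?mule0// => hr; apply: rh.
have mp r : measurable_fun setT (wE \_ (h @^-1` [set r])).
  by apply/(measurable_restrictT _ _).1 => //; exact: measurable_funTS.
have p0 r x : 0 <= (wE \_ (h @^-1` [set r])) x by rewrite patchE; case: ifP.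
under [RHS]eq_integral do rewrite hE.
rewrite ge0_integral_fsum//; last 2 first.
- by move=> r; exact: measurable_funeM.
- move=> r x _; rewrite patchE; case: ifPn => [/set_mem <-|_]; last by rewrite mule0.
  by rewrite mule_ge0// lee_fin.
rewrite integralT_nnsfun sintegralE; apply: eq_fsbigr => r /set_mem[x _ <-].
by rewrite ge0_integralZl// ?lee_fin// -integral_mkcond.
Qed.

(** Both sides agree on simple functions; monotone convergence along an increasing simple
    approximation of [k] is then used once for each of the two measures. *)
Lemma ge0_integral_weighted (E : set T) (k : T -> \bar R) :
  measurable E -> measurable_fun E k -> (forall x, E x -> 0 <= k x) ->
  \int[nu]_(x in E) k x = \int[mu]_(x in E) (k x * (w x)%:E).
Proof.
move=> mE mk k0; rewrite [LHS]integral_mkcond [RHS]integral_mkcond.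
have mkE : measurable_fun setT (k \_ E) by exact/(measurable_restrictT _ _).1.
have kE0 x : setT x -> 0 <= (k \_ E) x.
  by move=> _; rewrite patchE; case: ifPn => // /set_mem /k0.
rewrite [RHS](eq_integral (fun x => (k \_ E) x * wE x)); last first.
  by move=> x _; rewrite !patchE; case: ifP => //; rewrite mul0e.
pose h := nnsfun_approx measurableT mkE.
have nd x : setT x -> {homo (fun n => (h n x)%:E) : m n / (m <= n)%N >-> m <= n}.
  by move=> _ m n mn; rewrite lee_fin; exact/lefP/nd_nnsfun_approx.
have mh n : measurable_fun setT (fun x => (h n x)%:E) by exact/measurable_EFinP.
have cvgh x : EFin \o h ^~ x @ \oo --> (k \_ E) x by exact: cvg_nnsfun_approx.
rewrite (eq_integral (fun x => limn (fun n => (h n x)%:E))); last first.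
  by move=> x _; apply/esym/cvg_lim => //; exact: cvgh.
rewrite monotone_convergence//; last by move=> n x _; rewrite lee_fin.
under eq_fun do rewrite simple_integral_weighted.
rewrite -monotone_convergence//; last 3 first.
- by move=> n; exact: emeasurable_funM.
- by move=> n x _; rewrite mule_ge0// lee_fin.
- by move=> x xT m n mn; rewrite lee_wpmul2r//; exact: nd.
apply: eq_integral => x _; apply/cvg_lim => //.
by apply: cvgeZr => //; exact: cvgh.
Qed.

End DensityMeasure.

(** * Change of variables through an image measure *)

Section ChangeOfVariables.
Context d1 d2 (T1 : measurableType d1) (T2 : measurableType d2) (R : realType).
Variables (mu : {measure set T1 -> \bar R}) (nu : {measure set T2 -> \bar R}).
Variables (p : T1 -> T2) (w : T1 -> R).
Hypotheses (mp : measurable_fun setT p) (mw : measurable_fun setT w).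
Hypothesis w0 : forall x, 0 <= w x.
Hypothesis push : forall A, measurable A ->
  (\int[mu]_(x in p @^-1` A) (w x)%:E = nu A)%E.

Let mpre A : measurable A -> measurable (p @^-1` A).
Proof. by move=> mA; rewrite -(setTI (_ @^-1` _)); exact: mp. Qed.

Lemma ge0_change_of_variables (A : set T2) (k : T2 -> \bar R) :
  measurable A -> measurable_fun setT k -> (forall x, (0 <= k x)%E) ->
  (\int[nu]_(x in A) k x = \int[mu]_(x in p @^-1` A) (k (p x) * (w x)%:E))%E.
Proof.
move=> mA mk k0.
have e (B : set T2) : measurable B -> B `<=` A ->
    nu B = pushforward (weighted mu mw w0) p B.
  by move=> mB _; rewrite -push.
pose mp' := isMeasurableFun.Build _ _ _ _ _ mp.
pose p' : {mfun T1 >-> T2} := HB.pack p mp'.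
rewrite (@eq_measure_integral _ _ _ _ (pushforward (weighted mu mw w0) p'))//.
rewrite ge0_integral_pushforward//; last exact: measurable_funTS.
rewrite ge0_integral_weighted//; [exact: mpre| |by move=> x _; exact: k0].
by apply: measurable_funTS; exact: measurableT_comp.
Qed.

Lemma integrable_change_of_variables (A : set T2) (k : T2 -> R) :
  measurable A -> measurable_fun setT k -> nu.-integrable A (EFin \o k) ->
  mu.-integrable (p @^-1` A) (fun x => (k (p x) * w x)%:E).
Proof.
move=> mA mk /integrableP[_ kfin]; apply/integrableP; split.
  apply/measurable_EFinP/measurable_funTS; apply: measurable_funM => //.
  exact: measurableT_comp.
move: kfin; rewrite (@ge0_change_of_variables A (fun x => `|(k x)%:E|)%E)//; last first.
  by apply: measurableT_comp => //; exact/measurable_EFinP.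
by under eq_integral do rewrite -[X in (_ * X)%E]gee0_abs ?lee_fin// -abseM.
Qed.

Lemma Rintegral_change_of_variables (A : set T2) (k : T2 -> R) :
  measurable A -> measurable_fun setT k -> nu.-integrable A (EFin \o k) ->
  \int[nu]_(x in A) k x = \int[mu]_(x in p @^-1` A) (k (p x) * w x).
Proof.
move=> mA mk ik; rewrite /Rintegral; congr fine.
have mkE : measurable_fun setT (EFin \o k) by exact/measurable_EFinP.
rewrite [in LHS]integralE [in RHS]integralE.
rewrite (ge0_change_of_variables mA (measurable_funepos mkE))//.
rewrite (ge0_change_of_variables mA (measurable_funeneg mkE))//.
congr (_ - _)%E; apply: eq_integral => x _.
  by rewrite !funeposE /= EFinM maxe_pMl ?mul0e// ?lee_fin.
by rewrite !funenegE /= -mulNr EFinM maxe_pMl ?mul0e// ?lee_fin.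
Qed.

End ChangeOfVariables.

(** * Lebesgue measure and local integrability on the line *)

Section RealLine.
Context {R : realType}.
Local Notation leb := (@lebesgue_measure R).

(** Half-open intervals are stable under intersection and generate the Borel sets, and the intervals
    []-n, n]], of finite measure, exhaust the line: the uniqueness theorem for measures applies. *)
Lemma eq_measure_itv (m1 m2 : {measure set (measurableTypeR R) -> \bar R}) :
  (forall a b : R, a < b -> m1 `]a, b]%classic = m2 `]a, b]%classic) ->
  (forall a b : R, (m1 `]a, b]%classic < +oo)%E) ->
  forall A, measurable A -> m1 A = m2 A.
Proof.
move=> m12 m1fin A mA.
pose g (n : nat) : set (measurableTypeR R) := `](- n%:R : R), n%:R]%classic.
apply: (@measure_unique _ R (measurableTypeR R) (@ocitv R) g) => //.
- exact: ocitvI.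
- by move=> n; exact: is_ocitv.
- apply/seteqP; split => // x _; have [n xn] : exists n : nat, `|x : R| < n%:R.
    exists (Num.bound `|x|); exact: archi_boundP (normr_ge0 (x : R)).
  exists n => //; rewrite /g /= in_itv /=; move: xn; rewrite ltr_norml => /andP[-> /ltW ->//].
- by move=> B /ocitvP[->|[[a b] /= ab ->]]; [rewrite !measure0|exact: m12].
- by move=> k; exact: m1fin.
Qed.

(** Near [x], [K] differs by the constant [K (x - 1)] from the integral based at [x - 1], to which
    the fundamental theorem at Lebesgue points applies. *)
Lemma Lebesgue_pt_derivable (K k : R -> R) (x : R) :
  locally_integrable setT k ->
  (forall a b, a <= b -> K b - K a = \int[leb]_(x in `[a, b]) k x) ->
  lebesgue_pt k x -> derivable K x 1 /\ derive1 K x = k x.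
Proof.
move=> lk inc lx.
have ik : leb.-integrable `[x - 1, x + 1] (EFin \o k).
  have [mk _ fk] := lk; apply/integrableP; split.
    by apply/measurable_EFinP; exact: measurable_funTS.
  by apply: fk => //; exact: segment_compact.
have xx1 : (x < x + 1)%R by rewrite ltrDl.
have bx : (BLeft (x - 1)%R < BRight x)%E by rewrite lte_fin ltrBlDr ltrDl.
have [dF F'] := FTC1_lebesgue_pt xx1 ik bx lx.
set F := (fun y => _) in dF F'.
have nF : {near x, (fun y => F y + cst (K (x - 1)) y) =1 K}.
  have : \forall y \near x, x - 1 < y by apply: lt_nbhsr; rewrite ltrBlDr ltrDl.
  apply: filterS => y xy; rewrite /F -inc ?ltW//= subrK//.
have dFK : derivable (F + cst (K (x - 1))) x 1 by exact: derivableD.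
split; first exact: near_eq_derivable dFK.
rewrite derive1E -(near_eq_derive _ nF) deriveD// derive_cst addr0 -derive1E.
exact: F'.
Qed.

Lemma Lebesgue_ae_derivable (K k : R -> R) :
  locally_integrable setT k ->
  (forall a b, a <= b -> K b - K a = \int[leb]_(x in `[a, b]) k x) ->
  {ae leb, forall x : measurableTypeR R, derivable K x 1 /\ derive1 K x = k x}.
Proof.
move=> lk inc; have := lebesgue_differentiation lk.
apply: filterS; first exact: (ae_filter_ringOfSetsType leb).
by move=> x; exact: Lebesgue_pt_derivable.
Qed.

Lemma locally_integrable_bounded (k : R -> R) (C : R) :
  measurable_fun setT k -> (forall x, `|k x| <= C) -> locally_integrable setT k.
Proof.
move=> mk kC; split => //; first exact: openT.
move=> K _ cK; have mK := compact_measurable cK.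
apply: (@le_lt_trans _ _ (\int[leb]_(x in K) C%:E)%E).
  apply: ge0_le_integral => //.
  - apply/measurable_EFinP; apply: measurableT_comp => //.
    exact: measurable_funTS.
  - by move=> x _; rewrite lee_fin.
rewrite integral_cst// lte_mul_pinfty ?lee_fin//.
  exact: le_trans (kC 0).
exact: compact_finite_measure.
Qed.

Lemma locally_integrable_itv (k : R -> R) (a b : R) :
  locally_integrable setT k -> leb.-integrable `[a, b] (EFin \o k).
Proof.
move=> [mk _ fk]; apply/integrableP; split.
  by apply/measurable_EFinP; exact: measurable_funTS.
by apply: fk => //; exact: segment_compact.
Qed.

Lemma Rintegral_segD (k : R -> R) (a b c : R) :
  locally_integrable setT k -> a <= b -> b <= c ->
  \int[leb]_(x in `[a, c]) k x =
  \int[leb]_(x in `[a, b]) k x + \int[leb]_(x in `[b, c]) k x.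
Proof.
move=> lk ab bc; have ik := locally_integrable_itv _ _ lk.
have := @Rintegral_itvB R k (BLeft a) (BRight c) b (ik _ _).
rewrite !bnd_simp => /(_ ab bc) e.
rewrite -(@Rintegral_itv_obnd_cbnd R b (BRight c)); last first.
  by apply: integrableS (ik b c) => //; apply: subset_itv; rewrite bnd_simp.
by rewrite -e addrC subrK.
Qed.

End RealLine.

(** * Integration by parts for primitives of locally integrable functions *)

Section ProductRule.
Context {R : realType}.
Local Notation leb := (@lebesgue_measure R).

Lemma locally_integrable_mul_continuous (k Q : R -> R) :
  locally_integrable setT k -> continuous Q ->
  locally_integrable setT (fun x => k x * Q x).
Proof.
move=> [mk _ fk] cQ; have mQ := continuous_measurable_fun cQ.
split; [exact: measurable_funM|exact: openT|move=> K KT cK].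
have mK := compact_measurable cK.
have [C [_ QC]] : bounded_set (Q @` K).
  apply: compact_bounded.
  exact: continuous_compact (continuous_subspaceT cQ) cK.
have {}QC x : K x -> `|Q x| <= `|C| + 1.
  by move=> Kx; apply: QC; [rewrite ltr_pwDr// ler_norm|exists x].
apply: (@le_lt_trans _ _ (\int[leb]_(x in K) ((`|C| + 1)%:E * `|k x|%:E))%E).
  apply: ge0_le_integral => //.
  - apply/measurable_EFinP; apply: measurableT_comp => //.
    by apply: measurable_funTS; exact: measurable_funM.
  - apply: emeasurable_funM => //; apply/measurable_EFinP.
    by apply: measurableT_comp => //; exact: measurable_funTS.
  - by move=> x Kx; rewrite -EFinM lee_fin normrM mulrC ler_wpM2r// QC.
rewrite ge0_integralZl//.
- by apply: lte_mul_pinfty => //; exact: fk.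
- apply/measurable_EFinP; apply: measurableT_comp => //.
  exact: measurable_funTS.
Qed.

Lemma Rintegral_supported (D : set R) (k : R -> R) :
  (forall x, ~ D x -> k x = 0) ->
  \int[leb]_(x in D) k x = \int[leb]_x k x.
Proof.
move=> kD; rewrite [LHS]Rintegral_mkcond; apply: eq_Rintegral => x _.
by rewrite patchE; case: ifPn => //; rewrite notin_setE => /kD.
Qed.

Lemma integrable_patch_itv (k : R -> R) (a b : R) : locally_integrable setT k ->
  leb.-integrable setT (EFin \o (k \_ `[a, b])).
Proof.
move=> /(@locally_integrable_itv _ k a b) ik.
by rewrite -restrict_EFin; apply: (integrable_mkcond _ _).1.
Qed.

(* Fubini on the triangle a <= x <= y <= b. *)
Lemma Rintegral_triangle (P Q p q : R -> R) (a b : R) :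
  locally_integrable setT p -> locally_integrable setT q ->
  (forall c d, c <= d -> P d - P c = \int[leb]_(x in `[c, d]) p x) ->
  (forall c d, c <= d -> Q d - Q c = \int[leb]_(x in `[c, d]) q x) ->
  \int[leb]_(x in `[a, b]) (p x * (Q b - Q x)) =
  \int[leb]_(x in `[a, b]) (q x * (P x - P a)).
Proof.
move=> lp lq incP incQ.
have mp : measurable_fun setT (p \_ `[a, b]).
  by apply/measurable_EFinP; case/integrableP : (integrable_patch_itv a b lp).
have mq : measurable_fun setT (q \_ `[a, b]).
  by apply/measurable_EFinP; case/integrableP : (integrable_patch_itv a b lq).
pose f (z : measurableTypeR R * measurableTypeR R) : R :=
  (p \_ `[a, b]) z.1 * (q \_ `[a, b]) z.2 * (z.1 <= z.2)%R%:R.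
have mle : measurable_fun setT
    (fun z : measurableTypeR R * measurableTypeR R => (z.1 <= z.2)%R%:R : R).
  rewrite (_ : (fun _ => _) = \1_[set z : measurableTypeR R * measurableTypeR R | z.1 <= z.2]); last first.
    by apply/funext => z; rewrite indicE; case: (boolP (z.1 <= z.2)) => h;
      [rewrite mem_set|rewrite memNset//; apply/negP].
  apply: measurable_indic; rewrite -[X in measurable X]setTI.
  apply: (measurable_fun_ler measurable_fst measurable_snd).
    exact: measurableT.
  by [].
have mf : measurable_fun setT (EFin \o f).
  apply/measurable_EFinP; apply: measurable_funM => //; apply: measurable_funM.
    exact: (measurableT_comp mp measurable_fst).
  exact: (measurableT_comp mq measurable_snd).
have If : (leb \x leb)%E.-integrable setT (EFin \o f).
  apply/integrable12ltyP => //.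
  apply: (@le_lt_trans _ _ (\int[leb]_x (`|(p \_ `[a, b]) x|%:E * \int[leb]_y `|(q \_ `[a, b]) y|%:E))%E).
    apply: le_nnintegral => x _; first exact: integral_ge0.
    rewrite -ge0_integralZl//; last by apply/measurable_EFinP; apply: measurableT_comp.
    apply: le_nnintegral => // y _; rewrite /f /= -EFinM lee_fin !normrM.
    by apply: ler_piMr => //; rewrite normr_nat lern1; case: (_ <= _).
  have [_ ip] := integrableP _ _ _ (integrable_patch_itv a b lp).
  have [_ iq] := integrableP _ _ _ (integrable_patch_itv a b lq).
  rewrite ge0_integralZr//.
  - apply: lte_mul_pinfty => //; first exact: integral_ge0.
    by rewrite ge0_fin_numE// integral_ge0.
  - by apply/measurable_EFinP; apply: measurableT_comp.
  - exact: integral_ge0.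
have := Fubini If; rewrite /Rintegral => fub.
rewrite integral_mkcond [in RHS]integral_mkcond; congr fine.
transitivity (\int[leb]_x \int[leb]_y (EFin \o f) (x, y))%E; last rewrite fub.
  apply: eq_integral => x _; rewrite /f /= [in LHS]patchE; case: ifPn => xab; last first.
    under eq_integral do rewrite [(p \_ _) x]patchE (negbTE xab) !mul0r.
    by rewrite integral0.
  move: (xab); rewrite inE /= in_itv /= => /andP[ax xb].
  rewrite incQ// /Rintegral EFinM fineK; last first.
    by apply: integrable_fin_num => //; exact: locally_integrable_itv.
  rewrite -integralZl//; last exact: locally_integrable_itv.
  rewrite integral_mkcond; apply: eq_integral => y _.
  rewrite !patchE xab !mem_setE !in_itv /=.
  case: (leP x y) => xy; rewrite /= ?(le_trans ax xy) ?mulr1 ?mulr0//=.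
  by case: ifPn => // _; rewrite mulr0.
apply: eq_integral => y _; rewrite /f /= [in RHS]patchE; case: ifPn => yab; last first.
  under eq_integral do rewrite [(q \_ _) y]patchE (negbTE yab) mulr0 mul0r.
  by rewrite integral0.
move: (yab); rewrite inE /= in_itv /= => /andP[ay yb].
rewrite incP// /Rintegral EFinM fineK; last first.
  by apply: integrable_fin_num => //; exact: locally_integrable_itv.
rewrite -integralZl//; last exact: locally_integrable_itv.
rewrite [RHS]integral_mkcond; apply: eq_integral => x _.
rewrite !patchE yab !mem_setE !in_itv /=.
case: (leP x y) => xy; rewrite /= ?mulr1 ?mulr0 ?andbF//=.
by rewrite andbT (le_trans xy yb) andbT; case: ifPn => _; rewrite ?mul0r// -EFinM mulrC.
Qed.

(** Expanding the two sides of [Rintegral_triangle], the constants [Q b] and [P a] produce exactly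
    the boundary terms. No differentiability of the factors enters. *)
Lemma product_rule (P Q p q : R -> R) (a b : R) :
  locally_integrable setT p -> locally_integrable setT q ->
  continuous P -> continuous Q ->
  (forall c d, c <= d -> P d - P c = \int[leb]_(x in `[c, d]) p x) ->
  (forall c d, c <= d -> Q d - Q c = \int[leb]_(x in `[c, d]) q x) ->
  a <= b ->
  P b * Q b - P a * Q a = \int[leb]_(x in `[a, b]) (p x * Q x + q x * P x).
Proof.
move=> lp lq cP cQ incP incQ ab.
have ii k : locally_integrable setT k -> leb.-integrable `[a, b] (EFin \o k).
  exact: locally_integrable_itv.
have lpQ := locally_integrable_mul_continuous lp cQ.
have lqP := locally_integrable_mul_continuous lq cP.
have := Rintegral_triangle a b lp lq incP incQ.
have -> : \int[leb]_(x in `[a, b]) (p x * (Q b - Q x)) =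
    (P b - P a) * Q b - \int[leb]_(x in `[a, b]) (p x * Q x).
  rewrite incP// -RintegralZr//; last exact: ii.
  rewrite -RintegralB//; [|exact: (ii _ (locally_integrable_mul_continuous lp (@cst_continuous _ _ _)))|exact: ii].
  by apply: eq_Rintegral => x _; rewrite mulrBr.
have -> : \int[leb]_(x in `[a, b]) (q x * (P x - P a)) =
    \int[leb]_(x in `[a, b]) (q x * P x) - (Q b - Q a) * P a.
  rewrite incQ// -RintegralZr//; last exact: ii.
  rewrite -RintegralB//; [|exact: ii|exact: (ii _ (locally_integrable_mul_continuous lq (@cst_continuous _ _ _)))].
  by apply: eq_Rintegral => x _; rewrite mulrBr.
rewrite RintegralD//; [|exact: ii|exact: ii].
move=> e.
have -> : \int[leb]_(x in `[a, b]) (q x * P x) = (P b - P a) * Q b -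
  \int[leb]_(x in `[a, b]) (p x * Q x) + (Q b - Q a) * P a by rewrite e subrK.
ring.
Qed.

End ProductRule.

(** * Weak derivatives *)

Section Primitive.
Context {R : realType}.
Local Notation leb := (@lebesgue_measure R).

Lemma locally_integrable_continuous (k : R -> R) :
  continuous k -> locally_integrable setT k.
Proof.
move=> ck; split; [exact: continuous_measurable_fun|exact: openT|].
move=> K _ cK; have := @continuous_compact_integrable R k K cK (continuous_subspaceT ck).
by case/integrableP.
Qed.

Lemma primitive_derivable (K k : R -> R) (x : R) :
  continuous k ->
  (forall a b, a <= b -> K b - K a = \int[leb]_(x in `[a, b]) k x) ->
  derivable K x 1 /\ derive1 K x = k x.
Proof.
move=> ck inc; apply: Lebesgue_pt_derivable => //.
  exact: locally_integrable_continuous.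
apply: (@continuous_lebesgue_pt _ _ _ setT) => //.
  exact: (open_nbhsT x).
  exact: continuous_measurable_fun.
exact: ck.
Qed.

Lemma primitive_continuous (K k : R -> R) :
  locally_integrable setT k ->
  (forall a b, a <= b -> K b - K a = \int[leb]_(x in `[a, b]) k x) ->
  continuous K.
Proof.
move=> lk inc x.
have ab : x - 1 < x + 1 by rewrite ltrD2l; lra.
have := parameterized_integral_continuous (ltW ab) (locally_integrable_itv (x - 1) (x + 1) lk).
move/(continuous_within_itvP _ ab) => [+ _ _] => /(_ x).
rewrite in_itv /= ltrBlDr !ltrDl !ltr01 => /(_ isT) cF.
have cFK : {for x, continuous (fun y => parameterized_integral leb (x - 1) y k + K (x - 1))}.
  by apply: cvgD => //; exact: cvg_cst.
have nF : {near x, (fun y => parameterized_integral leb (x - 1) y k + K (x - 1)) =1 K}.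
  have : \forall y \near x, x - 1 < y by apply: lt_nbhsr; rewrite ltrBlDr ltrDl.
  by apply: filterS => y xy; rewrite /parameterized_integral -inc ?ltW//= subrK.
rewrite /continuous_at -(nbhs_singleton nF).
by apply: cvg_trans cFK; exact: near_eq_cvg.
Qed.

Definition primitive (a : R) (k : R -> R) (x : R) : R :=
  if a <= x then \int[leb]_(z in `[a, x]) k z
  else - \int[leb]_(z in `[x, a]) k z.

Lemma primitive_increment (a : R) (k : R -> R) : locally_integrable setT k ->
  forall c d, c <= d ->
  primitive a k d - primitive a k c = \int[leb]_(x in `[c, d]) k x.
Proof.
move=> lk c d cd; rewrite /primitive.
case: (leP a c) => ac; case: (leP a d) => ad.
- by rewrite (Rintegral_segD lk ac cd) addrAC subrr add0r.
- by move: (lt_le_trans ad ac); rewrite ltNge cd.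
- by rewrite (Rintegral_segD lk (ltW ac) ad) opprK addrC.
- rewrite (Rintegral_segD lk cd (ltW ad)); ring.
Qed.

Lemma derive1_increment (K : R -> R) :
  (forall x, derivable K x 1) -> continuous (derive1 K) ->
  forall a b, a <= b -> K b - K a = \int[leb]_(x in `[a, b]) (derive1 K x).
Proof.
move=> dK cK a b; rewrite le_eqVlt => /orP[/eqP ->|ab].
  by rewrite subrr set_itv1 Rintegral_set1.
have cKc : continuous K.
  by move=> x; apply/differentiable_continuous/derivable1_diffP.
have dKab : derivable_oo_LRcontinuous K a b.
  split; [by move=> x _; exact: dK| |].
    by apply: cvg_at_right_filter; exact: cKc.
  by apply: cvg_at_left_filter; exact: cKc.
have cKab : {within `[a, b], continuous (derive1 K)}.
  exact: continuous_subspaceT.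
have e := @continuous_FTC2 R (derive1 K) K a b ab cKab dKab (fun _ _ => erefl).
by rewrite /Rintegral e.
Qed.

(* The primitive of [k] is constant on the interval, and its derivative is [k]. *)
Lemma continuous_Rintegral_eq0 (k : R -> R) (a b : R) :
  continuous k -> (forall x, 0 <= k x) ->
  \int[leb]_(x in `[a, b]) k x = 0 -> forall x, a < x < b -> k x = 0.
Proof.
move=> ck k0 ik x /andP[ax xb].
have lk := locally_integrable_continuous ck.
have inc := primitive_increment a lk.
have [_ <-] := primitive_derivable x ck inc.
have nd c d : c <= d -> primitive a k c <= primitive a k d.
  by move=> cd; rewrite -subr_ge0 inc//; apply: Rintegral_ge0 => *.
have pa : primitive a k a = 0 by rewrite /primitive lexx set_itv1 Rintegral_set1.
have pb : primitive a k b = 0.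
  by move: (inc a b (ltW (lt_trans ax xb))); rewrite ik pa subr0.
have nz : {near x, cst 0 =1 primitive a k}.
  apply: filterS2 (lt_nbhsr ax) (lt_nbhsl xb) => y ay yb; apply/eqP.
  rewrite eq_le /cst; apply/andP; split.
    by rewrite -pa nd// ltW.
  by rewrite -pb nd// ltW.
by rewrite derive1E -(near_eq_derive _ nz) derive_cst.
Qed.

End Primitive.

Section WeakDerivative.
Context {R : realType}.
Local Notation leb := (@lebesgue_measure R).

(** The conclusion is vanishing near [x], not only at [x], so that the derivatives of [phi] at [x]
    vanish too. *)
Lemma compactly_supported_far (V : normedModType R) (phi : V -> R) :
  compactly_supported phi -> exists2 A : R, 0 < A &
  forall x : V, A <= `|x| -> {near x, cst 0 =1 phi}.
Proof.
move=> /compact_bounded[M [_ MC]].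
exists (`|M| + 1); first by rewrite ltr_pwDr.
move=> x Ax; have nC : ~ closure [set p | phi p != 0] x.
  (* Boundedness provides bounds strictly above [M] only; [|M| + 1/2] lies strictly between [M] and
     the radius [|M| + 1]. *)
  move=> Cx; have := MC (`|M| + 2^-1) _ _ Cx.
  have M1 : M < `|M| + 2^-1 by rewrite ltr_pwDr ?ler_norm// invr_gt0.
  by move=> /(_ M1) /(le_trans Ax); rewrite lerD2l leNgt invf_lt1 ?ltr1n// .
have : nbhs x (~` closure [set p | phi p != 0]).
  by apply: open_nbhs_nbhs; split => //; rewrite openC; exact: closed_closure.
move=> nx; apply: filterS nx => y; apply: contra_notP => /eqP yn.
by apply: subset_closure; rewrite /= eq_sym.
Qed.

Lemma compactly_supported_segment (phi : R -> R) (a b : R) :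
  (forall x, ~ `[a, b]%classic x -> phi x = 0) -> compactly_supported phi.
Proof.
move=> phi0; apply: (subclosed_compact _ (@segment_compact _ a b)) => //.
  exact: closed_closure.
have /closure_id -> : closed `[a, b]%classic by exact: interval_closed.
by apply: closureS => x /= /eqP; apply: contra_notP => /phi0.
Qed.

Lemma C1c_support (phi : R -> R) : C1c phi -> exists2 A : R, 0 < A &
  forall x : R, A <= `|x| -> phi x = 0 /\ derive1 phi x = 0.
Proof.
move=> [_ _ /compactly_supported_far[A A0 far]]; exists A => // x /far nz.
by rewrite -(nbhs_singleton nz) derive1E -(near_eq_derive _ nz) derive_cst.
Qed.

(** Integration by parts on a segment [[- A, A]] at whose ends and beyond which the test function
    vanishes, so that the boundary terms drop out. *)
Lemma increment_weak_derivative (u g : R -> R) :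
  continuous u -> locally_integrable setT g ->
  (forall a b, a <= b -> u b - u a = \int[leb]_(x in `[a, b]) g x) ->
  weak_derivative u g.
Proof.
move=> cu lg inc; split => // phi Cphi.
have [dphi cphi' _] := Cphi.
have [A A0 sA] := C1c_support Cphi.
have cphi : continuous phi.
  by move=> x; apply/differentiable_continuous/derivable1_diffP.
have AA : - A <= A by rewrite ge0_cp// ltW.
have incphi := derive1_increment dphi cphi'.
have lphi := locally_integrable_continuous cphi'.
have := product_rule lg lphi cu cphi inc incphi AA.
have [pA _] : phi A = 0 /\ derive1 phi A = 0 by apply: sA; exact: ler_norm.
have [pNA _] : phi (- A) = 0 /\ derive1 phi (- A) = 0.
  by apply: sA; rewrite normrN ler_norm.
rewrite pA pNA.
have nin x : ~ `[- A, A]%classic x -> A <= `|x|.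
  move=> /=; rewrite in_itv /= => /negP; rewrite -ler_norml -ltNge; exact: ltW.
rewrite RintegralD//; last 2 first.
- exact: (locally_integrable_itv _ _ (locally_integrable_mul_continuous lg cphi)).
- exact: (locally_integrable_itv _ _ (locally_integrable_mul_continuous lphi cu)).
rewrite !mulr0 subrr.
rewrite (@Rintegral_supported _ `[- A, A]%classic (fun x => g x * phi x)); last first.
  by move=> x /nin /sA[-> _]; rewrite mulr0.
rewrite (@Rintegral_supported _ `[- A, A]%classic (fun x => derive1 phi x * u x)); last first.
  by move=> x /nin /sA[_ ->]; rewrite mul0r.
move=> /esym/eqP; rewrite addrC addr_eq0 => /eqP <-.
by apply: eq_Rintegral => x _; rewrite mulrC.
Qed.

Lemma Rintegral_itv_eq0 (q : R -> R) (c d : R) : locally_integrable setT q ->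
  (forall y : R, c < y < d -> q y = 0) -> \int[leb]_(y in `[c, d]) q y = 0.
Proof.
move=> lq cd; rewrite -(@Rintegral_itv_obnd_cbnd R c (BRight d)); last first.
  apply: integrableS (locally_integrable_itv c d lq) => //.
  by apply: subset_itv; rewrite bnd_simp.
rewrite -(@Rintegral_itv_bndo_bndc R (BRight c) d); last first.
  apply: integrableS (locally_integrable_itv c d lq) => //.
  by apply: subset_itv; rewrite bnd_simp.
rewrite (@eq_Rintegral _ _ _ leb _ (cst 0)) ?Rintegral_cst ?mul0r//.
by move=> y /set_mem /= ycd; rewrite (cd y)//; move: ycd; rewrite in_itv.
Qed.

(** Zero mean is what makes the primitive vanish again beyond [b]; it thus exhibits [q] as the
    derivative of a test function. *)
Lemma C1c_primitive (q : R -> R) (a b : R) : a <= b -> continuous q ->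
  (forall x, ~ `[a, b]%classic x -> q x = 0) ->
  \int[leb]_(x in `[a, b]) q x = 0 ->
  C1c (primitive a q) /\ derive1 (primitive a q) = q.
Proof.
move=> ab cq sq iq; have lq := locally_integrable_continuous cq.
have inc := primitive_increment a lq.
have d x := primitive_derivable x cq inc.
have dE : derive1 (primitive a q) = q by apply/funext => x; exact: (d x).2.
split => //; split; [by move=> x; exact: (d x).1|by rewrite dE|].
apply: (@compactly_supported_segment _ a b) => x /negP; rewrite /= in_itv /= => nx.
have z c d' : (forall y : R, c < y < d' -> q y = 0) -> \int[leb]_(y in `[c, d']) q y = 0.
  exact: Rintegral_itv_eq0.
rewrite /primitive; case: (leP a x) nx => /= [ax|xa _].
  rewrite -ltNge => bx; rewrite (Rintegral_segD lq ab (ltW bx)) iq add0r z//.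
  move=> y /andP[yb _]; apply: sq; rewrite /= in_itv /= => /andP[_].
  by rewrite leNgt yb.
rewrite z ?oppr0// => y /andP[_ ya]; apply: sq; rewrite /= in_itv /= => /andP[].
by rewrite leNgt ya.
Qed.

(** Both densities are almost everywhere the derivative of [u]. *)
Lemma increment_ae_unique (u g1 g2 : R -> R) :
  locally_integrable setT g1 -> locally_integrable setT g2 ->
  (forall a b, a <= b -> u b - u a = \int[leb]_(x in `[a, b]) g1 x) ->
  (forall a b, a <= b -> u b - u a = \int[leb]_(x in `[a, b]) g2 x) ->
  {ae leb, forall x : measurableTypeR R, g1 x = g2 x}.
Proof.
move=> l1 l2 /(Lebesgue_ae_derivable l1) a1 /(Lebesgue_ae_derivable l2) a2.
have F := ae_filter_ringOfSetsType leb.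
by apply: filterS2 a1 a2 => x [_ <-] [_ <-].
Qed.

End WeakDerivative.

(** * The du Bois-Reymond lemma *)

Section DuBoisReymond.
Context {R : realType}.
Local Notation leb := (@lebesgue_measure R).

(* du Bois-Reymond: [w = u - primitive] satisfies [int w q = 0] for every
   continuous [q] of zero mean supported in [[a, b]]; take [q = (w - c) eta]
   where [c] is the [eta]-average of [w]. *)
Lemma weak_derivative_increment (u g : R -> R) :
  continuous u -> weak_derivative u g ->
  forall a b, a <= b -> u b - u a = \int[leb]_(x in `[a, b]) g x.
Proof.
move=> cu [lg wd].
pose G := primitive 0 g.
have incG := primitive_increment 0 lg.
have cG : continuous G by exact: primitive_continuous incG.
pose w x := u x - G x.
have cw : continuous w by move=> x; apply: cvgB; [exact: cu|exact: cG].
have [_ wdG] := increment_weak_derivative cG lg incG.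
have intp (q phi : R -> R) : continuous q -> C1c phi ->
    leb.-integrable setT (EFin \o (fun x => q x * derive1 phi x)).
  move=> cq Cphi; have [A A0 sA] := C1c_support Cphi.
  have [_ cphi' _] := Cphi.
  rewrite (_ : _ \o _ = (fun x => (q x * derive1 phi x)%:E) \_ `[- A, A]%classic).
    apply: (integrable_mkcond _ _).1 => //; apply: locally_integrable_itv.
    by apply: locally_integrable_continuous => x; apply: cvgM; [exact: cq|exact: cphi'].
  apply/funext => x; rewrite /= patchE; case: ifPn => //.
  rewrite mem_setE in_itv /= -ler_norml -ltNge => /ltW/sA[_ ->].
  by rewrite mulr0.
have wphi phi : C1c phi -> \int[leb]_x (w x * derive1 phi x) = 0.
  move=> Cphi; rewrite -(subrr (\int[leb]_x (u x * derive1 phi x))).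
  rewrite {2}wd// -wdG// -RintegralB//; [|exact: intp|exact: intp].
  by apply: eq_Rintegral => x _; rewrite mulrBl.
have constw a b : a < b -> exists c, forall x, a < x < b -> w x = c.
  move=> ab; pose eta x := Num.max 0 ((x - a) * (b - x)).
  have ceta : continuous eta.
    move=> x; apply: (@continuous_max _ _ (cst 0) (fun x => (x - a) * (b - x))).
      exact: cst_continuous.
    apply: cvgM; first by apply: cvgB => //; exact: cvg_cst.
    by apply: cvgB => //; exact: cvg_cst.
  have eta0 x : 0 <= eta x by rewrite /eta le_max lexx.
  have etaout x : ~ `[a, b]%classic x -> eta x = 0.
    rewrite /= in_itv /= => nx; apply/max_idPl; apply: contra_notP nx => /negP.
    rewrite -ltNge => h; apply/andP; split; rewrite leNgt; apply/negP => h'; nra.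
  have ieta : \int[leb]_(x in `[a, b]) eta x != 0.
    apply/eqP => /(continuous_Rintegral_eq0 ceta eta0)/(_ ((a + b) / 2)).
    have h : a < (a + b) / 2 < b by apply/andP; split; lra.
    move=> /(_ h); apply/eqP; rewrite gt_eqF// /eta lt_max; apply/orP; right; nra.
  have ii (k : R -> R) : continuous k -> leb.-integrable `[a, b] (EFin \o k).
    by move=> ck; apply: locally_integrable_itv; exact: locally_integrable_continuous.
  have cweta : continuous (fun x => w x * eta x).
    by move=> x; apply: cvgM; [exact: cw|exact: ceta].
  pose c := \int[leb]_(x in `[a, b]) (w x * eta x) / \int[leb]_(x in `[a, b]) eta x.
  pose q x := (w x - c) * eta x.
  have cq : continuous q.
    move=> x; apply: cvgM; last exact: ceta.
    by apply: cvgB; [exact: cw|exact: cvg_cst].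
  have ceta' : continuous (fun x => c * eta x).
    by move=> x; apply: cvgM; [exact: cvg_cst|exact: ceta].
  have iq : \int[leb]_(x in `[a, b]) q x = 0.
    rewrite (@eq_Rintegral _ _ _ leb _ (fun x => w x * eta x - c * eta x)); last first.
      by move=> x _; rewrite /q mulrBl.
    rewrite RintegralB//; [|exact: ii|exact: ii].
    by rewrite RintegralZl//; [rewrite /c divfK// subrr|exact: ii].
  have qout x : ~ `[a, b]%classic x -> q x = 0 by move=> /etaout h; rewrite /q h mulr0.
  have [C1 dE] := C1c_primitive (ltW ab) cq qout iq.
  have := wphi _ C1; rewrite dE -(@Rintegral_supported _ `[a, b]%classic); last first.
    by move=> x /qout ->; rewrite mulr0.
  move=> iwq.
  have cwq : continuous (fun x => w x * q x).
    by move=> x; apply: cvgM; [exact: cw|exact: cq].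
  have ccq : continuous (fun x => c * q x).
    by move=> x; apply: cvgM; [exact: cvg_cst|exact: cq].
  (* As [w q] and [q] both have integral zero, so has [(w - c) q = (w - c) ^ 2 eta], which is
     nonnegative; this forces [w = c] where [eta > 0], that is, inside []a, b[]. *)
  have isq : \int[leb]_(x in `[a, b]) ((w x - c) * q x) = 0.
    rewrite (@eq_Rintegral _ _ _ leb _ (fun x => w x * q x - c * q x)); last first.
      by move=> x _; rewrite mulrBl.
    rewrite RintegralB//; [|exact: ii|exact: ii].
    by rewrite RintegralZl//; [rewrite iwq iq mulr0 subrr|exact: ii].
  exists c => x axb.
  have := @continuous_Rintegral_eq0 R (fun x => (w x - c) * q x) a b _ _ isq x axb.
  have h1 : continuous (fun x => (w x - c) * q x).
    move=> z; apply: cvgM; last exact: cq.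
    by apply: cvgB; [exact: cw|exact: cvg_cst].
  have h2 z : 0 <= (w z - c) * q z by rewrite /q mulrA -expr2 mulr_ge0// sqr_ge0.
  move=> /(_ h1 h2)/eqP; rewrite /q mulrA -expr2 mulf_eq0 sqrf_eq0 subr_eq0.
  move=> /orP[/eqP//|/eqP e]; move: e; rewrite /eta.
  have /andP[ax xb] := axb.
  by move/max_idPl; nra.
have wcst x z : w x = w z.
  have xz0 : 0 <= `|x| + `|z| by rewrite addr_ge0.
  have [c wc] := constw (- (`|x| + `|z| + 1)) (`|x| + `|z| + 1) ltac:(lra).
  have [hx1 hx2] := ler_normlP _ _ (lexx `|x|).
  have [hz1 hz2] := ler_normlP _ _ (lexx `|z|).
  by have z0 := normr_ge0 z; have x0 := normr_ge0 x; rewrite !wc//;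
    apply/andP; split; lra.
move=> a b ab; rewrite -incG//; have := wcst a b; rewrite /w /G; lra.
Qed.

End DuBoisReymond.

(** * The initial datum in Lagrangian coordinates *)

Section PseudoInverse.
Context {R : realType}.
Local Notation leb := (@lebesgue_measure R).
Variable mubar : {finmeas R}.

Local Notation X := (xbar mubar).
Let M := fine (mubar setT).
Let Gm (x : R) := fine (mubar `]-oo, x[%classic).
Let Gp (x : R) := fine (mubar `]-oo, x]%classic).

Lemma finmeas_fin_num (A : set (measurableTypeR R)) :
  measurable A -> mubar A \is a fin_num.
Proof. by move=> mA; exact: fin_num_measure. Qed.

Lemma finmeas_le (A B : set (measurableTypeR R)) :
  measurable A -> measurable B -> A `<=` B -> fine (mubar A) <= fine (mubar B).
Proof.
move=> mA mB AB; apply: fine_le; [exact: finmeas_fin_num|exact: finmeas_fin_num|].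
by apply: le_measure => //; rewrite inE.
Qed.

Lemma dist_lt_le x y : x < y -> Gp x <= Gm y.
Proof.
move=> xy; apply: finmeas_le => // z; rewrite /= !in_itv /= => zx.
exact: le_lt_trans zx xy.
Qed.

Lemma dist_le x : Gm x <= Gp x.
Proof. by apply: finmeas_le => // z; rewrite /= !in_itv /=; exact: ltW. Qed.

Lemma dist_left_mono x y : x <= y -> Gm x <= Gm y.
Proof.
rewrite le_eqVlt => /orP[/eqP -> //|xy].
exact: le_trans (dist_le x) (dist_lt_le xy).
Qed.

Lemma dist_left_ge0 x : 0 <= Gm x. Proof. exact: fine_ge0. Qed.

Lemma dist_right_leM x : Gp x <= M. Proof. exact: finmeas_le. Qed.

(** Left continuity of [Gm]: the half-lines []-oo, x - 1/(n+1)[] increase to the open half-line at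
    [x]. *)
Lemma dist_left_sup x a : (forall y, y < x -> y + Gm y <= a) -> x + Gm x <= a.
Proof.
move=> h; pose F n : set (measurableTypeR R) := `]-oo, x - n.+1%:R^-1[%classic.
have cF : (mubar \o F) n @[n --> \oo] --> mubar (\bigcup_n F n).
  have mF n : measurable (F n) by exact: measurable_itv.
  apply: nondecreasing_cvg_mu; [exact: mF|exact: bigcupT_measurable|].
  move=> n m nm; apply/subsetPset => z; rewrite /F /= !in_itv /= => /lt_le_trans; apply.
  by rewrite lerB// lef_pV2 ?posrE// ler_nat.
have bF : \bigcup_n F n = `]-oo, x[%classic.
  apply/seteqP; split => z /=.
    by move=> [n _]; rewrite /F /= !in_itv /= => /lt_trans; apply; rewrite ltrBlDr ltrDl invr_gt0.
  rewrite in_itv /= => zx; have xz : 0 < x - z by rewrite subr_gt0.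
  exists (Num.bound (x - z)^-1) => //; rewrite /F /= in_itv /= ltrBrDr addrC -ltrBrDr.
  rewrite invf_plt ?posrE// (lt_le_trans (archi_boundP _))//.
    by rewrite invr_ge0 ltW.
  by rewrite ler_nat.
have cf : fine ((mubar \o F) n) @[n --> \oo] --> Gm x.
  rewrite bF in cF; apply: fine_cvg; rewrite /Gm fineK//.
  exact: finmeas_fin_num.
have ch : ((x - n.+1%:R^-1) + fine ((mubar \o F) n)) @[n --> \oo] --> (x - 0) + Gm x.
  apply: cvgD => //; apply: cvgB; first exact: cvg_cst.
  exact: cvg_harmonic.
rewrite -[X in X + _](subr0 x); apply: (@closed_cvg _ _ _ _ _ [set r | r <= a] _ _ _ ch).
  exact: closed_le.
by near=> n; apply: h; rewrite ltrBlDr ltrDl invr_gt0.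
Unshelve. all: by end_near. Qed.

(** The open half-lines []-oo, x + 1/(n+1)[] decrease to the closed half-line at [x], so the right
    limit of [Gm] is [Gp]; finiteness of [mubar] is what permits the decreasing limit. *)
Lemma dist_right_inf x a : (forall y, x < y -> a <= y + Gm y) -> a <= x + Gp x.
Proof.
move=> h; pose F n : set (measurableTypeR R) := `]-oo, x + n.+1%:R^-1[%classic.
have bF : \bigcap_n F n = `]-oo, x]%classic.
  apply/seteqP; split => z /=; rewrite in_itv /=; last first.
    by move=> zx n _; rewrite /F /= in_itv /= (le_lt_trans zx)// ltrDl invr_gt0.
  move=> Fz; rewrite leNgt; apply/negP => xz; have zx : 0 < z - x by rewrite subr_gt0.
  have := Fz (Num.bound (z - x)^-1) I; rewrite /F /= in_itv /= -ltrBlDl.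
  apply/negP; rewrite -leNgt invf_ple ?posrE//; apply: ltW.
  rewrite (lt_le_trans (archi_boundP _))//; first by rewrite invr_ge0 ltW.
  by rewrite ler_nat.
have cF : (mubar \o F) n @[n --> \oo] --> mubar (\bigcap_n F n).
  have mF n : measurable (F n) by exact: measurable_itv.
  apply: nonincreasing_cvg_mu; [by rewrite ltey_eq finmeas_fin_num|exact: mF|by rewrite bF|].
  - move=> n m nm; apply/subsetPset => z; rewrite /F /= !in_itv /= => /lt_le_trans; apply.
    by rewrite lerD2l lef_pV2 ?posrE// ler_nat.
have cf : fine ((mubar \o F) n) @[n --> \oo] --> Gp x.
  rewrite bF in cF; apply: fine_cvg; rewrite /Gp fineK//.
  exact: finmeas_fin_num.
have ch : ((x + n.+1%:R^-1) + fine ((mubar \o F) n)) @[n --> \oo] --> (x + 0) + Gp x.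
  apply: cvgD => //; apply: cvgD; first exact: cvg_cst.
  exact: cvg_harmonic.
rewrite -[X in X + _](addr0 x); apply: (@closed_cvg _ _ _ _ _ [set r | a <= r] _ _ _ ch).
  exact: closed_ge.
by near=> n; apply: h; rewrite ltrDl invr_gt0.
Unshelve. all: by end_near. Qed.

(** The supremum of the points satisfying the left inequality satisfies both: the left one by left
    continuity, the right one because every larger point violates the left one. Hence [xget] never
    returns its default value. *)
Lemma xbarP a : X a + Gm (X a) <= a <= X a + Gp (X a).
Proof.
pose E := [set x : R | x + Gm x <= a].
have M0 : 0 <= M by exact: fine_ge0.
have E0 : E (a - M) by rewrite /E /= addrAC -addrA gerDl subr_le0 (le_trans (dist_le _))// dist_right_leM.
have Eub : ubound E a.
  by move=> x; rewrite /E /=; apply: le_trans; rewrite lerDl dist_left_ge0.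
have hs : has_sup E by split; [exists (a - M)|exists a].
rewrite /xbar; apply: (@xgetPex _ 0 [set x : R | x + Gm x <= a <= x + Gp x]).
exists (sup E); apply/andP; split.
  apply: dist_left_sup => y /(sup_gt hs.1)[x Ex yx].
  by apply: le_trans (lerD (ltW yx) (dist_left_mono (ltW yx))) Ex.
apply: dist_right_inf => y sy; rewrite leNgt; apply/negP => h.
by have := sup_upper_bound hs (ltW h); rewrite leNgt sy.
Qed.

(** With [xbar_le], a Galois connection: preimages of half-lines under [X] are half-lines, with end
    [x + Gm x] for open ones and [x + Gp x] for closed ones. All later facts on [X] come from these
    two equivalences. *)
Lemma xbar_lt a x : (X a < x) = (a < x + Gm x).
Proof.
have /andP[h1 h2] := xbarP a; apply/idP/idP => h; last first.
  rewrite ltNge; apply/negP => xX; move: h; rewrite ltNge => /negP; apply.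
  by rewrite (le_trans _ h1)// lerD// dist_left_mono.
by rewrite (le_lt_trans h2)// ltr_leD// dist_lt_le.
Qed.

Lemma xbar_le a x : (X a <= x) = (a <= x + Gp x).
Proof.
have /andP[h1 h2] := xbarP a; apply/idP/idP => h.
  rewrite (le_trans h2)//; move: h; rewrite le_eqVlt => /orP[/eqP ->//|h].
  by apply: lerD (ltW h) (le_trans (dist_lt_le h) (dist_le _)).
rewrite leNgt; apply/negP => xX; move: h; apply/negP; rewrite -ltNge.
by rewrite (lt_le_trans _ h1)// ltr_leD// dist_lt_le.
Qed.

Lemma xbar_nondecreasing : {homo X : a b / a <= b}.
Proof.
move=> a b ab; rewrite xbar_le (le_trans ab)//.
by have /andP[_] := xbarP b.
Qed.

Lemma xbar_lipschitz a b : a <= b -> X b - X a <= b - a.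
Proof.
move=> ab; have := xbar_nondecreasing ab; rewrite le_eqVlt => /orP[/eqP ->|Xab].
  by rewrite subrr subr_ge0.
have /andP[_ h1] := xbarP a; have /andP[h2 _] := xbarP b.
have := dist_lt_le Xab; lra.
Qed.

Lemma xbar_dist_left x : X (x + Gm x) = x.
Proof.
apply/eqP; rewrite eq_le xbar_le lerD2l dist_le /= leNgt xbar_lt ltxx//.
Qed.

Lemma xbar_bounds a : Gm (X a) <= a - X a <= Gp (X a).
Proof. by have /andP[h1 h2] := xbarP a; apply/andP; split; lra. Qed.

Lemma xbar_gap a : 0 <= a - X a <= M.
Proof.
have /andP[h1 h2] := xbar_bounds a; apply/andP; split.
  exact: le_trans (dist_left_ge0 _) h1.
exact: le_trans h2 (dist_right_leM _).
Qed.

Lemma lipschitz_continuous (K : R -> R) (C : R) :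
  (forall a b, a <= b -> `|K b - K a| <= C * (b - a)) -> continuous K.
Proof.
move=> KC x; apply/cvgrPdist_le => e e0.
have C1 : 0 < `|C| + 1 by rewrite ltr_pwDr.
near=> z.
have H : `|K x - K z| <= (`|C| + 1) * `|x - z|.
  have [xz|zx] := leP x z.
    rewrite distrC (distrC x) (ger0_norm (_ : 0 <= z - x)) ?subr_ge0//.
    rewrite (le_trans (KC _ _ xz))// ler_wpM2r ?subr_ge0//.
    by rewrite (le_trans (ler_norm C))// lerDl.
  rewrite (ger0_norm (_ : 0 <= x - z)) ?subr_ge0; last exact: ltW.
  apply: le_trans (KC _ _ (ltW zx)) _; apply: ler_wpM2r.
    by rewrite subr_ge0 ltW.
  by rewrite (le_trans (ler_norm C))// lerDl.
rewrite (le_trans H)// mulrC -ler_pdivlMr//.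
near: z; apply: (@cvgr_dist_le _ _ _ _ _ id x) => //; exact: divr_gt0.
Unshelve. all: by end_near. Qed.

Lemma xbar_continuous : continuous X.
Proof.
apply: (@lipschitz_continuous _ 1) => a b ab.
by rewrite mul1r ger0_norm ?subr_ge0 ?xbar_nondecreasing// xbar_lipschitz.
Qed.

Lemma xbar_measurable : measurable_fun setT X.
Proof. exact: continuous_measurable_fun xbar_continuous. Qed.

Lemma xbar_preimage_lt x : X @^-1` `]-oo, x[%classic = `]-oo, x + Gm x[%classic.
Proof. by apply/seteqP; split => a /=; rewrite !in_itv /= xbar_lt. Qed.

Lemma finmeas_itvoc (c d : R) : c <= d -> mubar `]c, d]%classic = (Gp d - Gp c)%:E.
Proof.
move=> cd; have -> : (`]c, d] = `]-oo, d] `\` `]-oo, c])%classic.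
  apply/seteqP; split => z /=; rewrite !in_itv /=.
    by move=> /andP[cz ->]; split => //; apply/negP; rewrite -ltNge.
  by move=> [-> /negP]; rewrite -ltNge => ->.
rewrite measureD//; last by rewrite ltey_eq finmeas_fin_num.
rewrite (_ : _ `&` _ = `]-oo, c]%classic); last first.
  apply/seteqP; split => z /=; rewrite !in_itv /=; first by case.
  by move=> zc; rewrite zc (le_trans zc cd).
by rewrite EFinB /Gp !fineK// finmeas_fin_num.
Qed.

(** The preimage of []a, b]] is []a + Gp a, b + Gp b]], of length [b - a] plus the mass of []a,
    b]]. *)
Lemma xbar_pushforward (A : set (measurableTypeR R)) : measurable A ->
  leb (X @^-1` A) = (leb A + mubar A)%E.
Proof.
move=> mA; have mX : @measurable_fun _ _ (measurableTypeR R) (measurableTypeR R) setT X.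
  exact: xbar_measurable.
pose X' : {mfun measurableTypeR R >-> measurableTypeR R} :=
  HB.pack (X : measurableTypeR R -> measurableTypeR R)
    (isMeasurableFun.Build _ _ _ _ _ mX).
have e (a b : R) : a < b -> leb (X @^-1` `]a, b]%classic) =
    ((b - a) + (Gp b - Gp a))%:E.
  move=> ab; have -> : X @^-1` `]a, b]%classic = `]a + Gp a, b + Gp b]%classic.
    apply/seteqP; split => z /=; rewrite !in_itv /= -xbar_le => /andP[h ->];
    by move: h; rewrite !ltNge xbar_le => ->.
  rewrite lebesgue_measure_itv /= lte_fin ifT.
    by rewrite -EFinB; congr (_ %:E); ring.
  by rewrite ltr_leD// (le_trans (dist_lt_le ab))// dist_le.
rewrite -measure_addE.
apply: (@eq_measure_itv R (pushforward leb X') (measure_add leb mubar) _ _ A mA).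
  move=> a b ab; apply: etrans (e a b ab) _; apply: etrans (esym (measure_addE _ _ _)).
  rewrite EFinD; congr (_ + _)%E; last by apply/esym; exact: finmeas_itvoc (ltW ab).
  have l : leb `]a, b]%classic = (b - a)%:E by rewrite lebesgue_measure_itv /= lte_fin ab.
  exact: esym l.
have fin (a b : R) : (leb (X @^-1` `]a, b]%classic) < +oo)%E.
  have [ab|ba] := ltP a b; first by rewrite e// ltry.
  by rewrite set_itv_ge ?bnd_simp -?leNgt// preimage_set0 measure0.
exact: fin.
Qed.

End PseudoInverse.

Lemma lebesgue_setU0 (R : realType) (A B : set (measurableTypeR R)) :
  measurable A -> measurable B ->
  lebesgue_measure A = 0%E -> lebesgue_measure B = 0%E ->
  lebesgue_measure (A `|` B) = 0%E.
Proof.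
move=> mA mB A0 B0; apply/eqP; rewrite -measure_le0.
have e : (lebesgue_measure A + lebesgue_measure B = 0)%E by rewrite A0 B0 adde0.
by rewrite -[leRHS]e; exact: measureU2.
Qed.

Lemma Rintegral_cst_itv (R : realType) (a b c : R) : a <= b ->
  \int[lebesgue_measure]_(x in `[a, b]) (cst c x) = c * (b - a).
Proof.
move=> ab; rewrite Rintegral_cst//; congr (_ * _).
have l : lebesgue_measure `[a, b]%classic = (b - a)%:E.
  rewrite lebesgue_measure_itv /= lte_fin.
  move: ab; rewrite le_eqVlt => /orP[/eqP ->|->]; last by rewrite -EFinB.
  by rewrite ltxx subrr.
exact: (congr1 fine l).
Qed.

Lemma measurable_inv (R : realType) : measurable_fun setT (@GRing.inv R).
Proof.
have c0 (x : R) : x != 0 -> {for x, continuous (@GRing.inv R)}.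
  by move=> x0; apply: inv_continuous.
have -> : (setT : set R) = [set~ 0] `|` [set 0] by rewrite setUC setUv.
apply/measurable_funU; first 2 last; first split.
- apply: open_continuous_measurable_fun; first by rewrite openC; apply: accessible_closed_set1; apply: hausdorff_accessible; exact: Rhausdorff.
  by move=> x; rewrite inE /= => /eqP; exact: c0.
- exact: measurable_fun_set1.
- by apply: measurableC; exact: measurable_set1.
- exact: measurable_set1.
Qed.

(** * Nondecreasing maps that push a density to Lebesgue measure *)

Section MonotoneTransport.
Context {R : realType}.
Local Notation leb := (@lebesgue_measure R).
Local Notation T := (measurableTypeR R).
Variables (p w : R -> R).
Hypotheses (mp : @measurable_fun _ _ T T setT p).
Hypotheses (mw : @measurable_fun _ _ T R setT w) (w0 : forall x, 0 <= w x).

Lemma pushforward_itv_ext (nu : {measure set T -> \bar R}) :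
  (forall a b : R, a < b ->
     (\int[leb]_(x in p @^-1` `]a, b]%classic) (w x)%:E = nu `]a, b]%classic)%E) ->
  (forall a b : R, (nu `]a, b]%classic < +oo)%E) ->
  forall A : set T, measurable A -> (\int[leb]_(x in p @^-1` A) (w x)%:E = nu A)%E.
Proof.
move=> h fin A mA.
pose p' : {mfun T >-> T} := HB.pack (p : T -> T) (isMeasurableFun.Build _ _ _ _ _ mp).
have := @eq_measure_itv R nu (pushforward (weighted leb mw w0) p') _ fin A mA.
by move=> e; apply/esym/e => a b ab; rewrite -h.
Qed.

Hypothesis ndp : {homo p : a b / a <= b}.
Hypothesis push : forall A : set T, measurable A ->
  (\int[leb]_(x in p @^-1` A) (w x)%:E = leb A)%E.

(** The preimage of [[p a, p b]] can exceed [[a, b]], but only by points sent to [p a] or [p b]. Two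
    points are Lebesgue null, so the change of variables shows that the excess contributes
    nothing. *)
Lemma transport_increment (k : R -> R) (a b : R) :
  locally_integrable setT k -> a <= b ->
  leb.-integrable `[a, b] (fun x => (k (p x) * w x)%:E) /\
  \int[leb]_(x in `[p a, p b]) k x = \int[leb]_(x in `[a, b]) (k (p x) * w x).
Proof.
move=> lk ab; have [mk _ _] := lk; have pab := ndp ab.
pose A : set T := `[p a, p b]%classic.
have mA : measurable A by exact: measurable_itv.
have iA : leb.-integrable A (EFin \o k) by exact: locally_integrable_itv.
have mkT : @measurable_fun _ _ T R setT k by exact: mk.
have ikw := integrable_change_of_variables mp mw w0 push mA mkT iA.
have mpA : measurable (p @^-1` A) by rewrite -[X in measurable X]setTI; exact: mp.
have abA : (`[a, b]%classic : set T) `<=` p @^-1` A.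
  move=> x /=; rewrite !in_itv /= => /andP[ax xb]; apply/andP; split; exact: ndp.
have iab : leb.-integrable `[a, b] (fun x => (k (p x) * w x)%:E).
  exact: integrableS abA ikw.
split => //.
rewrite (Rintegral_change_of_variables mp mw w0 push mA mkT iA).
pose D : set T := p @^-1` A `\` `[a, b]%classic.
have mD : measurable D by exact: measurableD.
pose E : set T := [set p a] `|` [set p b].
have mE : measurable E by apply: measurableU; exact: measurable_set1.
have DE : D `<=` p @^-1` E.
  move=> x [] /=; rewrite !in_itv /= => /andP[pax pxb] nx.
  rewrite !bnd_simp in pax pxb.
  have [xa|ax] := ltP x a.
    by left; apply/eqP; rewrite eq_le pax ndp// ltW.
  have [xb|bx] := leP x b; first by move: nx; rewrite ax xb.
  by right; apply/eqP; rewrite eq_le pxb ndp// ltW.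
have leb0 : leb E = 0%E.
  by apply: lebesgue_setU0; rewrite ?lebesgue_measure_set1//; exact: measurable_set1.
have D0 : (\int[leb]_(x in D) `|(k (p x) * w x)%:E| = 0)%E.
  apply/eqP; rewrite eq_le integral_ge0 ?andbT//.
  have mpE : measurable (p @^-1` E) by rewrite -[X in measurable X]setTI; exact: mp.
  have mkw : @measurable_fun _ _ T R setT (fun x => k (p x) * w x).
    by apply: measurable_funM => //; exact: measurableT_comp mkT mp.
  apply: le_trans (_ : (\int[leb]_(x in p @^-1` E) `|(k (p x) * w x)%:E| <= 0)%E).
    apply: ge0_subset_integral => //.
    by apply: measurable_funTS; apply/measurable_EFinP; apply: measurableT_comp.
  rewrite (eq_integral (fun x : T => (`|(k (p x))%:E| * (w x)%:E)%E)); last first.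
    by move=> x _; rewrite EFinM abseM; congr (_ * _)%E; rewrite gee0_abs// lee_fin.
  have mkE : measurable_fun setT (fun x : T => `|(k x)%:E|%E).
    by apply: measurableT_comp => //; exact/measurable_EFinP.
  rewrite -(@ge0_change_of_variables _ _ _ _ _ leb leb p w mp mw w0 push E (fun x => `|(k x)%:E|%E))//.
  rewrite (@integral_abs_eq0 _ _ _ leb E (EFin \o k))//.
  by apply: measurable_funTS; exact/measurable_EFinP.
have -> : p @^-1` A = `[a, b]%classic `|` D by rewrite setDUK.
have iD : leb.-integrable D (fun x => (k (p x) * w x)%:E).
  by apply: integrableS ikw => // x [].
rewrite Rintegral_setU//; last 2 first.
- by rewrite setDUK.
- by apply/disj_setPS => x [? []].
suff -> : \int[leb]_(x in D) (k (p x) * w x) = 0 by rewrite addr0.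
rewrite /Rintegral; apply/eqP; rewrite fine_eq0; last exact: integrable_fin_num.
rewrite -abse_eq0 eq_le abse_ge0 andbT -D0.
by apply: le_abse_integral => //; case/integrableP : iD.
Qed.

Lemma transport_length (a b : R) : a <= b ->
  p b - p a = \int[leb]_(x in `[a, b]) w x.
Proof.
move=> ab.
have l1 : locally_integrable setT (cst 1 : R -> R).
  by apply: (@locally_integrable_bounded _ _ 1) => // x; rewrite normr1.
have [_] := transport_increment l1 ab; rewrite Rintegral_cst_itv ?ndp// mul1r => ->.
by apply: eq_Rintegral => x _; rewrite mul1r.
Qed.

End MonotoneTransport.

(** * Densities attached to the initial datum *)

Section Data.
Context {R : realType}.
Local Notation leb := (@lebesgue_measure R).
Local Notation T := (measurableTypeR R).
Variables (ubar ubarx : R -> R) (mubar : {finmeas R}).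
Hypothesis hD : calD ubar ubarx mubar.

Lemma calD_measurable : @measurable_fun _ _ T R setT ubarx.
Proof. by case: hD => _ [[? _ _] _] _ _. Qed.

Lemma calD_increment : forall a b, a <= b ->
  ubar b - ubar a = \int[leb]_(x in `[a, b]) ubarx x.
Proof. by case: hD => -[cu _] wd _ _; exact: weak_derivative_increment wd. Qed.

(** The last clause serves to identify the masses of the open and the closed half-line at points off
    [S]. *)
Definition carries_singular (S : set T) := [/\ measurable S, leb S = 0%E,
  forall A : set T, measurable A -> A `<=` ~` S ->
    mubar A = density (fun x => ubarx x ^+ 2) A &
  forall x : R, ~ S x -> mubar [set x] = 0%E].

(** The union of a countable carrier of the pure point part and a null carrier of the singular
    continuous part. *)
Lemma calD_singular_set : exists S : set T, carries_singular S.
Proof.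
have [_ _ _ [ac [pp [sc [[_ ppP scP dec] acE]]]]] := hD.
have [C [cC ppC]] := ppP; have [sc1 [N [mN N0 scN]]] := scP.
have mC : measurable (C : set T).
  by apply: countable_measurable => // x; exact: measurable_set1.
have C0 : leb C = 0%E by exact: countable_lebesgue_measure0.
have mS : measurable (C `|` N) by exact: measurableU.
have main (A : set T) : measurable A -> A `<=` ~` (C `|` N) ->
    mubar A = density (fun x => ubarx x ^+ 2) A.
  move=> mA AS; rewrite dec// acE//.
  have -> : pp A = 0%E.
    apply: (subset_measure0 mA _ _ ppC); first exact: measurableC.
    by move=> x /AS nS Cx; apply: nS; left.
  have -> : sc A = 0%E.
    apply: (subset_measure0 mA _ _ scN); first exact: measurableC.
    by move=> x /AS nS Cx; apply: nS; right.
  by rewrite !adde0.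
exists (C `|` N); split => //.
  exact: lebesgue_setU0.
move=> x nSx; rewrite main//; last by move=> z ->.
by rewrite /density integral_set1.
Qed.

Variable S : set T.
Hypothesis hS : carries_singular S.

Local Notation X := (xbar mubar).

(** The density of [dx] with respect to [dx + mubar]: off [S] the latter is [(1 + ubarx ^ 2) dx],
    and [dx] does not charge [S]. *)
Definition jac0 (x : R) : R := \1_(~` S) x / (1 + ubarx x ^+ 2).
Definition jac (a : R) : R := jac0 (X a).
Definition vel (a : R) : R := ubarx (X a) * jac a.

Let den x : 0 < 1 + ubarx x ^+ 2.
Proof. by rewrite ltr_pwDl// sqr_ge0. Qed.

Lemma jac0_ge0 x : 0 <= jac0 x.
Proof. by rewrite /jac0 divr_ge0 ?indicE// ltW. Qed.

Lemma jac0_le1 x : jac0 x <= 1.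
Proof.
rewrite /jac0 ler_pdivrMr// mul1r indicE.
by case: (_ \in _); rewrite /= ?(ltW (den _))// lerDl sqr_ge0.
Qed.

Lemma jac0_singular x : S x -> jac0 x = 0.
Proof. by move=> Sx; rewrite /jac0 indicE memNset ?mul0r//; apply. Qed.

Lemma jac0_regular x : ~ S x -> jac0 x = (1 + ubarx x ^+ 2)^-1.
Proof. by move=> Sx; rewrite /jac0 indicE mem_set ?mul1r. Qed.

Lemma vel_sqr a : vel a ^+ 2 = jac a * (1 - jac a).
Proof.
have [SX|nSX] := pselect (S (X a)).
  by rewrite /vel /jac jac0_singular// mulr0 mul0r expr0n.
rewrite /vel /jac jac0_regular//; field; exact: lt0r_neq0.
Qed.

Lemma jac0_measurable : @measurable_fun _ _ T R setT jac0.
Proof.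
have [mS _ _ _] := hS.
apply: measurable_funM; first by apply: measurable_indic; exact: measurableC.
apply: (measurableT_comp (@measurable_inv R)); apply: measurable_funD => //.
by apply: measurable_funX; exact: calD_measurable.
Qed.

End Data.

Section LagrangianDensity.
Context {R : realType}.
Local Notation leb := (@lebesgue_measure R).
Local Notation T := (measurableTypeR R).
Variables (ubar ubarx : R -> R) (mubar : {finmeas R}).
Hypothesis hD : calD ubar ubarx mubar.
Variable S : set T.
Hypothesis hS : carries_singular ubarx mubar S.

Local Notation X := (xbar mubar).
Local Notation j0 := (jac0 ubarx S).
Local Notation g := (jac ubarx mubar S).
Local Notation v := (vel ubarx mubar S).

Let mX : @measurable_fun _ _ T T setT X.
Proof. exact: xbar_measurable. Qed.

Let mux : @measurable_fun _ _ T R setT ubarx := calD_measurable hD.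

Lemma integral_mubar_regular (A : set T) (k : R -> R) :
  measurable A -> @measurable_fun _ _ T R setT k -> (forall x, 0 <= k x) ->
  (forall x, S x -> k x = 0) ->
  (\int[mubar]_(x in A) (k x)%:E = \int[leb]_(x in A) (k x * ubarx x ^+ 2)%:E)%E.
Proof.
move=> mA mk k0 kS; have [mS _ reg _] := hS.
have mAS : measurable (A `\` S) by exact: measurableD.
have red (m : {measure set T -> \bar R}) (l : T -> R) : @measurable_fun _ _ T R setT l ->
    (forall x, 0 <= l x) -> (forall x, S x -> l x = 0) ->
    (\int[m]_(x in A) (l x)%:E = \int[m]_(x in A `\` S) (l x)%:E)%E.
  move=> ml l0 lS; rewrite integral_mkcond [RHS]integral_mkcond.
  apply: eq_integral => x _; rewrite !patchE.
  have [Sx|nSx] := pselect (S x).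
    by rewrite lS//; do 2 case: ifP.
  congr (if _ then _ else _); apply/idP/idP => /set_mem h; apply/mem_set => //.
  by case: h.
rewrite (red mubar)// [RHS](red leb (fun x => k x * ubarx x ^+ 2)); last 3 first.
- by apply: measurable_funM => //; exact: measurable_funX.
- by move=> x; rewrite mulr_ge0// sqr_ge0.
- by move=> x /kS ->; rewrite mul0r.
have mu2 : @measurable_fun _ _ T R setT (fun x => ubarx x ^+ 2).
  exact: measurable_funX.
have u20 x : 0 <= ubarx x ^+ 2 by exact: sqr_ge0.
rewrite (@eq_measure_integral _ _ _ _ (weighted leb mu2 u20))//; last first.
  by move=> B mB BA; apply: reg => // x /BA[].
rewrite ge0_integral_weighted//; last by move=> x _; rewrite lee_fin.
by apply/measurable_EFinP; exact: measurable_funTS.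
Qed.

(** Since [X] pushes [da] to [dx + mubar], the left side is the integral of [jac0] over [A] against
    [dx + mubar]. As [jac0] vanishes on [S], this is the integral of [jac0 * (1 + ubarx ^ 2)], the
    indicator of the complement of the null set [S]. *)
Lemma jac_push (A : set T) : measurable A ->
  (\int[leb]_(x in X @^-1` A) (g x)%:E = leb A)%E.
Proof.
move=> mA; have [mS S0 _ _] := hS.
have mj := jac0_measurable hD hS; have j0_ge0 := jac0_ge0 ubarx S.
have push1 (B : set T) : measurable B ->
    (\int[leb]_(x in X @^-1` B) (cst 1 x)%:E = measure_add leb mubar B)%E.
  move=> mB; have mXB : measurable (X @^-1` B).
    by rewrite -[X in measurable X]setTI; exact: mX.
  apply: etrans (integral_cst leb mXB 1%:E) _; rewrite mul1e.
  apply: etrans (xbar_pushforward _ mB) _.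
  exact/esym/measure_addE.
have := @ge0_change_of_variables _ _ _ _ _ leb (measure_add leb mubar) X (cst 1)
  mX (measurable_cst _) (fun _ => ler01) push1 A (EFin \o j0) mA.
have mjE : measurable_fun setT (EFin \o j0) by exact/measurable_EFinP.
move=> /(_ mjE (fun x => j0_ge0 x)) => e.
transitivity (\int[leb]_(x in X @^-1` A) ((EFin \o j0) (X x) * 1%:E))%E.
  by apply: eq_integral => x _; rewrite mule1.
rewrite -e ge0_integral_measure_add//; last 2 first.
- by move=> x _; rewrite lee_fin.
- exact: measurable_funTS.
rewrite integral_mubar_regular//; last exact: jac0_singular.
rewrite -ge0_integralD//; last 4 first.
- by move=> x _; rewrite lee_fin.
- exact: measurable_funTS.
- by move=> x _; rewrite lee_fin mulr_ge0// sqr_ge0.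
- apply/measurable_EFinP; apply: measurable_funTS.
  by apply: measurable_funM => //; exact: measurable_funX.
rewrite (eq_integral (fun x : T => (\1_(~` S) x)%:E)); last first.
  move=> x _; rewrite /= -EFinD; congr EFin.
  have d0 : 1 + ubarx x ^+ 2 != 0 by rewrite gt_eqF// ltr_pwDl// sqr_ge0.
  by rewrite -[X in X + _]mulr1 -mulrDr /jac0 divfK.
rewrite integral_indic//; last exact: measurableC.
rewrite setIC -setDE; apply/esym; apply: etrans (measureDI leb mA mS) _.
rewrite -[RHS]adde0; congr (_ + _)%E.
by apply: (subset_measure0 _ mS _ S0) => //; exact: measurableI.
Qed.

Lemma jac_ge0 a : 0 <= g a. Proof. exact: jac0_ge0. Qed.
Lemma jac_le1 a : g a <= 1. Proof. exact: jac0_le1. Qed.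

Lemma jac_measurable : @measurable_fun _ _ T R setT g.
Proof. exact: measurableT_comp (jac0_measurable hD hS) mX. Qed.

Lemma vel_measurable : @measurable_fun _ _ T R setT v.
Proof.
apply: measurable_funM; last exact: jac_measurable.
exact: measurableT_comp mux mX.
Qed.

Let e a := 1 - g a.
Let e0 a : 0 <= e a. Proof. by rewrite subr_ge0 jac_le1. Qed.
Let me : @measurable_fun _ _ T R setT e.
Proof. by apply: measurable_funB => //; exact: jac_measurable. Qed.

(** On a bounded interval this is the difference of [xbar_pushforward] and [jac_push]. The
    subtraction requires finite Lebesgue measure, hence the passage through intervals. *)
Lemma energy_push (A : set T) : measurable A ->
  (\int[leb]_(x in X @^-1` A) (1 - g x)%:E = mubar A)%E.
Proof.
apply: (@pushforward_itv_ext R X e mX me e0 mubar); last first.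
  by move=> a b; rewrite ltey_eq finmeas_fin_num.
move=> a b ab; pose I : set T := `]a, b]%classic.
have mI : measurable I by exact: measurable_itv.
have mXI : measurable (X @^-1` I) by rewrite -[X in measurable X]setTI; exact: mX.
have lI : leb I = (b - a)%:E.
  by rewrite /I lebesgue_measure_itv /= lte_fin ab.
have h1 := jac_push mI; have h2 := xbar_pushforward mubar mI.
have h3 : leb (X @^-1` I) = (\int[leb]_(x in X @^-1` I) (g x)%:E +
    \int[leb]_(x in X @^-1` I) (e x)%:E)%E.
  rewrite -ge0_integralD//.
  - rewrite -[LHS]mul1e -integral_cst//; apply: eq_integral => x _.
    by rewrite -EFinD /e addrCA subrr addr0.
  - by move=> x _; rewrite lee_fin jac_ge0.
  - by apply/measurable_EFinP; apply: measurable_funTS; exact: jac_measurable.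
  - by move=> x _; rewrite lee_fin.
  - by apply/measurable_EFinP; apply: measurable_funTS.
move: h3; rewrite h2 h1 lI => /(congr1 (fun z => z - (b - a)%:E)%E).
by rewrite ![((b - a)%:E + _)%E]addeC !addeK// => ->.
Qed.

Lemma xbar_increment (a b : R) : a <= b ->
  X b - X a = \int[leb]_(x in `[a, b]) g x.
Proof.
exact: (transport_length mX jac_measurable jac_ge0
  (@xbar_nondecreasing _ mubar) jac_push).
Qed.

Lemma ubar_xbar_increment (a b : R) : a <= b ->
  ubar (X b) - ubar (X a) = \int[leb]_(x in `[a, b]) v x.
Proof.
move=> ab; rewrite (calD_increment hD) ?xbar_nondecreasing//.
have [_ [lux _] _ _] := hD.
by have [_ ->] := transport_increment mX jac_measurable jac_ge0
  (@xbar_nondecreasing _ mubar) jac_push lux ab.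
Qed.

End LagrangianDensity.

(** * Decompositions of measures *)

Section FiniteMeasures.
Context {R : realType}.
Local Notation leb := (@lebesgue_measure R).
Local Notation T := (measurableTypeR R).

Section FiniteOf.
Variables (nu : {measure set T -> \bar R}) (nufin : fin_num_fun nu).

(** A copy of [nu] indexed by the proof of finiteness, so that the finite measure structure can be
    attached to it. *)
Definition finite_of of fin_num_fun nu := fun A : set T => nu A.

Let finite_of0 : finite_of nufin set0 = 0%E. Proof. exact: measure0. Qed.

Let finite_of_ge0 A : (0 <= finite_of nufin A)%E. Proof. exact: measure_ge0. Qed.

Let finite_of_sigma_additive : semi_sigma_additive (finite_of nufin).
Proof. exact: measure_semi_sigma_additive. Qed.

HB.instance Definition _ := isMeasure.Build _ _ _ (finite_of nufin)
  finite_of0 finite_of_ge0 finite_of_sigma_additive.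

HB.instance Definition _ := Measure_isFinite.Build _ _ _ (finite_of nufin) nufin.

End FiniteOf.

Lemma pushforward_finmeas (p w : R -> R) :
  @measurable_fun _ _ T T setT p -> @measurable_fun _ _ T R setT w ->
  (forall x, 0 <= w x) -> (\int[leb]_x (w x)%:E < +oo)%E ->
  exists m : {finmeas R}, forall A : set T, measurable A ->
    m A = (\int[leb]_(x in p @^-1` A) (w x)%:E)%E.
Proof.
move=> mp mw w0 fin.
have [nu nuE] : exists nu : {measure set T -> \bar R},
    forall A, nu A = weighted leb mw w0 (p @^-1` A).
  pose nu := (@pushforward _ _ T T R (weighted leb mw w0) p : {measure set T -> \bar R}).
  by exists (nu mp).
have nufin : fin_num_fun nu.
  move=> A mA; have h : (nu A <= nu setT)%E by apply: le_measure; rewrite ?inE.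
  by rewrite ge0_fin_numE// (le_lt_trans h)// nuE.
by exists (finite_of nufin) => A _; exact: nuE.
Qed.

Lemma countable_null (m : {measure set T -> \bar R}) (K : set T) :
  (forall x : R, m [set x] = 0%E) -> countable K -> m K = 0%E.
Proof.
move=> m1 cK; have mK : measurable K.
  by apply: countable_measurable => // x; exact: measurable_set1.
apply/(negligibleP m mK); move: (cK) => /countable_injP[f injf].
have -> : K = \bigcup_n (K `&` f @^-1` [set n]).
  by apply/seteqP; split => [x Kx|x [n _ []]//]; exists (f x).
apply: negligible_bigcup => n.
have [[x [Kx fx]]|no] := pselect (exists x, K x /\ f x = n).
  apply: (@negligibleS _ _ _ m [set x]); last first.
    by apply/(negligibleP m (measurable_set1 x)); exact: m1.
  by move=> z [Kz fz] /=; apply: injf; rewrite ?inE// fz fx.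
rewrite (_ : _ `&` _ = set0); first exact: negligible_set0.
by apply/seteqP; split => // z [Kz fz]; apply: no; exists z.
Qed.

Lemma measure_restr_full (m : {measure set T -> \bar R}) (A N : set T) :
  measurable A -> measurable N -> m (~` N) = 0%E -> m (A `&` N) = m A.
Proof.
move=> mA mN N0; apply/esym; apply: etrans (measureDI m mA mN) _.
rewrite -[RHS]add0e; congr (_ + _)%E.
apply: (subset_measure0 _ _ _ N0); [exact: measurableD|exact: measurableC|].
by move=> x [].
Qed.

Lemma measure_null_sub (m : {measure set T -> \bar R}) (A N : set T) :
  measurable A -> measurable N -> A `<=` N -> m N = 0%E -> m A = 0%E.
Proof. by move=> mA mN AN; exact: subset_measure0. Qed.

(** The part [ac] ignores the null sets [K] and [N], [sc] ignores the countable set [K], and [pp]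
    lives on [K]: each part is the restriction of [m] to its own piece of the partition. *)
Lemma lebesgue_decomposition_formula (m ac pp sc : {finmeas R}) (K N : set T) :
  lebesgue_decomposition m ac pp sc ->
  countable K -> measurable N -> leb N = 0%E ->
  pp (~` K) = 0%E -> sc (~` N) = 0%E ->
  forall A : set T, measurable A ->
    [/\ pp A = m (A `&` K), sc A = m (A `&` (N `\` K)) &
        ac A = m (A `\` (N `|` K))].
Proof.
move=> [acl _ [sc1 _] dec] cK mN N0 ppK scN A mA.
have mK : measurable K.
  by apply: countable_measurable => // x; exact: measurable_set1.
have K0 : leb K = 0%E by exact: countable_lebesgue_measure0.
have acl0 (B : set T) : measurable B -> leb B = 0%E -> ac B = 0%E.
  by move: acl => /null_content_dominatesP; exact.
have scK := countable_null sc1 cK.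
have mAK : measurable (A `&` K) by exact: measurableI.
have mNK : measurable (N `\` K) by exact: measurableD.
have mANK : measurable (A `&` (N `\` K)) by exact: measurableI.
have mNUK : measurable (N `|` K) by exact: measurableU.
have mD : measurable (A `\` (N `|` K)) by exact: measurableD.
have mCK : measurable (~` K) by exact: measurableC.
have mCN : measurable (~` N) by exact: measurableC.
have NK0 : leb (N `|` K) = 0%E by exact: lebesgue_setU0.
split; rewrite dec//.
- have -> : ac (A `&` K) = 0%E.
    by apply: acl0 => //; apply: (measure_null_sub mAK mK).
  have -> : sc (A `&` K) = 0%E by apply: (measure_null_sub mAK mK).
  by rewrite add0e adde0; apply/esym; exact: measure_restr_full.
- have -> : ac (A `&` (N `\` K)) = 0%E.
    by apply: acl0 => //; apply: (measure_null_sub mANK mN) => // x [_ []].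
  have -> : pp (A `&` (N `\` K)) = 0%E.
    by apply: (measure_null_sub mANK mCK) => // x [_ []].
  rewrite !add0e; apply/esym; apply: measure_restr_full => //.
  rewrite setCD; apply/eqP; rewrite -measure_le0.
  have e : (sc (~` N) + sc K = 0)%E by rewrite scN scK adde0.
  by rewrite -[leRHS]e; exact: measureU2.
- have -> : pp (A `\` (N `|` K)) = 0%E.
    by apply: (measure_null_sub mD mCK) => // x [_ nNK Kx]; apply: nNK; right.
  have -> : sc (A `\` (N `|` K)) = 0%E.
    by apply: (measure_null_sub mD mCN) => // x [_ nNK Nx]; apply: nNK; left.
  rewrite !adde0 setDE; apply/esym; apply: measure_restr_full => //.
    exact: measurableC.
  by rewrite setCK; exact: acl0.
Qed.

(** With carriers common to both decompositions, [lebesgue_decomposition_formula] expresses all the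
    parts through [m] alone. *)
Lemma lebesgue_decomposition_unique (m ac pp sc ac' pp' sc' : {finmeas R}) :
  lebesgue_decomposition m ac pp sc -> lebesgue_decomposition m ac' pp' sc' ->
  forall A : set T, measurable A ->
    [/\ pp A = pp' A, sc A = sc' A & ac A = ac' A].
Proof.
move=> d d' A mA.
have [_ [C [cC ppC]] [_ [N [mN N0 scN]]] _] := d.
have [_ [C' [cC' ppC']] [_ [N' [mN' N0' scN']]] _] := d'.
have cm (D : set T) : countable D -> measurable D.
  by move=> cD; apply: countable_measurable => // x; exact: measurable_set1.
have mC := cm _ cC; have mC' := cm _ cC'.
have cK : countable (C `|` C') by rewrite -bigcup2E; apply: bigcup_countable => // -[|[|i]] _ //=; exact: countable0.
have mNN : measurable (N `|` N') by exact: measurableU.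
have NN0 : leb (N `|` N') = 0%E by exact: lebesgue_setU0.
have sub (n : {finmeas R}) (B D : set T) : measurable B -> measurable D ->
    D `<=` B -> n (~` D) = 0%E -> n (~` B) = 0%E.
  move=> mB mD DB; apply: measure_null_sub; [exact: measurableC|exact: measurableC|].
  exact: subsetC.
have mK := cm _ cK.
have [|| -> -> ->] := lebesgue_decomposition_formula d cK mNN NN0 _ _ mA.
- by apply: (sub _ _ C).
- by apply: (sub _ _ N).
have [|| -> -> ->] // := lebesgue_decomposition_formula d' cK mNN NN0 _ _ mA.
- by apply: (sub _ _ C').
- by apply: (sub _ _ N').
Qed.

End FiniteMeasures.

(** * Monotone maps of the line *)

Lemma ae_mono d (T : measurableType d) (R : realType)
    (mu : {measure set T -> \bar R}) (P Q : T -> Prop) :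
  (forall x, P x -> Q x) -> {ae mu, forall x, P x} -> {ae mu, forall x, Q x}.
Proof. by move=> PQ; apply: negligibleS => x; apply: contra_not; exact: PQ. Qed.

Lemma ae_mono2 d (T : measurableType d) (R : realType)
    (mu : {measure set T -> \bar R}) (P1 P2 Q : T -> Prop) :
  (forall x, P1 x -> P2 x -> Q x) ->
  {ae mu, forall x, P1 x} -> {ae mu, forall x, P2 x} -> {ae mu, forall x, Q x}.
Proof.
move=> PQ h1 h2; have := negligibleU h1 h2.
apply: negligibleS => x; apply: contra_notP => /not_orP[/contrapT p1 /contrapT p2].
exact: PQ.
Qed.

Lemma ge0_integral_eq0P d (T : measurableType d) (R : realType)
    (mu : {measure set T -> \bar R}) (D : set T) (h : T -> R) :
  measurable D -> measurable_fun setT h -> (forall x, 0 <= h x) ->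
  (\int[mu]_(x in D) (h x)%:E = 0)%E <-> {ae mu, forall x, D x -> h x = 0}.
Proof.
move=> mD mh h0.
have mhD : measurable_fun D (EFin \o h).
  by apply: measurable_funTS; exact/measurable_EFinP.
have F := ae_filter_ringOfSetsType mu.
rewrite (eq_integral (fun x => `|(h x)%:E|%E)); last first.
  by move=> x _; rewrite /= ger0_norm.
apply: iff_trans (ae_eq_integral_abs mu mD mhD) _.
by split; apply: filterS => x hx Dx; have := hx Dx; [case|move=> /= ->].
Qed.

Lemma lebesgue_itvoc (R : realType) (a b : R) : a < b ->
  lebesgue_measure `]a, b]%classic = (b - a)%:E.
Proof. by move=> ab; rewrite lebesgue_measure_itv /= lte_fin ab EFinB. Qed.

Lemma lebesgue_itvoc_lty (R : realType) (a b : R) :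
  (lebesgue_measure `]a, b]%classic < +oo)%E.
Proof. by rewrite lebesgue_measure_itv; case: ifP => // _; rewrite -EFinB ltry. Qed.

Section MonotoneMap.
Context {R : realType}.
Local Notation leb := (@lebesgue_measure R).
Local Notation T := (measurableTypeR R).
Variables (Y h : R -> R) (H C : R).
Hypotheses (mh : @measurable_fun _ _ T R setT h) (h0 : forall a, 0 <= h a).
Hypotheses (hH : forall a, h a <= H).
Hypothesis incY : forall a b, a <= b -> Y b - Y a = \int[leb]_(x in `[a, b]) h x.
Hypothesis gapY : forall a, `|Y a - a| <= C.

Let lh : locally_integrable setT h.
Proof.
by apply: (@locally_integrable_bounded _ _ H) => // a; rewrite ger0_norm.
Qed.

Lemma mono_nd : {homo Y : a b / a <= b}.
Proof. by move=> a b ab; rewrite -subr_ge0 incY// Rintegral_ge0. Qed.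

Lemma mono_lip a b : a <= b -> Y b - Y a <= H * (b - a).
Proof.
move=> ab; rewrite incY// -(Rintegral_cst_itv H ab); apply: le_Rintegral => //.
- exact: locally_integrable_itv.
- apply: locally_integrable_itv.
  by apply: (@locally_integrable_bounded _ _ `|H|).
Qed.

Lemma mono_continuous : continuous Y.
Proof. exact: primitive_continuous lh incY. Qed.

Lemma mono_measurable : @measurable_fun _ _ T T setT Y.
Proof. exact: (continuous_measurable_fun mono_continuous). Qed.

Definition fiber_inf (x : R) : R := inf [set a | Y a = x].
Definition fiber_sup (x : R) : R := sup [set a | Y a = x].
Local Notation zl := fiber_inf.
Local Notation zr := fiber_sup.

Let Hge0 : 0 <= H. Proof. exact: le_trans (h0 0) (hH 0). Qed.

Let bounds a : a - C <= Y a <= a + C.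
Proof. by have := gapY a; rewrite ler_norml => /andP[? ?]; apply/andP; split; lra. Qed.

(** As [Y] stays within [C] of the identity, its values at [x - C] and [x + C] enclose [x]. *)
Lemma mono_surj x : exists a, Y a = x.
Proof.
have C0 : 0 <= C by exact: le_trans (normr_ge0 _) (gapY 0).
have le1 : x - C <= x + C by lra.
have /andP[_ b1] := bounds (x - C); have /andP[b2 _] := bounds (x + C).
have h1 : Num.min (Y (x - C)) (Y (x + C)) <= x by rewrite ge_min; apply/orP; left; lra.
have h2 : x <= Num.max (Y (x - C)) (Y (x + C)) by rewrite le_max; apply/orP; right; lra.
have cY : {within `[x - C, x + C], continuous Y}.
  exact: continuous_subspaceT mono_continuous.
have [|c _ Yc] := @IVT R Y (x - C) (x + C) x le1 cY; first by rewrite h1 h2.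
by exists c.
Qed.

Let fiber_has_inf x : has_inf [set a | Y a = x].
Proof.
split; first exact: mono_surj.
by exists (x - C) => a /= <-; have /andP[_] := bounds a; rewrite lerBlDr.
Qed.

Let fiber_has_sup x : has_sup [set a | Y a = x].
Proof.
split; first exact: mono_surj.
by exists (x + C) => a /= <-; have /andP[] := bounds a; rewrite lerBlDr.
Qed.

Lemma fiber_infK x : Y (zl x) = x.
Proof.
have [ne lb] := fiber_has_inf x.
have [b Yb] := ne.
have le1 : Y (zl x) <= x by rewrite -[leRHS]Yb; apply: mono_nd; apply: ge_inf.
apply/eqP; rewrite eq_le le1 /= leNgt; apply/negP => lt1.
have H1 : 0 < H + 1 by rewrite ltr_pwDr.
(* Within this distance of [zl x] the [H]-Lipschitz map [Y] rises by less than [x - Y (zl x)], so it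
   cannot reach [x]; [H + 1] is nonzero even if [H] is not. *)
have d0 : 0 < (x - Y (zl x)) / (H + 1) by rewrite divr_gt0// subr_gt0.
have [a Ya az] := inf_adherent d0 (fiber_has_inf x).
have za : zl x <= a by apply: ge_inf.
have := mono_lip za; rewrite Ya leNgt => /negP; apply.
apply: le_lt_trans (_ : H * ((x - Y (zl x)) / (H + 1)) < _).
  by rewrite ler_wpM2l// lerBlDl ltW.
rewrite mulrCA gtr_pMr ?subr_gt0// ltr_pdivrMr// mul1r ltrDl//.
Qed.

Lemma fiber_supK x : Y (zr x) = x.
Proof.
have [ne ub] := fiber_has_sup x.
have [b Yb] := ne.
have le1 : x <= Y (zr x) by rewrite -[leLHS]Yb; apply: mono_nd; apply: ub_le_sup.
apply/eqP; rewrite eq_le le1 andbT leNgt; apply/negP => lt1.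
have H1 : 0 < H + 1 by rewrite ltr_pwDr.
have d0 : 0 < (Y (zr x) - x) / (H + 1) by rewrite divr_gt0// subr_gt0.
have [a Ya az] := sup_adherent d0 (fiber_has_sup x).
have za : a <= zr x by apply: ub_le_sup.
have := mono_lip za; rewrite Ya leNgt => /negP; apply.
apply: le_lt_trans (_ : H * ((Y (zr x) - x) / (H + 1)) < _).
  by rewrite ler_wpM2l//; move: az; rewrite -/(zr x); lra.
rewrite mulrCA gtr_pMr ?subr_gt0// ltr_pdivrMr// mul1r ltrDl//.
Qed.

(** With [fiber_supP], the Galois connections between [Y] and its two pseudo-inverses; they give
    their monotonicity and the shape of fibres and preimages. *)
Lemma fiber_infP c x : (zl x <= c) = (x <= Y c).
Proof.
apply/idP/idP => [zc|xc]; first by rewrite -(fiber_infK x) mono_nd.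
have [eq|ne] := eqVneq (Y c) x; first by apply: ge_inf => //; exact: (fiber_has_inf x).2.
rewrite leNgt; apply/negP => cz; move: ne; rewrite eq_le xc andbT -(fiber_infK x).
by rewrite mono_nd// ltW.
Qed.

Lemma fiber_supP c x : (c <= zr x) = (Y c <= x).
Proof.
apply/idP/idP => [zc|xc]; first by rewrite -(fiber_supK x) mono_nd.
have [eq|ne] := eqVneq (Y c) x; first by apply: ub_le_sup => //; exact: (fiber_has_sup x).2.
rewrite leNgt; apply/negP => cz; move: ne; rewrite eq_le xc /= -(fiber_supK x).
by rewrite mono_nd// ltW.
Qed.

Lemma fiberP a x : (Y a = x) <-> zl x <= a <= zr x.
Proof.
rewrite fiber_infP fiber_supP; split => [->|/andP[xa ax]]; first by rewrite lexx.
by apply/eqP; rewrite eq_le ax.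
Qed.

Lemma fiber_inf_strict x x' : (zl x <= zl x') = (x <= x').
Proof. by rewrite fiber_infP fiber_infK. Qed.

Lemma fiber_inf_measurable : @measurable_fun _ _ T T setT zl.
Proof.
apply: (@nondecreasing_measurable R setT zl) => // x x' xx'.
by rewrite fiber_inf_strict.
Qed.

Lemma fiber_sup_nd : {homo zr : x x' / x <= x'}.
Proof. by move=> x x' xx'; rewrite fiber_supP fiber_supK. Qed.

Lemma integral_increment a b : a <= b ->
  (\int[leb]_(x in `]a, b]) (h x)%:E = (Y b - Y a)%:E)%E.
Proof.
move=> ab; rewrite integral_itv_obnd_cbnd//; last first.
  by apply: measurable_funTS; exact/measurable_EFinP.
rewrite incY// /Rintegral fineK//; apply: integrable_fin_num => //.
exact: locally_integrable_itv.
Qed.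

(** The preimage of []a, b]] is []zr a, zr b]], over which [h] integrates to
    [Y (zr b) - Y (zr a) = b - a]. *)
Lemma mono_push (A : set T) : measurable A ->
  (\int[leb]_(x in Y @^-1` A) (h x)%:E = leb A)%E.
Proof.
apply: (pushforward_itv_ext mono_measurable mh h0); last first.
  by move=> a b; exact: lebesgue_itvoc_lty.
move=> a b ab.
have -> : Y @^-1` `]a, b]%classic = `]zr a, zr b]%classic.
  apply/seteqP; split => z /=; rewrite !in_itv /= -fiber_supP => /andP[z1 ->];
  by move: z1; rewrite !ltNge fiber_supP => ->.
rewrite integral_increment ?fiber_sup_nd ?ltW// !fiber_supK.
exact: esym (lebesgue_itvoc ab).
Qed.

Definition plateau_values : set R := [set x | zl x < zr x].

(** Each plateau is a nondegenerate interval, so its value is taken at a rational. *)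
Lemma plateau_countable : countable plateau_values.
Proof.
pose F (q : rat) : R := Y (ratr q).
apply: (@sub_countable _ _ _ (F @` setT)); last first.
  exact: sub_countable (card_image_le F setT) (countableP _).
apply: subset_card_le => x /= zz.
have [q /itvP qz] := rat_in_itvoo zz.
exists q => //; apply/fiberP; by rewrite !ltW ?qz.
Qed.

Lemma plateau_measurable : measurable (plateau_values : set T).
Proof.
apply: countable_measurable plateau_countable => x; exact: measurable_set1.
Qed.

(** The measure [h da] is pushed to Lebesgue measure, which ignores the countably many plateau
    values. As [h >= 0], it follows that [h] vanishes almost everywhere on the plateaus. *)
Lemma plateau_null : (\int[leb]_(x in Y @^-1` plateau_values) (h x)%:E = 0)%E.
Proof.
rewrite mono_push; last exact: plateau_measurable.
exact: countable_lebesgue_measure0 plateau_countable.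
Qed.

Lemma measurable_preim (A : set T) : measurable A -> measurable (Y @^-1` A : set T).
Proof. by move=> mA; rewrite -[X in measurable X]setTI; exact: mono_measurable. Qed.

Lemma ae_plateau_flat :
  {ae leb, forall a : T, plateau_values (Y a) -> h a = 0}.
Proof.
have mP := measurable_preim plateau_measurable.
exact: (ge0_integral_eq0P leb mP mh h0).1 plateau_null.
Qed.

Lemma not_plateauP a : ~ plateau_values (Y a) -> zl (Y a) = a.
Proof.
rewrite /plateau_values /= => /negP; rewrite -leNgt => zz.
have /andP[z1 z2] := (fiberP a (Y a)).1 erefl.
by apply/eqP; rewrite eq_le z1 (le_trans z2 zz).
Qed.

(* Reading the values taken at flat points through the Borel selection [zl]
   makes this set measurable. *)
Definition flat_values : set T := [set x | h (zl x) = 0].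

Lemma flat_values_measurable : measurable flat_values.
Proof.
rewrite (_ : flat_values = (h \o zl) @^-1` [set 0])//.
rewrite -[X in measurable X]setTI.
by apply: (measurableT_comp mh fiber_inf_measurable) => //; exact: measurable_set1.
Qed.

(** A Sard property. By [mono_push] it suffices that [h = 0] almost everywhere on the preimage: off
    the plateaus [zl (Y a) = a], and on the plateaus [ae_plateau_flat] applies. *)
Lemma flat_values_null : leb flat_values = 0%E.
Proof.
rewrite -mono_push; last exact: flat_values_measurable.
have mF := measurable_preim flat_values_measurable.
have ae0 : {ae leb, forall x : T, (Y @^-1` flat_values) x -> h x = 0}.
  apply: ae_mono ae_plateau_flat => x hx Fx.
  have [/hx//|/not_plateauP zx] := pselect (plateau_values (Y x)).
  by move: Fx; rewrite /flat_values /= zx.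
exact: (ge0_integral_eq0P leb mF mh h0).2 ae0.
Qed.

End MonotoneMap.

Lemma negligible_set1 (R : realType) (x : R) :
  (@lebesgue_measure R).-negligible [set x].
Proof.
have m1 : measurable ([set x] : set (measurableTypeR R)) by exact: measurable_set1.
by exists [set x]; split => //; exact: lebesgue_measure_set1.
Qed.

(** * Lebesgue decomposition of the image of an energy density *)

Section EnergyDecomposition.
Context {R : realType}.
Local Notation leb := (@lebesgue_measure R).
Local Notation T := (measurableTypeR R).
Variables (Y h : R -> R) (H C : R).
Hypotheses (mh : @measurable_fun _ _ T R setT h) (h0 : forall a, 0 <= h a).
Hypotheses (hH : forall a, h a <= H).
Hypothesis incY : forall a b, a <= b -> Y b - Y a = \int[leb]_(x in `[a, b]) h x.
Hypothesis gapY : forall a, `|Y a - a| <= C.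
Variable e : R -> R.
Hypotheses (me : @measurable_fun _ _ T R setT e) (e0 : forall a, 0 <= e a).
Hypothesis efin : (\int[leb]_x (e x)%:E < +oo)%E.

Local Notation zl := (fiber_inf Y).
Local Notation zr := (fiber_sup Y).

(** Measurable counterparts of [ALpp], [ALsc] and [BL], in which the density [h] replaces the
    pointwise derivative of [Y]. *)
Definition plateau_flat : set T := [set a | h a = 0 /\ zl (Y a) < zr (Y a)].
Definition graph_flat : set T := [set a | h a = 0 /\ zl (Y a) = zr (Y a)].
Definition not_flat : set T := [set a | 0 < h a].

Let mY : @measurable_fun _ _ T T setT Y.
Proof. exact: (mono_measurable mh h0 hH incY). Qed.

Let mflat : measurable [set a : T | h a = 0].
Proof.
rewrite (_ : [set a | _] = h @^-1` [set 0])// -[X in measurable X]setTI.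
by apply: mh => //; exact: measurable_set1.
Qed.

Let mplat : measurable (Y @^-1` plateau_values Y : set T).
Proof.
apply: (measurable_preim mh h0 hH incY).
exact: (plateau_measurable mh h0 hH incY gapY).
Qed.

Lemma plateau_flat_measurable : measurable plateau_flat.
Proof. exact: (measurableI _ _ mflat mplat). Qed.

Lemma graph_flatE : graph_flat = [set a | h a = 0] `\` (Y @^-1` plateau_values Y).
Proof.
apply/seteqP; split => a [ha].
  by move=> zz; split => //=; rewrite /plateau_values /= zz ltxx.
move=> np; split => //; apply/eqP; rewrite eq_le.
have /andP[z1 z2] := (fiberP mh h0 hH incY gapY a (Y a)).1 erefl.
by rewrite (le_trans z1 z2) leNgt; apply/negP.
Qed.

Lemma graph_flat_measurable : measurable graph_flat.
Proof. by rewrite graph_flatE; exact: measurableD. Qed.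

Lemma not_flatE : not_flat = ~` [set a | h a = 0].
Proof.
apply/seteqP; split => a; rewrite /not_flat /= lt_neqAle h0 andbT.
  by move=> /eqP ha ha0; apply: ha.
by move=> /eqP; rewrite eq_sym.
Qed.

Lemma not_flat_measurable : measurable not_flat.
Proof. by rewrite not_flatE; exact: measurableC. Qed.

Lemma flat_partition a :
  \1_not_flat a + \1_plateau_flat a + \1_graph_flat a = 1 :> R.
Proof.
rewrite !indicE; have [ha|ha] := eqVneq (h a) 0; last first.
  have nf : not_flat a by rewrite /not_flat /= lt_neqAle h0 eq_sym ha.
  rewrite (mem_set nf) !memNset ?addr0// => -[ha0 _]; move: ha;
  by rewrite ha0 eqxx.
rewrite [X in X + _ + _](_ : _ = 0) ?add0r; last first.
  by rewrite memNset// /not_flat /= ha ltxx.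
have [pa|npa] := pselect (zl (Y a) < zr (Y a)).
  by rewrite mem_set// memNset ?addr0// => -[_ zz]; move: pa; rewrite zz ltxx.
rewrite memNset ?add0r; last by case.
by rewrite mem_set// graph_flatE; split.
Qed.

Let mI (A : set T) : measurable A -> @measurable_fun _ _ T R setT (fun a => e a * \1_A a).
Proof. by move=> mA; apply: measurable_funM => //; exact: measurable_indic. Qed.

Let I0 (A : set T) a : 0 <= e a * \1_A a.
Proof. by rewrite mulr_ge0// indicE. Qed.

Let Ifin (A : set T) : measurable A -> (\int[leb]_x (e x * \1_A x)%:E < +oo)%E.
Proof.
move=> mA; apply: le_lt_trans efin; apply: le_nnintegral => x _; rewrite lee_fin//.
by rewrite ler_piMr// indicE; case: (_ \in _).
Qed.

(** If [A] is null then [h da] does not charge its preimage, so [h] vanishes almost everywhere there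
    and [not_flat] meets it in a null set. *)
Lemma ac_null (A : set T) : measurable A -> leb A = 0%E ->
  (\int[leb]_(x in Y @^-1` A) (e x * \1_not_flat x)%:E = 0)%E.
Proof.
move=> mA A0; have mYA := measurable_preim mh h0 hH incY mA.
apply: (ge0_integral_eq0P leb mYA (mI not_flat_measurable) (I0 _)).2.
have := mono_push mh h0 hH incY gapY mA; rewrite A0.
move=> /(ge0_integral_eq0P leb mYA mh h0).1.
apply: ae_mono => x hx /hx h0x; rewrite indicE memNset ?mulr0//.
by rewrite /not_flat /= h0x ltxx.
Qed.

Lemma pp_concentrated :
  (\int[leb]_(x in Y @^-1` (~` plateau_values Y)) (e x * \1_plateau_flat x)%:E = 0)%E.
Proof.
apply: integral0_eq => x nx; rewrite indicE memNset ?mulr0// => -[_ zz].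
exact: nx.
Qed.

(** The fibre over [x] contains at most one point of [graph_flat], namely [zl x]. *)
Lemma sc_point (x : R) :
  (\int[leb]_(a in Y @^-1` [set x]) (e a * \1_graph_flat a)%:E = 0)%E.
Proof.
have mYx := measurable_preim mh h0 hH incY (measurable_set1 (x : R)).
apply: (ge0_integral_eq0P leb mYx (mI graph_flat_measurable) (I0 _)).2.
apply: (@negligibleS _ _ _ leb [set zl x]); last first.
  exact: negligible_set1.
move=> a; apply: contra_notP => /= ne /= Yax; rewrite indicE memNset ?mulr0// => -[_ zz].
apply: ne; have /andP[z1 z2] := (fiberP mh h0 hH incY gapY a x).1 Yax.
by apply/eqP; rewrite eq_le z1 andbT (le_trans z2)// -Yax zz.
Qed.

(** Off the plateaus [zl (Y a) = a], so [graph_flat] is sent into [flat_values], which is Lebesgue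
    null. *)
Lemma sc_concentrated :
  (\int[leb]_(x in Y @^-1` (~` flat_values Y h)) (e x * \1_graph_flat x)%:E = 0)%E.
Proof.
apply: integral0_eq => x nx; rewrite indicE memNset ?mulr0// graph_flatE => -[hx np].
by apply: nx; rewrite /flat_values /= (not_plateauP mh h0 hH incY gapY np).
Qed.

Lemma energy_decomposition (m : {finmeas R}) :
  (forall A : set T, measurable A -> m A = (\int[leb]_(x in Y @^-1` A) (e x)%:E)%E) ->
  exists ac pp sc : {finmeas R}, lebesgue_decomposition m ac pp sc /\
  forall A : set T, measurable A -> [/\
    pp A = (\int[leb]_(x in Y @^-1` A) (e x * \1_plateau_flat x)%:E)%E,
    sc A = (\int[leb]_(x in Y @^-1` A) (e x * \1_graph_flat x)%:E)%E &
    ac A = (\int[leb]_(x in Y @^-1` A) (e x * \1_not_flat x)%:E)%E].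
Proof.
move=> mE.
have [pp ppE] := pushforward_finmeas mY (mI plateau_flat_measurable) (I0 _)
  (Ifin plateau_flat_measurable).
have [sc scE] := pushforward_finmeas mY (mI graph_flat_measurable) (I0 _)
  (Ifin graph_flat_measurable).
have [ac acE] := pushforward_finmeas mY (mI not_flat_measurable) (I0 _)
  (Ifin not_flat_measurable).
exists ac, pp, sc; split; last by move=> A mA; rewrite ppE// scE// acE.
split.
- by apply/null_content_dominatesP => A mA A0; rewrite acE//; exact: ac_null.
- exists (plateau_values Y); split.
    exact: (plateau_countable mh h0 hH incY gapY).
  rewrite ppE; first exact: pp_concentrated.
  by apply: measurableC; exact: (plateau_measurable mh h0 hH incY gapY).
- split; first by move=> x; rewrite scE; [exact: sc_point|exact: measurable_set1].
  exists (flat_values Y h).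
  have mF := flat_values_measurable mh h0 hH incY gapY.
  split => //; first exact: (flat_values_null mh h0 hH incY gapY).
  by rewrite scE; [exact: sc_concentrated|exact: measurableC].
- move=> A mA; rewrite mE// ppE// scE// acE//.
  have mYA := measurable_preim mh h0 hH incY mA.
  have mIE (B : set T) : measurable B ->
      measurable_fun (Y @^-1` A : set T) (fun x => (e x * \1_B x)%:E).
    by move=> mB; apply: measurable_funTS; apply/measurable_EFinP; exact: mI.
  have i0 (B : set T) : forall x : T, (Y @^-1` A) x -> (0 <= (e x * \1_B x)%:E)%E.
    by move=> x _; rewrite lee_fin I0.
  have m1 := mIE _ not_flat_measurable; have m2 := mIE _ plateau_flat_measurable.
  have m3 := mIE _ graph_flat_measurable.
  rewrite -(ge0_integralD leb mYA (i0 _) m1 (i0 _) m2).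
  have i12 : forall x : T, (Y @^-1` A) x ->
      (0 <= (e x * \1_not_flat x)%:E + (e x * \1_plateau_flat x)%:E)%E.
    by move=> x _; rewrite -EFinD lee_fin addr_ge0.
  rewrite -(ge0_integralD leb mYA i12 (emeasurable_funD m1 m2) (i0 _) m3).
  apply: eq_integral => x _; rewrite -!EFinD -!mulrDr.
  by rewrite flat_partition mulr1.
Qed.

End EnergyDecomposition.

(** * Square integrable functions *)

Section SquareIntegrable.
Context {R : realType}.
Local Notation leb := (@lebesgue_measure R).
Local Notation T := (measurableTypeR R).

Lemma Lnorm2_sqr (k : R -> R) :
  ('N[leb]_2%:E [(EFin \o k : T -> \bar R)] ^+ 2 = \int[leb]_x (k x ^+ 2)%:E)%E.
Proof.
transitivity (\int[leb]_x `|(k x)%:E| `^ 2)%E.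
  rewrite -(@powR_Lnorm _ _ _ leb (EFin \o k : T -> \bar R) 2)//.
  have := Lnorm_ge0 leb 2%:E (EFin \o k : T -> \bar R).
  case: ('N[leb]_2%:E [_])%E => [r| |]//.
    by rewrite lee_fin => r0; rewrite -EFin_expe poweR_EFin powR_mulrn.
  by move=> _; rewrite poweRyr.
apply: eq_integral => x _.
rewrite -[`|(k x)%:E|%E]/((`|k x|)%:E) poweR_EFin powR_mulrn//.
by rewrite real_normK// num_real.
Qed.

Lemma L2P (k : R -> R) : L2 k <->
  @measurable_fun _ _ T R setT k /\ (\int[leb]_x (k x ^+ 2)%:E < +oo)%E.
Proof.
rewrite -Lnorm2_sqr; have N0 := Lnorm_ge0 leb 2%:E (EFin \o k : T -> \bar R).
split.
  rewrite /L2 inE => /andP[mk]; rewrite inE /= => nk; split; first by rewrite inE in mk.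
  move: nk N0; rewrite /finite_norm; case: ('N[leb]_2%:E [_])%E => [r| |]//.
  by move=> _ _; rewrite -EFinM ltry.
move=> [mk nk]; rewrite /L2 inE; apply/andP; split; first by rewrite inE.
rewrite inE /= /finite_norm; move: nk N0.
by case: ('N[leb]_2%:E [_])%E => [r| |]//=; rewrite ?ltry// mulyy ltxx.
Qed.

(** The bound [|k| <= 1 + k ^ 2] is integrable on compact sets. *)
Lemma L2_locally_integrable (k : R -> R) :
  @measurable_fun _ _ T R setT k -> (\int[leb]_x (k x ^+ 2)%:E < +oo)%E ->
  locally_integrable setT k.
Proof.
move=> mk k2; split; [exact: mk|exact: openT|move=> K _ cK].
have mK := compact_measurable cK.
have mk2 : measurable_fun setT (fun x : T => (k x ^+ 2)%:E).
  by apply/measurable_EFinP; exact: measurable_funX.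
apply: (@le_lt_trans _ _ (\int[leb]_(x in K) (1 + (k x ^+ 2)%:E))%E).
  apply: le_nnintegral => x _ //.
  rewrite /= -EFinD lee_fin -[X in _ <= _ + X](@real_normK _ (k x)) ?num_real//.
  have := sqr_ge0 (`|k x| - 1); have := normr_ge0 (k x); nra.
rewrite ge0_integralD//; last 2 first.
- by move=> x _; rewrite lee_fin sqr_ge0.
- exact: measurable_funTS.
rewrite integral_cst// mul1e; apply: lte_add_pinfty.
  exact: compact_finite_measure.
apply: le_lt_trans k2; apply: ge0_subset_integral => // x _.
by rewrite lee_fin sqr_ge0.
Qed.

End SquareIntegrable.

(** * The velocity and its slope at a fixed time *)

Section EulerianVelocity.
Context {R : realType}.
Local Notation leb := (@lebesgue_measure R).
Local Notation T := (measurableTypeR R).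
Variables (Y h : R -> R) (H C : R).
Hypotheses (mh : @measurable_fun _ _ T R setT h) (h0 : forall a, 0 <= h a).
Hypotheses (hH : forall a, h a <= H).
Hypothesis incY : forall a b, a <= b -> Y b - Y a = \int[leb]_(x in `[a, b]) h x.
Hypothesis gapY : forall a, `|Y a - a| <= C.
Variable e : R -> R.
Hypotheses (me : @measurable_fun _ _ T R setT e) (e0 : forall a, 0 <= e a).
Hypothesis efin : (\int[leb]_x (e x)%:E < +oo)%E.
Variables W w : R -> R.
Hypothesis mw : @measurable_fun _ _ T R setT w.
Hypothesis wE : forall a, w a ^+ 2 = e a * h a.
Hypothesis incW : forall a b, a <= b -> W b - W a = \int[leb]_(x in `[a, b]) w x.

Local Notation zl := (fiber_inf Y).

Let mY : @measurable_fun _ _ T T setT Y.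
Proof. exact: (mono_measurable mh h0 hH incY). Qed.

Let mzl : @measurable_fun _ _ T T setT zl.
Proof. exact: (fiber_inf_measurable mh h0 hH incY gapY). Qed.

(* Where [h] vanishes so does [w], and the quotient is then [0 / 0 = 0]. *)
Definition eulerian_slope (x : R) : R := w (zl x) / h (zl x).
Local Notation ux := eulerian_slope.

Lemma eulerian_slope_measurable : @measurable_fun _ _ T R setT ux.
Proof.
apply: measurable_funM; first exact: (measurableT_comp mw mzl).
exact: (measurableT_comp (@measurable_inv R) (measurableT_comp mh mzl)).
Qed.

Lemma flat_w0 a : h a = 0 -> w a = 0.
Proof. by move=> ha; apply/eqP; rewrite -sqrf_eq0 wE ha mulr0. Qed.

(** Off the plateaus the quotient is read at [a] itself; on the plateaus both sides vanish almost
    everywhere, because [h] does and [w ^ 2 = e * h]. *)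
Lemma eulerian_slope_ae : {ae leb, forall a : T, ux (Y a) * h a = w a}.
Proof.
have := ae_plateau_flat mh h0 hH incY gapY; apply: ae_mono => a ha.
have [/ha h0a|np] := pselect (plateau_values Y (Y a)).
  by rewrite h0a mulr0 flat_w0.
rewrite /ux (not_plateauP mh h0 hH incY gapY np).
have [h0a|hn0] := eqVneq (h a) 0; last by rewrite divfK.
by rewrite h0a mulr0 flat_w0.
Qed.

Lemma eulerian_slope_sqr_ae :
  {ae leb, forall a : T, ux (Y a) ^+ 2 * h a = e a * \1_(not_flat h) a}.
Proof.
have := ae_plateau_flat mh h0 hH incY gapY; apply: ae_mono => a ha.
have zero : h a = 0 -> ux (Y a) ^+ 2 * h a = e a * \1_(not_flat h) a.
  by move=> h0a; rewrite h0a mulr0 indicE memNset ?mulr0// /not_flat /= h0a ltxx.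
have [/ha /zero//|np] := pselect (plateau_values Y (Y a)).
have [/zero//|hn0] := eqVneq (h a) 0.
have nf : not_flat h a by rewrite /not_flat /= lt_neqAle h0 eq_sym hn0.
rewrite /ux (not_plateauP mh h0 hH incY gapY np) indicE mem_set// mulr1.
rewrite exprMn wE; field; exact: hn0.
Qed.

(** After the change of variables [Y] the integrand is [ux (Y a) ^ 2 * h a], which is
    [w ^ 2 / h = e] where [h > 0] and zero where [h = 0], up to a null set. *)
Lemma eulerian_slope_density (A : set T) : measurable A ->
  (\int[leb]_(x in A) (ux x ^+ 2)%:E =
   \int[leb]_(x in Y @^-1` A) (e x * \1_(not_flat h) x)%:E)%E.
Proof.
move=> mA; have mux := eulerian_slope_measurable.
have mux2 : measurable_fun setT (fun x : T => (ux x ^+ 2)%:E).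
  by apply/measurable_EFinP; exact: measurable_funX.
have mYA := measurable_preim mh h0 hH incY mA.
have push := fun A mA => mono_push mh h0 hH incY gapY (A := A) mA.
rewrite (@ge0_change_of_variables _ _ _ _ _ leb leb Y h mY mh h0 push A (fun x => (ux x ^+ 2)%:E) mA mux2); last first.
  by move=> x; rewrite lee_fin sqr_ge0.
apply: ge0_ae_eq_integral_any => //.
- apply: measurable_funTS; apply/measurable_EFinP; apply: measurable_funM => //.
  by apply: measurable_indic; exact: not_flat_measurable.
- by move=> x _; rewrite lee_fin mulr_ge0// indicE.
- by move=> x _; rewrite lee_fin mulr_ge0// sqr_ge0.
- have := eulerian_slope_sqr_ae; apply: ae_mono => a <- _.
  by rewrite EFinM.
Qed.

Lemma eulerian_slope_L2 : (\int[leb]_x (ux x ^+ 2)%:E <= \int[leb]_x (e x)%:E)%E.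
Proof.
rewrite eulerian_slope_density//; apply: le_nnintegral => x _.
  by rewrite lee_fin mulr_ge0// indicE.
by rewrite lee_fin ler_piMr// indicE; case: (_ \in _).
Qed.

Lemma eulerian_slope_locally_integrable : locally_integrable setT ux.
Proof.
apply: L2_locally_integrable; first exact: eulerian_slope_measurable.
exact: le_lt_trans eulerian_slope_L2 efin.
Qed.

Variable u : R -> R.
Hypothesis uY : forall a, u (Y a) = W a.

(** Pulling [ux] back by [Y] to the segment from [zl x] to [zl x'] turns it almost everywhere into
    [w], the density of [W]. *)
Lemma eulerian_increment (x x' : R) : x <= x' ->
  u x' - u x = \int[leb]_(z in `[x, x']) ux z.
Proof.
move=> xx'.
have zK := fiber_infK mh h0 hH incY gapY.
have zz : zl x <= zl x' by rewrite (fiber_inf_strict mh h0 hH incY gapY).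
have push := fun A mA => mono_push mh h0 hH incY gapY (A := A) mA.
have nd : {homo Y : a b / a <= b} := mono_nd h0 incY.
have [_] := transport_increment mY mh h0 nd push eulerian_slope_locally_integrable zz.
rewrite !zK => ->.
rewrite -{1}(zK x) -{1}(zK x') !uY incW// /Rintegral; congr fine.
apply: ae_eq_integral => //.
- by apply: measurable_funTS; exact/measurable_EFinP.
- apply: measurable_funTS; apply/measurable_EFinP; apply: measurable_funM => //.
  exact: (measurableT_comp eulerian_slope_measurable mY).
- by have := eulerian_slope_ae; apply: ae_mono => a /= <-.
Qed.

Lemma eulerian_continuous : continuous u.
Proof. exact: primitive_continuous eulerian_slope_locally_integrable eulerian_increment. Qed.

Lemma eulerian_weak_derivative : weak_derivative u ux.
Proof.
exact: increment_weak_derivative eulerian_continuous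
  eulerian_slope_locally_integrable eulerian_increment.
Qed.

Lemma eulerian_L2 : L2 ux.
Proof.
apply/L2P; split; first exact: eulerian_slope_measurable.
exact: le_lt_trans eulerian_slope_L2 efin.
Qed.

End EulerianVelocity.

(** * Absolute continuity from a square integrable derivative *)

Section L2Slope.
Context {R : realType}.
Local Notation leb := (@lebesgue_measure R).
Local Notation T := (measurableTypeR R).
Variables (u k : R -> R).
Hypothesis mk : @measurable_fun _ _ T R setT k.
Hypothesis k2 : (\int[leb]_x (k x ^+ 2)%:E < +oo)%E.
Hypothesis inc : forall a b, a <= b -> u b - u a = \int[leb]_(x in `[a, b]) k x.

Let Mk := fine (\int[leb]_x (k x ^+ 2)%:E)%E.

Let lk : locally_integrable setT k.
Proof. exact: L2_locally_integrable. Qed.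

Let lk2 : locally_integrable setT (fun x => k x ^+ 2).
Proof.
apply: open_integrable_locally; first exact: openT.
apply/integrableP; split; first by apply/measurable_EFinP; exact: measurable_funX.
rewrite (eq_integral (fun x : T => (k x ^+ 2)%:E))// => x _.
by rewrite /= ger0_norm// sqr_ge0.
Qed.

(* Young's inequality with a free weight [l]; optimizing [l] gives
   Cauchy-Schwarz, summing over intervals gives absolute continuity. *)
Lemma increment_young (a b l : R) : a <= b -> 0 < l ->
  `|u b - u a| <=
    (l * \int[leb]_(x in `[a, b]) (k x ^+ 2) + (b - a) / l) / 2.
Proof.
move=> ab l0; rewrite inc//.
have i1 := locally_integrable_itv a b lk; have i2 := locally_integrable_itv a b lk2.
apply: le_trans (le_normr_Rintegral _ i1) _ => //.
have c1 : leb.-integrable `[a, b] (EFin \o cst (l^-1 / 2)).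
  apply: locally_integrable_itv; apply: (@locally_integrable_bounded _ _ `|l^-1 / 2|) => //.
have i3 : leb.-integrable `[a, b] (EFin \o (fun x => l / 2 * k x ^+ 2)).
  exact: (integrableZl _ (l / 2) i2).
apply: le_trans (_ : \int[leb]_(x in `[a, b]) (l / 2 * k x ^+ 2 + cst (l^-1 / 2) x) <= _).
  apply: le_Rintegral => //.
  - exact: (integrable_abse i1).
  - exact: (integrableD _ i3 c1).
  - move=> x _; rewrite /cst -(@real_normK _ (k x)) ?num_real//.
    have := sqr_ge0 (l * `|k x| - 1); have l' : l^-1 > 0 by rewrite invr_gt0.
    have ll : l * l^-1 = 1 by rewrite mulfV// gt_eqF.
    move=> sq; have : 0 <= l^-1 * (l * `|k x| - 1) ^+ 2 by rewrite mulr_ge0// ltW.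
    have -> : l^-1 * (l * `|k x| - 1) ^+ 2 = l * `|k x| ^+ 2 - 2 * `|k x| + l^-1.
      by field; rewrite gt_eqF.
    lra.
rewrite RintegralD// RintegralZl// Rintegral_cst_itv//.
rewrite le_eqVlt; apply/orP; left; apply/eqP; ring.
Qed.

Lemma L2_globally_absolutely_continuous : globally_absolutely_continuous u.
Proof.
move=> eps eps0.
have M0 : 0 <= Mk by apply: fine_ge0; apply: integral_ge0 => x _; rewrite lee_fin sqr_ge0.
(* With this weight the energy term [l * Mk] is at most [eps], and a total length below [l * eps]
   keeps the other term below [eps]; the bound is half their sum. *)
pose l := eps / (Mk + 1).
have l0 : 0 < l by rewrite divr_gt0// ltr_pwDr.
exists (l * eps); first by rewrite mulr_gt0.
move=> n a b ab tI sum.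
have le1 i : `|u (b i) - u (a i)| <= (l * \int[leb]_(x in `[a i, b i]) (k x ^+ 2) + (b i - a i) / l) / 2.
  exact: increment_young.
apply: le_lt_trans (ler_sum _ (fun i _ => le1 i)) _.
rewrite -mulr_suml big_split /= -mulr_suml -mulr_sumr.
have kM : \sum_(i < n) \int[leb]_(x in `[a i, b i]) (k x ^+ 2) <= Mk.
  have mI i : measurable (`]a i, b i[%classic : set T) by exact: measurable_itv.
  (* Only the open intervals are assumed disjoint; dropping the endpoints does not change the
     integrals. *)
  have e i : (\int[leb]_(x in `[a i, b i]) (k x ^+ 2))%:E =
      (\int[leb]_(x in `]a i, b i[) (k x ^+ 2)%:E)%E.
    have mk2 (D : set T) : measurable D -> measurable_fun D (fun x : T => (k x ^+ 2)%:E).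
      by move=> mD; apply: measurable_funTS; apply/measurable_EFinP; exact: measurable_funX.
    rewrite integral_itv_bndo_bndc; last exact: mk2.
    rewrite integral_itv_obnd_cbnd; last exact: mk2.
    rewrite /Rintegral fineK//; apply: integrable_fin_num => //.
    exact: locally_integrable_itv.
  rewrite -lee_fin -sumEFin; under eq_bigr do rewrite e.
  rewrite /Mk fineK; last by rewrite ge0_fin_numE// integral_ge0// => x _; rewrite lee_fin sqr_ge0.
  pose I i : set T := `]a i, b i[%classic.
  have mU : measurable (\big[setU/set0]_(i <- index_enum 'I_n) I i).
    by apply: bigsetU_measurable => i _; exact: mI.
  rewrite -(@ge0_integral_bigsetU _ _ _ leb 'I_n I (fun x => (k x ^+ 2)%:E)) //.
  - apply: ge0_subset_integral => //.
    + by apply: measurable_funTS; apply/measurable_EFinP; exact: measurable_funX.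
    + by move=> x _; rewrite lee_fin sqr_ge0.
  - exact: index_enum_uniq.
  - exact: sub_trivIset tI.
  - by apply: measurable_funTS; apply/measurable_EFinP; exact: measurable_funX.
  - by move=> x _; rewrite lee_fin sqr_ge0.
have h1 : (\sum_(i < n) (b i - a i)) / l < eps by rewrite ltr_pdivrMr// mulrC.
have h2 : l * \sum_(i < n) \int[leb]_(x in `[a i, b i]) (k x ^+ 2) <= eps.
  apply: le_trans (ler_wpM2l (ltW l0) kM) _.
  by rewrite /l mulrAC ler_pdivrMr ?ltr_pwDr// ler_pM2l// lerDl.
rewrite ltr_pdivrMr// mulr_natr mulr2n; exact: ler_ltD.
Qed.

End L2Slope.

(** * The flow and its energy *)

(** Signed form of [ge0_ae_eq_integral_any], applied to positive and negative parts; [q] will be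
    built from [f] and from sets defined by pointwise derivatives. *)
Lemma ae_eq_integral_any d (T : measurableType d) (R : realType)
    (mu : {measure set T -> \bar R}) (D : set T) (p q : T -> \bar R) :
  measurable D -> measurable_fun D p ->
  {ae mu, forall x, D x -> p x = q x} ->
  (\int[mu]_(x in D) q x = \int[mu]_(x in D) p x)%E.
Proof.
move=> mD mp pq; rewrite integralE [RHS]integralE; congr (_ - _)%E.
  apply: ge0_ae_eq_integral_any => //; first exact: measurable_funepos.
  by apply: ae_mono pq => x h Dx; rewrite !funeposE h.
apply: ge0_ae_eq_integral_any => //; first exact: measurable_funeneg.
by apply: ae_mono pq => x h Dx; rewrite !funenegE h.
Qed.

Section Flow.
Context {R : realType}.
Local Notation leb := (@lebesgue_measure R).
Local Notation T := (measurableTypeR R).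
Variables (ubar ubarx : R -> R) (mubar : {finmeas R}).
Hypothesis hD : calD ubar ubarx mubar.
Variable S : set T.
Hypothesis hS : carries_singular ubarx mubar S.

Local Notation X := (xbar mubar).
Local Notation g := (jac ubarx mubar S).
Local Notation v := (vel ubarx mubar S).
Local Notation M := (fine (mubar setT)).

Definition energy_density (a : R) : R := 1 - g a.
Local Notation e := energy_density.
Definition flow_jac (t a : R) : R := g a + t * v a + t ^+ 2 / 4 * e a.
Local Notation hh := flow_jac.
Definition flow_slope (t a : R) : R := v a + t / 2 * e a.
Local Notation ww := flow_slope.
Local Notation Y t := (y ubar mubar ^~ t).
Definition flow_velocity (t a : R) : R := ubar (X a) + t / 2 * (a - X a).
Local Notation W := flow_velocity.

Let g0 a : 0 <= g a. Proof. exact: jac_ge0. Qed.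
Let g1 a : g a <= 1. Proof. exact: jac_le1. Qed.
Let mg : @measurable_fun _ _ T R setT g. Proof. exact: (jac_measurable hD hS). Qed.
Let mv : @measurable_fun _ _ T R setT v. Proof. exact: (vel_measurable hD hS). Qed.

Lemma energy_density_ge0 a : 0 <= e a.
Proof. by rewrite subr_ge0. Qed.

Lemma energy_density_le1 a : e a <= 1.
Proof. by rewrite lerBlDr lerDl. Qed.

Lemma energy_density_measurable : @measurable_fun _ _ T R setT e.
Proof. exact: measurable_funB. Qed.

Lemma vel_le1 a : `|v a| <= 1.
Proof.
rewrite -(@ler_pXn2r _ 2)// ?nnegrE// real_normK ?num_real// expr1n.
by rewrite vel_sqr mulr_ile1// ?energy_density_le1 ?energy_density_ge0.
Qed.

(** Completing the square gives [g * h = (g + t / 2 * v) ^ 2]. Where [g = 0] also [v = 0], and only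
    [t ^ 2 / 4 * e] remains. *)
Lemma flow_jac_ge0 t a : 0 <= hh t a.
Proof.
have := vel_sqr ubarx mubar S a; have := g0 a; rewrite le_eqVlt => /orP[/eqP g00|gp] v2.
  have v0 : v a = 0 by apply/eqP; rewrite -sqrf_eq0 v2 -g00 mul0r.
  by rewrite /hh v0 -g00 mulr0 !add0r mulr_ge0 ?energy_density_ge0// divr_ge0// sqr_ge0.
have E : (g a + t / 2 * v a) ^+ 2 =
    g a * hh t a + t ^+ 2 / 4 * (v a ^+ 2 - g a * (1 - g a)).
  by rewrite /hh /e; field.
move: E; rewrite v2 subrr mulr0 addr0 => E.
by rewrite -(pmulr_rge0 _ gp) -E sqr_ge0.
Qed.

(** The two sides differ by [v ^ 2 - g * e], which is zero by [vel_sqr]. *)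
Lemma flow_slope_sqr t a : ww t a ^+ 2 = e a * hh t a.
Proof.
have v2 := vel_sqr ubarx mubar S a.
rewrite -[RHS]addr0 -(subrr (v a ^+ 2)) {2}v2 /ww /hh /e; by field.
Qed.

Lemma flow_jac_bound t a : hh t a <= 1 + `|t| + t ^+ 2 / 4.
Proof.
rewrite /hh; apply: lerD; first apply: lerD => //.
  apply: le_trans (ler_norm _) _; rewrite normrM.
  by rewrite -[leRHS]mulr1 ler_wpM2l// vel_le1.
by rewrite -[leRHS]mulr1 ler_wpM2l ?energy_density_le1// divr_ge0// sqr_ge0.
Qed.

Lemma flow_slope_bound t a : `|ww t a| <= 1 + `|t|.
Proof.
rewrite /ww; apply: le_trans (ler_normD _ _) _; apply: lerD; first exact: vel_le1.
rewrite normrM (ger0_norm (energy_density_ge0 a)) -[leRHS]mulr1 ler_pM//.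
- exact: energy_density_ge0.
- rewrite normrM (ger0_norm (_ : 0 <= 2^-1)) ?invr_ge0// ler_pdivrMr//.
  by rewrite mulr_natr mulr2n lerDl.
- exact: energy_density_le1.
Qed.

Lemma flow_jac_measurable t : @measurable_fun _ _ T R setT (hh t).
Proof.
have me := energy_density_measurable.
apply: measurable_funD; first by apply: measurable_funD => //; exact: measurable_funM.
exact: measurable_funM.
Qed.

Lemma flow_slope_measurable t : @measurable_fun _ _ T R setT (ww t).
Proof.
by apply: measurable_funD => //; apply: measurable_funM => //; exact: energy_density_measurable.
Qed.

Let li (k : R -> R) (C : R) (a b : R) : @measurable_fun _ _ T R setT k ->
  (forall x, `|k x| <= C) -> leb.-integrable `[a, b] (EFin \o k).
Proof.
by move=> mk kC; apply: locally_integrable_itv; exact: locally_integrable_bounded mk kC.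
Qed.

Let ig a b : leb.-integrable `[a, b] (EFin \o g).
Proof. by apply: (li (C := 1)) => // x; rewrite ger0_norm. Qed.

Let iv a b : leb.-integrable `[a, b] (EFin \o v).
Proof. by apply: (li (C := 1)) => // x; exact: vel_le1. Qed.

Let ie a b : leb.-integrable `[a, b] (EFin \o e).
Proof.
apply: (li (C := 1)) => [|x]; first exact: energy_density_measurable.
by rewrite ger0_norm ?energy_density_le1// energy_density_ge0.
Qed.

Lemma energy_increment a b : a <= b ->
  (b - X b) - (a - X a) = \int[leb]_(x in `[a, b]) e x.
Proof.
move=> ab; rewrite /e RintegralB//; last first.
  by apply: (li (C := 1)) => // x; rewrite normr1.
rewrite -(xbar_increment hD hS ab) (Rintegral_cst_itv 1 ab); ring.
Qed.

Lemma combination_increment a b (t s : R) : a <= b ->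
  \int[leb]_(x in `[a, b]) (t * v x + s * e x) =
  t * (ubar (X b) - ubar (X a)) + s * ((b - X b) - (a - X a)).
Proof.
move=> ab; have it : leb.-integrable `[a, b] (EFin \o (fun x => t * v x)).
  exact: (integrableZl _ t (iv a b)).
have is_ : leb.-integrable `[a, b] (EFin \o (fun x => s * e x)).
  exact: (integrableZl _ s (ie a b)).
rewrite RintegralD// !RintegralZl//.
by rewrite -energy_increment// -(ubar_xbar_increment hD hS ab).
Qed.

Lemma flow_increment t a b : a <= b ->
  Y t b - Y t a = \int[leb]_(x in `[a, b]) hh t x.
Proof.
move=> ab; have ic : leb.-integrable `[a, b]
    (EFin \o (fun x => t * v x + t ^+ 2 / 4 * e x)).
  by apply: (integrableD _ (integrableZl _ t (iv a b))
    (integrableZl _ (t ^+ 2 / 4) (ie a b))).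
transitivity (\int[leb]_(x in `[a, b]) (g x + (t * v x + t ^+ 2 / 4 * e x))).
  by rewrite RintegralD// combination_increment// -(xbar_increment hD hS ab) /y; ring.
by apply: eq_Rintegral => x _; rewrite addrA.
Qed.

Lemma flow_velocity_increment t a b : a <= b ->
  W t b - W t a = \int[leb]_(x in `[a, b]) ww t x.
Proof.
move=> ab; transitivity (\int[leb]_(x in `[a, b]) (1 * v x + t / 2 * e x)).
  by rewrite combination_increment// /W; ring.
by apply: eq_Rintegral => x _; rewrite mul1r.
Qed.

Lemma calD_bounded : exists B : R, forall x, `|ubar x| <= B.
Proof.
have [[_ [B [_ hB]]] _ _ _] := hD; exists (`|B| + 1) => x.
by apply: hB => //; rewrite ltr_pwDr// ler_norm.
Qed.

(** The bound is explicit in [t] because the support of a test function has to be confined along the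
    flow for a whole range of times. *)
Lemma flow_gap : exists B : R, 0 <= B /\ (forall x, `|ubar x| <= B) /\
  forall t a, `|Y t a - a| <= M + B * `|t| + t ^+ 2 / 4 * M.
Proof.
have [B hB] := calD_bounded.
exists B; split; first exact: le_trans (normr_ge0 _) (hB 0).
split=> // t a; have /andP[F0 F1] := xbar_gap mubar a.
rewrite (_ : _ - a = - (a - X a) + ubar (X a) * t + t ^+ 2 / 4 * (a - X a)); last first.
  by rewrite /y; ring.
have tt : 0 <= t ^+ 2 / 4 by rewrite divr_ge0// sqr_ge0.
apply: le_trans (ler_normD _ _) _; apply: lerD.
  apply: le_trans (ler_normD _ _) _; apply: lerD; first by rewrite normrN ger0_norm.
  by rewrite normrM ler_wpM2r.
by rewrite (ger0_norm (mulr_ge0 tt F0)) ler_wpM2l.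
Qed.

Lemma flow_gap_at t : exists C, forall a, `|Y t a - a| <= C.
Proof. by have [B [_ [_ h]]] := flow_gap; exists (M + B * `|t| + t ^+ 2 / 4 * M). Qed.

Lemma energy_total : (\int[leb]_x (e x)%:E = mubar setT)%E.
Proof. by rewrite -(energy_push hD hS measurableT) preimage_setT. Qed.

Lemma energy_finite : (\int[leb]_x (e x)%:E < +oo)%E.
Proof. by rewrite energy_total ltey_eq finmeas_fin_num. Qed.

Lemma xbar_ae_derivable :
  {ae leb, forall a : T, derivable X a 1 /\ derive1 X a = g a}.
Proof.
apply: Lebesgue_ae_derivable; last by move=> a b; exact: (xbar_increment hD hS).
by apply: (@locally_integrable_bounded _ _ 1) => // a; rewrite ger0_norm.
Qed.

Lemma flow_ae_derivable t :
  {ae leb, forall a : T, derivable (Y t) a 1 /\ derive1 (Y t) a = hh t a}.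
Proof.
apply: Lebesgue_ae_derivable; last exact: flow_increment.
apply: (@locally_integrable_bounded _ _ (1 + `|t| + t ^+ 2 / 4)).
  exact: flow_jac_measurable.
by move=> a; rewrite ger0_norm ?flow_jac_bound// flow_jac_ge0.
Qed.

Lemma f_ae : {ae leb, forall a : T, f mubar a = e a}.
Proof. by apply: ae_mono xbar_ae_derivable => a [_ h]; rewrite /f h. Qed.

Lemma density_f (A : set T) : measurable A ->
  density (f mubar) A = (\int[leb]_(x in A) (e x)%:E)%E.
Proof.
move=> mA; apply: ae_eq_integral_any => //.
  by apply: measurable_funTS; apply/measurable_EFinP; exact: energy_density_measurable.
by apply: ae_mono f_ae => x -> .
Qed.

Lemma density_f_indic (A B B' : set T) : measurable A -> measurable B ->
  {ae leb, forall a, B a <-> B' a} ->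
  density (f mubar \* \1_B') A = (\int[leb]_(x in A) (e x * \1_B x)%:E)%E.
Proof.
move=> mA mB BB; apply: ae_eq_integral_any => //.
  apply: measurable_funTS; apply/measurable_EFinP; apply: measurable_funM.
    exact: energy_density_measurable.
  exact: measurable_indic.
apply: ae_mono2 f_ae BB => x fx [h1 h2] _; rewrite /= fx !indicE.
congr (_ * _)%:E; congr (_ %:R); congr nat_of_bool.
by apply/idP/idP => /set_mem h; apply/mem_set; [exact: h1|exact: h2].
Qed.

Lemma y_flat_ae t : {ae leb, forall a : T, y_flat ubar mubar t a <-> hh t a = 0}.
Proof.
apply: ae_mono (flow_ae_derivable t) => a [d1 d2].
by rewrite /y_flat /= d2; split => [[]//|].
Qed.

Lemma ALpp_ae t :
  {ae leb, forall a : T, plateau_flat (Y t) (hh t) a <-> ALpp ubar mubar t a}.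
Proof.
by apply: ae_mono (y_flat_ae t) => a [h1 h2]; split => -[? ?]; split; auto.
Qed.

Lemma ALsc_ae t :
  {ae leb, forall a : T, graph_flat (Y t) (hh t) a <-> ALsc ubar mubar t a}.
Proof.
by apply: ae_mono (y_flat_ae t) => a [h1 h2]; split => -[? ?]; split; auto.
Qed.

Lemma BL_ae t : {ae leb, forall a : T, not_flat (hh t) a <-> BL ubar mubar t a}.
Proof.
apply: ae_mono (flow_ae_derivable t) => a [d1 d2].
by rewrite /BL /not_flat /= d2; split => [|[]//].
Qed.

Lemma is_energyE (mu : R -> {finmeas R}) : is_energy ubar mubar mu ->
  forall t (A : set T), measurable A -> mu t A = (\int[leb]_(x in Y t @^-1` A) (e x)%:E)%E.
Proof.
move=> hmu t A mA; rewrite hmu// /pushforward density_f//.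
exact: measurable_preim (flow_jac_measurable t) (flow_jac_ge0 t) (flow_jac_bound t) (@flow_increment t) _ mA.
Qed.

(** The velocity is read at the left end of the fibre. This is consistent: between two points of a
    fibre [h] has integral zero, so [h], and with it the slope of [W], vanishes almost everywhere
    there, and [W] is constant on the fibre. *)
Lemma velocity_exists : exists u, is_velocity ubar mubar u.
Proof.
exists (fun x t => W t (z1 ubar mubar x t)) => a t.
have [C hC] := flow_gap_at t.
pose Ya := fiber_inf (Y t) (Y t a).
have YK : Y t Ya = Y t a.
  exact: fiber_infK (flow_jac_measurable t) (flow_jac_ge0 t) (flow_jac_bound t) (@flow_increment t) hC _.
have Yle : Ya <= a.
  have := fiber_infP (flow_jac_measurable t) (flow_jac_ge0 t) (flow_jac_bound t) (@flow_increment t) hC a (Y t a).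
  by rewrite lexx => ->.
have Winc := flow_velocity_increment t Yle.
have h0 : (\int[leb]_(x in `[Ya, a]) (hh t x)%:E = 0)%E.
  have := flow_increment t Yle; rewrite YK subrr /Rintegral => /esym/eqP.
  rewrite fine_eq0; first by move/eqP.
  apply: integrable_fin_num => //; apply: (li (C := 1 + `|t| + t ^+ 2 / 4)).
    exact: flow_jac_measurable.
  by move=> x; rewrite ger0_norm ?flow_jac_bound// flow_jac_ge0.
have mI : measurable (`[Ya, a]%classic : set T) by exact: measurable_itv.
have /ae_eq_integral_any w0 : {ae leb, forall x : T, `[Ya, a]%classic x -> (cst 0 x)%:E = (ww t x)%:E}.
  apply: ae_mono ((ge0_integral_eq0P leb mI (flow_jac_measurable t) (flow_jac_ge0 t)).1 h0).
  move=> x hx /hx h0x; congr EFin; apply/esym/eqP.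
  by rewrite -sqrf_eq0 flow_slope_sqr h0x mulr0.
have w0' : (\int[leb]_(x in `[Ya, a]) (ww t x)%:E = 0)%E.
  apply: etrans (w0 mI _) _; last exact: integral0.
  by apply/measurable_EFinP; exact: measurable_cst.
move: Winc; rewrite /Rintegral w0' /= => /eqP.
by rewrite subr_eq0 => /eqP e; rewrite -[LHS]e.
Qed.

End Flow.

(** * The energy measures and their weak continuity *)

Section EnergyMeasure.
Context {R : realType}.
Local Notation leb := (@lebesgue_measure R).
Local Notation T := (measurableTypeR R).
Variables (ubar ubarx : R -> R) (mubar : {finmeas R}).
Hypothesis hD : calD ubar ubarx mubar.
Variable S : set T.
Hypothesis hS : carries_singular ubarx mubar S.

Local Notation X := (xbar mubar).
Local Notation e := (energy_density ubarx mubar S).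
Local Notation hh := (flow_jac ubarx mubar S).
Local Notation Y t := (y ubar mubar ^~ t).

Let mh t := flow_jac_measurable hD hS t.
Let h0 t := flow_jac_ge0 ubarx mubar S t.
Let hH t := flow_jac_bound ubarx mubar S t.
Let inc t := fun a b (ab : a <= b) => flow_increment hD hS t ab.
Let me := energy_density_measurable hD hS.
Let e0 := energy_density_ge0 ubarx mubar S.
Let efin := energy_finite hD hS.

Let mY t : @measurable_fun _ _ T T setT (Y t).
Proof. exact: (mono_measurable (mh t) (h0 t) (hH t) (inc t)). Qed.

Lemma energy_exists : exists mu, is_energy ubar mubar mu.
Proof.
have /choice[mu hmu] : forall t, exists m : {finmeas R}, forall A : set T, measurable A ->
    m A = (\int[leb]_(x in Y t @^-1` A) (e x)%:E)%E.
  by move=> t; apply: pushforward_finmeas.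
exists mu => t A mA; rewrite hmu// /pushforward (density_f hD hS)//.
by rewrite -[X in measurable X]setTI; exact: mY.
Qed.

Lemma decomposition_exists (m : {finmeas R}) t :
  (forall A : set T, measurable A -> m A = (\int[leb]_(x in Y t @^-1` A) (e x)%:E)%E) ->
  exists ac pp sc : {finmeas R}, lebesgue_decomposition m ac pp sc /\
  forall A : set T, measurable A -> [/\
    pp A = (\int[leb]_(x in Y t @^-1` A) (e x * \1_(plateau_flat (Y t) (hh t)) x)%:E)%E,
    sc A = (\int[leb]_(x in Y t @^-1` A) (e x * \1_(graph_flat (Y t) (hh t)) x)%:E)%E &
    ac A = (\int[leb]_(x in Y t @^-1` A) (e x * \1_(not_flat (hh t)) x)%:E)%E].
Proof.
have [C hC] := flow_gap_at hD t.
exact: (energy_decomposition (mh t) (h0 t) (hH t) (inc t) hC me e0 efin).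
Qed.

Variable mu : R -> {finmeas R}.
Hypothesis hmu : is_energy ubar mubar mu.
Let muE t (A : set T) : measurable A -> mu t A = (\int[leb]_(x in Y t @^-1` A) (e x)%:E)%E.
Proof. exact: (is_energyE hD hS hmu). Qed.

Lemma energy_conservation t : mu t setT = mubar setT.
Proof. by rewrite muE// preimage_setT (energy_total hD hS). Qed.

(** Uniqueness transfers the formulas of the constructed decomposition to an arbitrary one. *)
Lemma energy_parts (ac pp sc : {finmeas R}) t : lebesgue_decomposition (mu t) ac pp sc ->
  forall A : set T, measurable A -> [/\
    pp A = (\int[leb]_(x in Y t @^-1` A) (e x * \1_(plateau_flat (Y t) (hh t)) x)%:E)%E,
    sc A = (\int[leb]_(x in Y t @^-1` A) (e x * \1_(graph_flat (Y t) (hh t)) x)%:E)%E &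
    ac A = (\int[leb]_(x in Y t @^-1` A) (e x * \1_(not_flat (hh t)) x)%:E)%E].
Proof.
move=> dec A mA; have [ac' [pp' [sc' [dec' h]]]] := decomposition_exists (@muE t).
have [-> -> ->] := lebesgue_decomposition_unique dec dec' mA.
exact: h.
Qed.

Lemma energy_parts_density (ac pp sc : {finmeas R}) t :
  lebesgue_decomposition (mu t) ac pp sc ->
  forall A : set T, measurable A -> [/\
    pp A = pushforward (density (f mubar \* \1_(ALpp ubar mubar t))) (Y t) A,
    sc A = pushforward (density (f mubar \* \1_(ALsc ubar mubar t))) (Y t) A &
    ac A = pushforward (density (f mubar \* \1_(BL ubar mubar t))) (Y t) A].
Proof.
move=> dec A mA; have [-> -> ->] := energy_parts dec mA.
have mYA : measurable (Y t @^-1` A : set T).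
  by rewrite -[X in measurable X]setTI; exact: mY.
have [C hC] := flow_gap_at hD t.
split; rewrite /pushforward; apply/esym.
- apply: (density_f_indic hD hS mYA _ (ALpp_ae hD hS t)).
  exact: (plateau_flat_measurable (mh t) (h0 t) (hH t) (inc t) hC).
- apply: (density_f_indic hD hS mYA _ (ALsc_ae hD hS t)).
  exact: (graph_flat_measurable (mh t) (h0 t) (hH t) (inc t) hC).
- apply: (density_f_indic hD hS mYA _ (BL_ae hD hS t)).
  exact: (not_flat_measurable (mh t) (h0 t)).
Qed.

Lemma flow_time_continuous a : continuous (y ubar mubar a).
Proof.
move=> t; apply: cvgD; first apply: cvgD; first exact: cvg_cst.
  by apply: cvgM; [exact: cvg_cst|exact: cvg_id].
apply: cvgM; last exact: cvg_cst.
by apply: cvgM; [exact: exprn_continuous|exact: cvg_cst].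
Qed.

Lemma Rintegral_energy (phi : R -> R) t : Cb phi ->
  \int[mu t]_x phi x = \int[leb]_a (phi (Y t a) * e a).
Proof.
move=> [cphi [B [_ hB]]].
have mphi : @measurable_fun _ _ T R setT phi by exact: (continuous_measurable_fun cphi).
have iphi : (mu t).-integrable setT (EFin \o phi).
  apply: measurable_bounded_integrable => //; first by rewrite ltey_eq finmeas_fin_num.
  by exists B; split => //; exact: num_real.
have push (A : set T) : measurable A ->
    (\int[leb]_(x in Y t @^-1` A) (e x)%:E = mu t A)%E by move=> mA; rewrite muE.
have := @Rintegral_change_of_variables _ _ T T R leb (mu t) (Y t) e (mY t) me e0 push
  setT phi measurableT mphi iphi.
by rewrite preimage_setT.
Qed.

(** In the Lagrangian variable the measure [e da] no longer depends on time, and dominated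
    convergence applies with the bound [B * e]. *)
Lemma energy_weak_continuous (phi : R -> R) : Cb phi ->
  continuous (fun t : R => \int[mu t]_x phi x).
Proof.
move=> Cphi; have [cphi [B0 [_ hB0]]] := Cphi.
pose B := `|B0| + 1.
have hB x : `|phi x| <= B by apply: hB0 => //; rewrite ltr_pwDr// ler_norm.
under eq_fun do rewrite Rintegral_energy//.
have mphi : @measurable_fun _ _ T R setT phi by exact: (continuous_measurable_fun cphi).
have mk t : measurable_fun setT (fun a : T => phi (Y t a) * e a).
  by apply: measurable_funM => //; exact: (measurableT_comp mphi (mY t)).
have ie : leb.-integrable setT (EFin \o (fun a : T => B * e a)).
  have ie' : leb.-integrable setT (EFin \o e).
    apply/integrableP; split; first exact/measurable_EFinP.
    rewrite (eq_integral (fun a : T => (e a)%:E))// => a _.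
    by rewrite /= ger0_norm.
  exact: (integrableZl measurableT B ie').
have dom t a : `|phi (Y t a) * e a| <= B * e a.
  by rewrite normrM (ger0_norm (e0 a)) ler_wpM2r.
have ik t : leb.-integrable setT (EFin \o (fun a : T => phi (Y t a) * e a)).
  apply: le_integrable ie => //; first by apply/measurable_EFinP; exact: mk.
  move=> a _ /=; rewrite lee_fin (ger0_norm (_ : 0 <= B * e a)) ?dom//.
  exact: le_trans (dom 0 a).
move=> t; apply: (@continuity_under_integral R _ T leb (fun t a => phi (Y t a) * e a)
  setT measurableT (t - 1) (t + 1) _ _ (fun a => B * e a)) => //.
- apply: aeW => a _ s _; apply: cvgM; last exact: cvg_cst.
  by apply: continuous_comp; [exact: flow_time_continuous|exact: cphi].
- by move=> s _; apply: aeW.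
- by apply/mem_set; rewrite /= in_itv/=; apply/andP; split; lra.
Qed.

End EnergyMeasure.

(** For each [n] only finitely many of the disjoint sets have mass at least [1 / (n + 1)]: more than
    [m setT * (n + 1)] of them would exceed the total mass. *)
Lemma countable_positive_measure d (T : measurableType d) (R : realType) (I : choiceType)
    (m : {finite_measure set T -> \bar R}) (F : I -> set T) :
  (forall i, measurable (F i)) -> trivIset setT F -> countable [set i | m (F i) != 0%E].
Proof.
move=> mF tF.
have fin A : measurable A -> m A \is a fin_num by move=> mA; exact: fin_num_measure.
suff h n : finite_set [set i | (n.+1%:R)^-1 <= fine (m (F i))].
  apply: (@sub_countable _ _ _ (\bigcup_n [set i | (n.+1%:R)^-1 <= fine (m (F i))])).
    apply: subset_card_le => i /= mi.
    have mi0 : 0 < fine (m (F i)).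
      by rewrite fine_gt0// lt0e mi measure_ge0 ltey_eq fin.
    exists (Num.truncn (fine (m (F i)))^-1) => //=.
    by rewrite invf_ple ?posrE// ltW// truncnS_gt.
  by apply: bigcup_countable => // n _; exact: finite_set_countable.
apply: contrapT => inf.
have [B BI cB] := infinite_set_fset (Num.truncn (fine (m setT) * n.+1%:R)).+1 inf.
set s := finmap.enum_fset B in cB *.
have mB : m (\big[setU/set0]_(i <- s) F i) = (\sum_(i <- s) m (F i))%E.
  by rewrite measure_fbigsetU//; exact: sub_trivIset tF.
have mB' : measurable (\big[setU/set0]_(i <- s) F i) by exact: bigsetU_measurable.
have : (m (\big[setU/set0]_(i <- s) F i) <= m setT)%E by rewrite le_measure// inE.
rewrite mB; apply/negP; rewrite -ltNge.
rewrite -(fineK (fin _ measurableT)).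
rewrite (eq_bigr (fun i => (fine (m (F i)))%:E)); last by move=> i _; rewrite fineK// fin.
rewrite sumEFin lte_fin.
apply: (@lt_le_trans _ _ (\sum_(i <- s) (n.+1%:R)^-1)); last first.
  by rewrite big_seq [leRHS]big_seq; apply: ler_sum => i /BI.
rewrite big_const_seq count_predT iter_addr_0 -[ltRHS]mulr_natr [ltRHS]mulrC ltr_pdivlMr//.
by apply: lt_le_trans (truncnS_gt _) _; rewrite ler_nat.
Qed.

(** * Flat sets and the singular parts of the energy *)

Section FlatSets.
Context {R : realType}.
Local Notation leb := (@lebesgue_measure R).
Local Notation T := (measurableTypeR R).
Variables (ubar ubarx : R -> R) (mubar : {finmeas R}).
Hypothesis hD : calD ubar ubarx mubar.
Variable S : set T.
Hypothesis hS : carries_singular ubarx mubar S.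

Local Notation X := (xbar mubar).
Local Notation g := (jac ubarx mubar S).
Local Notation e := (energy_density ubarx mubar S).
Local Notation hh := (flow_jac ubarx mubar S).
Local Notation Y t := (y ubar mubar ^~ t).

Let mh t := flow_jac_measurable hD hS t.
Let h0 t := flow_jac_ge0 ubarx mubar S t.
Let hH t := flow_jac_bound ubarx mubar S t.
Let inc t := fun a b (ab : a <= b) => flow_increment hD hS t ab.
Let me := energy_density_measurable hD hS.
Let e0 := energy_density_ge0 ubarx mubar S.

Lemma jac_gt0 a : 0 < g a <-> ~ S (X a).
Proof.
rewrite /jac; split; last first.
  by move=> nS; rewrite jac0_regular// invr_gt0 ltr_pwDl// sqr_ge0.
by move=> + SX; rewrite jac0_singular// ltxx.
Qed.

Lemma flow_jac_regular t a : ~ S (X a) -> hh t a = g a * (1 + t / 2 * ubarx (X a)) ^+ 2.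
Proof.
move=> nS; have den : 1 + ubarx (X a) ^+ 2 != 0 by rewrite lt0r_neq0// ltr_pwDl// sqr_ge0.
by rewrite /flow_jac /energy_density /vel /jac jac0_regular//; field.
Qed.

(** Over [S] one has [g = v = 0] and [h = t ^ 2 / 4], so the singular energy of the datum is spread
    out at every nonzero time. Off [S] the square in [flow_jac_regular] decides. *)
Lemma flow_jac_eq0 t a : t != 0 ->
  hh t a = 0 <-> ~ S (X a) /\ ubarx (X a) = - (2 / t).
Proof.
move=> t0; split=> [ha0|[nS ux]]; last first.
  by rewrite flow_jac_regular// ux; field.
have nS : ~ S (X a).
  move=> SX; move: ha0; rewrite /flow_jac /energy_density /vel /jac jac0_singular// !mulr0 !add0r subr0 mulr1.
  by apply/eqP; rewrite mulf_neq0// ?invr_eq0 ?pnatr_eq0// expf_neq0.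
split=> //; move: ha0; rewrite flow_jac_regular// => /eqP.
have := (jac_gt0 a).2 nS => /lt0r_neq0/negbTE gN0.
rewrite mulf_eq0 gN0/= sqrf_eq0 => /eqP E.
apply: (mulfI t0); rewrite mulrN mulrCA divff// mulr1.
by apply: (@mulIf _ 2^-1); rewrite ?invr_eq0 ?pnatr_eq0//; lra.
Qed.

(** Almost everywhere [xbar] has derivative [g], which is positive exactly off [S], so [BL0] amounts
    to the first condition of [flow_jac_eq0]. As [z1 <= z2] on every fibre, the two flat sets
    exhaust [y_flat]. *)
Lemma flat_AL t : t != 0 ->
  {ae leb, forall a : T, (ALpp ubar mubar t `|` ALsc ubar mubar t) a <-> AL ubarx mubar t a}.
Proof.
move=> t0; apply: ae_mono2 (y_flat_ae hD hS t) (xbar_ae_derivable hD hS).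
move=> a [h1 h2] [dX X'].
have zz : z1 ubar mubar (y ubar mubar a t) t <= z2 ubar mubar (y ubar mubar a t) t.
  have [C hC] := flow_gap_at hD t.
  have /andP[p q] := (fiberP (mh t) (h0 t) (hH t) (inc t) hC a (Y t a)).1 erefl.
  exact: le_trans p q.
split.
  by case=> -[/h1 /(flow_jac_eq0 _ t0)[/jac_gt0 ga ux] _]; split=> //; split=> //; rewrite X'.
case=> -[_]; rewrite X' => /jac_gt0 nS ux.
have fl : y_flat ubar mubar t a by apply: h2; apply/flow_jac_eq0.
move: zz; rewrite le_eqVlt => /orP[/eqP|] zz; [right|left]; by split.
Qed.

(** Off [S] there is no atom at [X a], so the lower and upper bounds of [a - X a] in [xbar_bounds]
    coincide. *)
Lemma XE_xbar t a : ~ S (X a) -> XE ubar mubar t (X a) = Y t a.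
Proof.
move=> nS; have [_ _ _ atom] := hS.
rewrite /XE /y; congr (_ + _ * _).
have /andP[] := xbar_bounds mubar a.
have -> : `]-oo, X a]%classic = `]-oo, X a[%classic `|` [set X a] by rewrite setUitv1.
have mI : measurable (`]-oo, X a[%classic : set T) by exact: measurable_itv.
have m1 : measurable ([set X a] : set T) by exact: measurable_set1.
rewrite measureU//; last first.
  by apply/seteqP; split=> // x [] /= + xX; rewrite in_itv/= xX ltxx.
move=> h1 h2; apply: le_anti; rewrite h1/=; apply: le_trans h2 _.
suff -> : (mubar `]-oo, X a[%classic + mubar [set X a] = mubar `]-oo, X a[%classic)%E by [].
by apply: etrans (congr1 (adde _) (atom _ nS)) _; exact: adde0.
Qed.

Lemma XE_measurable t : @measurable_fun _ _ T T setT (XE ubar mubar t).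
Proof.
have [[cu _] _ _ _] := hD.
have mu_ : @measurable_fun _ _ T T setT ubar by exact: (continuous_measurable_fun cu).
have mG : @measurable_fun _ _ T T setT (fun x => fine (mubar `]-oo, x[%classic)).
  apply: (@nondecreasing_measurable R setT) => // x z xz.
  exact: dist_left_mono.
apply: measurable_funD.
  by apply: measurable_funD => //; exact: measurable_funM.
exact: measurable_funM.
Qed.

Lemma AE_measurable t : measurable (AE ubarx t : set T).
Proof.
rewrite -[X in measurable X]setTI.
exact: ((calD_measurable hD) measurableT [set - (2 / t)] (measurable_set1 _)).
Qed.

Variable t : R.
Hypothesis t0 : t != 0.
Variables (ac pp sc : {finmeas R}).
Hypothesis parts : forall A : set T, measurable A -> [/\
    pp A = (\int[leb]_(x in Y t @^-1` A) (e x * \1_(plateau_flat (Y t) (hh t)) x)%:E)%E,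
    sc A = (\int[leb]_(x in Y t @^-1` A) (e x * \1_(graph_flat (Y t) (hh t)) x)%:E)%E &
    ac A = (\int[leb]_(x in Y t @^-1` A) (e x * \1_(not_flat (hh t)) x)%:E)%E].

Let mYpre (A : set T) : measurable A -> measurable (Y t @^-1` A : set T).
Proof. exact: measurable_preim (mh t) (h0 t) (hH t) (inc t) _. Qed.

Lemma singular_parts_flat (A : set T) : measurable A ->
  (pp A + sc A)%E =
  (\int[leb]_(x in (Y t @^-1` A `&` [set a | hh t a = 0%R])) (e x)%:E)%E.
Proof.
move=> mA; have [-> -> _] := parts mA; have [C hC] := flow_gap_at hD t.
have mp := plateau_flat_measurable (mh t) (h0 t) (hH t) (inc t) hC.
have mg := graph_flat_measurable (mh t) (h0 t) (hH t) (inc t) hC.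
have mi (B : set T) : measurable B ->
    measurable_fun (Y t @^-1` A) (fun x => (e x * \1_B x)%:E).
  move=> mB; apply/measurable_EFinP; apply: measurable_funTS; apply: measurable_funM => //.
rewrite -ge0_integralD//; last 5 first.
- exact: mYpre.
- by move=> x _; rewrite lee_fin mulr_ge0.
- exact: mi.
- by move=> x _; rewrite lee_fin mulr_ge0.
- exact: mi.
rewrite integral_mkcondr; apply: eq_integral => a _.
have := flat_partition (mh t) (h0 t) (hH t) (inc t) hC a.
rewrite patchE/= -EFinD -mulrDr.
have [ha|ha] := eqVneq (hh t a) 0.
  rewrite mem_set// [\1_(not_flat _) a]indicE memNset ?add0r => [->|]; first by rewrite mulr1.
  by rewrite /not_flat/= ha ltxx.
rewrite memNset; last exact/eqP.
rewrite [\1_(not_flat _) a]indicE mem_set; last by rewrite /not_flat/= lt_neqAle eq_sym ha h0.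
move=> E; suff -> : \1_(plateau_flat (Y t) (hh t)) a + \1_(graph_flat (Y t) (hh t)) a = 0 :> R.
  by rewrite mulr0.
by move: E => /=; lra.
Qed.

(** Flatness at [t != 0] depends on [a] only through [X a], and flat points move along [XE]: the
    flat points sent into [A] form a preimage under [X], to which [energy_push] applies. *)
Lemma singular_parts_mubar (A : set T) : measurable A ->
  (pp A + sc A)%E = mubar ((AE ubarx t `\` S) `&` XE ubar mubar t @^-1` A).
Proof.
move=> mA; have [mS _ _ _] := hS; rewrite singular_parts_flat//.
rewrite -(energy_push hD hS); last first.
  apply: measurableI; first by apply: measurableD => //; exact: AE_measurable.
  by rewrite -[X in measurable X]setTI; exact: XE_measurable.
congr (integral _ _ _); apply/seteqP; split=> a /=.
  by case=> Aa /(flow_jac_eq0 _ t0)[nS ux]; split; [split|rewrite XE_xbar].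
by case=> -[ux nS]; rewrite XE_xbar// => Aa; split => //; apply/flow_jac_eq0.
Qed.

(** Off [S] the measure [mubar] is the density [ubarx ^ 2], and for a density the Lebesgue null set
    [S] can be put back. *)
Lemma singular_parts_density (A : set T) : measurable A ->
  (pp A + sc A)%E = pushforward
    (density ((fun x => ubarx x ^+ 2) \* \1_(AE ubarx t))) (XE ubar mubar t) A.
Proof.
move=> mA; have [mS S0 reg _] := hS; rewrite singular_parts_mubar//.
have mXE : measurable (XE ubar mubar t @^-1` A : set T).
  by rewrite -[X in measurable X]setTI; exact: XE_measurable.
have mAE := AE_measurable t.
have mux := calD_measurable hD.
have mux2 (B : set T) : measurable_fun B (fun x => (ubarx x ^+ 2)%:E).
  by apply: measurable_funTS; apply/measurable_EFinP; exact: measurable_funX.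
rewrite reg; last 2 first.
- by apply: measurableI => //; exact: measurableD.
- by move=> x [[]].
rewrite /pushforward /density.
have -> : (AE ubarx t `\` S) `&` XE ubar mubar t @^-1` A =
    (XE ubar mubar t @^-1` A `&` AE ubarx t) `\` S.
  by apply/seteqP; split=> x /=; [case=> -[]|case=> -[]].
rewrite -ge0_negligible_integral//; first last.
- by move=> x _; rewrite lee_fin sqr_ge0.
- exact: measurableI.
rewrite integral_mkcondr; apply: eq_integral => x _.
by rewrite patchE/= indicE; case: (_ \in _); rewrite ?mulr1 ?mulr0.
Qed.

(** A Borel subset of the image of [AE t] under [XE t], whose own measurability is not established.
    Flat values are read through a Borel selection, and the plateau values are countably many. *)
Definition flat_image : set T :=
  flat_values (Y t) (hh t) `|` (plateau_values (Y t) `&` XE ubar mubar t @` AE ubarx t).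

Lemma flat_image_measurable : measurable flat_image.
Proof.
have [C hC] := flow_gap_at hD t.
apply: measurableU; first exact: (flat_values_measurable (mh t) (h0 t) (hH t) (inc t) hC).
apply: countable_measurable; first by move=> x; exact: measurable_set1.
apply: sub_countable (plateau_countable (mh t) (h0 t) (hH t) (inc t) hC).
by apply: subset_card_le => x [].
Qed.

Lemma flat_image_sub : flat_image `<=` XE ubar mubar t @` AE ubarx t.
Proof.
have [C hC] := flow_gap_at hD t.
move=> p [/=|[]//] /(flow_jac_eq0 _ t0)[nS ux].
exists (X (fiber_inf (Y t) p)) => //.
by rewrite XE_xbar//; exact: (fiber_infK (mh t) (h0 t) (hH t) (inc t) hC).
Qed.

Lemma singular_parts_carrier : measure_add pp sc (~` flat_image) = 0%E.
Proof.
have [C hC] := flow_gap_at hD t.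
rewrite measure_addE singular_parts_flat; last by apply: measurableC; exact: flat_image_measurable.
rewrite (_ : _ `&` _ = set0) ?integral_set0//.
apply/seteqP; split=> // a [/= nD ha0]; apply: nD.
have [zz|/(not_plateauP (mh t) (h0 t) (hH t) (inc t) hC) zY] :=
  pselect (plateau_values (Y t) (Y t a)).
  right; split=> //; have [nS ux] := (flow_jac_eq0 a t0).1 ha0.
  by exists (X a) => //; exact: XE_xbar.
by left; rewrite /flat_values/= zY.
Qed.

Lemma singular_parts_negligible :
  (measure_add pp sc).-negligible (~` (XE ubar mubar t @` AE ubarx t)).
Proof.
exists (~` flat_image); split.
- by apply: measurableC; exact: flat_image_measurable.
- exact: singular_parts_carrier.
- by apply: subsetC; exact: flat_image_sub.
Qed.

(** A ball that misses the image misses [flat_image], whose complement is null. *)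
Lemma singular_parts_support :
  msupport (measure_add pp sc) `<=` closure (XE ubar mubar t @` AE ubarx t).
Proof.
move=> p hp B /nbhs_ballP[r /= r0 rB].
apply: contrapT => /set0P/negP/negPn/eqP disj.
have mball : measurable (ball p r : set T) by exact: measurable_ball.
have := hp r r0; apply/negP; rewrite -leNgt.
rewrite -[leRHS]singular_parts_carrier le_measure ?inE//.
  by apply: measurableC; exact: flat_image_measurable.
move=> x xb /flat_image_sub Dx; have : set0 x by rewrite -disj; split => //; exact: rB.
by [].
Qed.

End FlatSets.

Section SingularTimes.
Context {R : realType}.
Local Notation T := (measurableTypeR R).
Variables (ubar ubarx : R -> R) (mubar : {finmeas R}).
Hypothesis hD : calD ubar ubarx mubar.
Variable S : set T.
Hypothesis hS : carries_singular ubarx mubar S.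

Lemma singular_times_countable : countable [set t | t = 0 \/ mubar (AE ubarx t `\` S) != 0%E].
Proof.
have [mS _ _ _] := hS.
have mF t : measurable (AE ubarx t `\` S : set T).
  by apply: measurableD => //; exact: AE_measurable hD t.
(* At [t = 0] the convention [2 / 0 = 0] makes [AE] a level set unrelated to that time; the single
   time 0 is added to the countable set by hand. *)
pose F (t : R) : set T := if t == 0 then set0 else AE ubarx t `\` S.
have mF' t : measurable (F t) by rewrite /F; case: ifP.
have tF : trivIset setT F.
  move=> s t _ _ [x []]; rewrite /F; case: eqVneq => // s0 [/= + _]; case: eqVneq => // t0 + [/= + _].
  rewrite /AE/= => -> /oppr_inj /(mulfI _) h; apply: invr_inj; apply: h.
  by rewrite pnatr_eq0.
apply: (@sub_countable _ _ _ ([set 0] `|` [set t | mubar (F t) != 0%E])).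
  apply: subset_card_le => t /= [->|h]; first by left.
  have [->|t0] := eqVneq t 0; first by left.
  by right; rewrite /F (negbTE t0).
rewrite -bigcup2E; apply: bigcup_countable => // -[|[|k]] _ /=.
- exact: countable1.
- exact: countable_positive_measure.
- exact: countable0.
Qed.

End SingularTimes.

(** * Functions on the plane *)

Section PlaneMeasurability.
Context {R : realType}.
Local Notation leb := (@lebesgue_measure R).
Local Notation leb2 := (leb \x leb)%E.
Local Notation T := (measurableTypeR R).

(* [k x t] is the limit of [k (q n x) t], where [q n x] is [x] rounded down to
   a multiple of [1 / (n + 1)]. *)
Lemma separately_continuous_measurable (k : R -> R -> R) :
  (forall x, @measurable_fun _ _ T T setT (k x)) ->
  (forall t, continuous (k ^~ t)) ->
  measurable_fun setT (fun p : T * T => k p.1 p.2).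
Proof.
move=> mk ck.
pose q n (x : R) : R := (Num.floor (n.+1%:R * x))%:~R / n.+1%:R.
have qx n x : `|q n x - x| <= (n.+1%:R)^-1.
  have n0 : 0 < n.+1%:R :> R by rewrite ltr0n.
  have /andP[h1 h2] := floor_itv (n.+1%:R * x).
  rewrite -(ler_pM2l n0) divff ?lt0r_neq0// -{1}(gtr0_norm n0) -normrM mulrBr.
  rewrite /q mulrCA divff ?lt0r_neq0// mulr1 distrC ger0_norm ?subr_ge0//.
  by rewrite lerBlDl; move: h2; rewrite intrD => /ltW.
apply: (@measurable_fun_cvg _ _ R setT (fun n (p : T * T) => k (q n p.1) p.2)); last first.
  move=> [x t] _ /=; apply: (@cvg_comp _ _ _ (q ^~ x) (k ^~ t) _ (nbhs x)); last exact: ck.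
  apply/cvgrPdist_le => eps eps0; near=> n; rewrite distrC; apply: le_trans (qx n x) _.
  rewrite ltW//; near: n; exact: (near_infty_natSinv_lt (PosNum eps0)).
move=> n _ B mB; rewrite setTI.
have -> : (fun p : T * T => k (q n p.1) p.2) @^-1` B =
    \bigcup_(z : int) ([set x : T | Num.floor (n.+1%:R * x) = z] `*`
      [set t : T | B (k (z%:~R / n.+1%:R) t)]).
  apply/seteqP; split=> [[x t] /= h|[x t] [z _] [/= <-]//].
  by exists (Num.floor (n.+1%:R * x)).
apply: countable_bigcupT_measurable; first exact: countableP.
move=> z; apply: measurableX.
  have mM : @measurable_fun _ _ T T setT (fun x => n.+1%:R * x) by exact: measurable_funM.
  have := mM measurableT `[z%:~R, (z + 1)%:~R[%classic (measurable_itv _); rewrite setTI.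
  congr (measurable _); apply/seteqP; split=> x /=; rewrite in_itv/=.
    by move=> h; apply: floor_def.
  by move=> <-; exact: floor_itv.
by rewrite -[X in measurable X]setTI; exact: mk.
Unshelve. all: by end_near. Qed.

(** Inner integrals in Fubini's theorem are finite only almost everywhere; this compares the real
    iterated integral, where an infinite value is read as 0, with the extended one. *)
Lemma Rintegral_fine (k : T -> \bar R) : measurable_fun setT k ->
  {ae leb, forall x, k x \is a fin_num} ->
  \int[leb]_x fine (k x) = fine (\int[leb]_x k x)%E.
Proof.
move=> mk kfin; rewrite /Rintegral; congr fine.
apply: ae_eq_integral_any => //.
by apply: ae_mono kfin => x h _; rewrite fineK.
Qed.

Lemma Rintegral_fubini1 (k : R * R -> R) : leb2.-integrable setT (EFin \o k) ->
  \int[leb2]_p k p = \int[leb]_x \int[leb]_t k (x, t).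
Proof.
move=> ik; rewrite (Rintegral_fine (measurable_fubini_F ik)).
  by rewrite /Rintegral -(integral12_prod_meas1 ik).
by apply: ae_mono (ae_integrable1 ik) => x h; exact: integrable_fin_num.
Qed.

Lemma Rintegral_fubini2 (k : R * R -> R) : leb2.-integrable setT (EFin \o k) ->
  \int[leb2]_p k p = \int[leb]_t \int[leb]_x k (x, t).
Proof.
move=> ik; rewrite (Rintegral_fine (measurable_fubini_G ik)).
  by rewrite /Rintegral -(integral21_prod_meas1 ik).
by apply: ae_mono (ae_integrable2 ik) => x h; exact: integrable_fin_num.
Qed.

Definition square (L : R) : set (T * T) := `[- L, L]%classic `*` `[- L, L]%classic.

Lemma squareP L (p : R * R) : square L p <-> `|p| <= L.
Proof.
rewrite /square /= !in_itv/= -!ler_norml prod_normE ge_max.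
by split => [[-> ->]//|/andP].
Qed.

Lemma square_compact L : compact (square L : set (R * R)).
Proof. by apply: compact_setX; exact: segment_compact. Qed.

Lemma square_measurable L : measurable (square L).
Proof. by apply: measurableX; exact: measurable_itv. Qed.

Lemma square_lty L : (leb2 (square L) < +oo)%E.
Proof.
rewrite /square product_measure1E; [|exact: measurable_itv|exact: measurable_itv].
have h : (leb `[(- L)%R, L]%classic < +oo)%E.
  by rewrite lebesgue_measure_itv/=; case: ifP; rewrite ?ltry.
by apply: lte_mul_pinfty => //; rewrite ge0_fin_numE.
Qed.

Lemma L2loc2_square (k : R * R -> R) : measurable_fun setT (k : T * T -> R) ->
  (forall L, \int[leb2]_(p in square L) (k p ^+ 2)%:E < +oo)%E -> L2loc2 k.
Proof.
move=> mk kL; split=> // K /compact_bounded[L [_ KL]].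
apply: le_lt_trans (kL (`|L| + 1)); apply: le_nnintegral_subset => p.
  by move=> Kp; apply/squareP; apply: KL => //; rewrite ltr_pwDr// ler_norm.
by rewrite lee_fin sqr_ge0.
Qed.

Lemma L2loc2_bounded (k : R * R -> R) : measurable_fun setT (k : T * T -> R) ->
  (forall L, exists C, forall p, `|p| <= L -> `|k p| <= C) -> L2loc2 k.
Proof.
move=> mk kC; apply: L2loc2_square => // L; have [C hC] := kC L.
have mkk : measurable_fun (square L) (fun p : T * T => (k p ^+ 2)%:E).
  by apply: measurable_funTS; apply/measurable_EFinP; exact: measurable_funX.
apply: (@le_lt_trans _ _ (\int[leb2]_(p in square L) (C ^+ 2)%:E)%E).
  apply: ge0_le_integral => //.
  - exact: square_measurable.
  - by move=> p _; rewrite lee_fin sqr_ge0.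
  - move=> p /squareP /hC kp; rewrite lee_fin -real_normK ?num_real//.
    by rewrite ler_pXn2r ?nnegrE// (le_trans _ kp).
rewrite integral_cst; last exact: square_measurable.
by rewrite lte_mul_pinfty ?lee_fin ?sqr_ge0//; exact: square_lty.
Qed.

(** On the square that contains the support of [psi] the product is dominated by
    [C * (k ^ 2 + 1)]. *)
Lemma L2loc2_mul_integrable (k psi : R * R -> R) (L C : R) : L2loc2 k ->
  measurable_fun setT (psi : T * T -> R) -> (forall p, `|psi p| <= C) ->
  (forall p, L <= `|p| -> psi p = 0) ->
  leb2.-integrable setT (EFin \o (fun p => k p * psi p)).
Proof.
move=> [mk k2] mpsi psiC psiL.
have C0 : 0 <= C by exact: le_trans (psiC 0).
have mS := square_measurable L.
have i1 : leb2.-integrable (square L) (EFin \o (fun p => k p ^+ 2)).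
  apply/integrableP; split.
    by apply: measurable_funTS; apply/measurable_EFinP; exact: measurable_funX.
  have k2L := k2 _ (@square_compact L).
  apply: le_lt_trans k2L; apply: le_nnintegral => p _; first exact: abse_ge0.
  by rewrite /= ger0_norm ?sqr_ge0.
have i2 : leb2.-integrable (square L) (EFin \o (fun p => C * (k p ^+ 2 + 1))).
  have ic : leb2.-integrable (square L) (EFin \o (fun p => 1 : R)).
    apply/integrableP; split; first by apply/measurable_EFinP; exact: measurable_cst.
    rewrite /= normr1 integral_cst// mul1e; exact: square_lty.
  exact: (integrableZl mS C (integrableD mS i1 ic)).
have i3 := (integrable_mkcond _ mS).1 i2.
apply: le_integrable i3 => //.
  by apply/measurable_EFinP; exact: measurable_funM.
move=> p _; rewrite patchE /= normrM.
have [Lp|pL] := leP L `|p|; first by rewrite psiL// normr0 mulr0 abse_ge0.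
rewrite mem_set; last by apply/squareP; exact: ltW.
have k1 : 0 <= C * (k p ^+ 2 + 1) by rewrite mulr_ge0// addr_ge0// sqr_ge0.
rewrite lee_fin (ger0_norm k1) mulrC ler_pM//.
rewrite -[k p ^+ 2]real_normK ?num_real//.
by have := sqr_ge0 (`|k p| - 1); nra.
Qed.

End PlaneMeasurability.

(** * Test functions in the plane *)

Section PlanarTestFunctions.
Context {R : realType}.
Local Notation T := (measurableTypeR R).
Implicit Types phi : R * R -> R.

Lemma derivable_fst phi (x t : R) : derivable phi (x, t) (1, 0) ->
  is_derive x 1 (fun z => phi (z, t)) ('D_(1, 0) phi (x, t)).
Proof.
have E : (fun h : R => h^-1 *: ((phi \o shift (x, t)) (h *: (1, 0)) - phi (x, t))) =
    (fun h : R => h^-1 *: (((fun z => phi (z, t)) \o shift x) (h *: 1) - phi (x, t))).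
  apply/funext => h /=; congr (_ *: (phi _ - _)).
  by apply: injective_projections; rewrite /= ?scaler0 ?add0r.
rewrite /derivable /derive E => d.
by apply: DeriveDef.
Qed.

Lemma derivable_snd phi (x t : R) : derivable phi (x, t) (0, 1) ->
  is_derive t 1 (fun z => phi (x, z)) ('D_(0, 1) phi (x, t)).
Proof.
have E : (fun h : R => h^-1 *: ((phi \o shift (x, t)) (h *: (0, 1)) - phi (x, t))) =
    (fun h : R => h^-1 *: (((fun z => phi (x, z)) \o shift t) (h *: 1) - phi (x, t))).
  apply/funext => h /=; congr (_ *: (phi _ - _)).
  by apply: injective_projections; rewrite /= ?scaler0 ?add0r.
rewrite /derivable /derive E => d.
by apply: DeriveDef.
Qed.

Lemma is_derive_cvg (k : R -> R) (t l : R) :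
  h^-1 *: ((k \o shift t) (h *: 1) - k t) @[h --> 0^'] --> l -> is_derive t (1 : R) k l.
Proof.
by move=> lim; apply: DeriveDef; [apply/cvg_ex; eexists; exact: lim|exact: cvg_lim lim].
Qed.

Lemma mean_value (k dk : R -> R) (a b : R) :
  (forall x : R, is_derive x (1 : R) k (dk x)) ->
  exists2 c, `|c - a| <= `|b - a| & k b - k a = dk c * (b - a).
Proof.
move=> hk; have ck (i : interval R) : {within [set` i], continuous k}.
  by apply: derivable_within_continuous => x _; have [] := hk x.
have [ab|/ltW ba] := leP a b.
  have [c] := MVT_segment ab (fun x _ => hk x) (ck _); rewrite in_itv/= => /andP[h1 h2] e.
  by exists c => //; rewrite !ger0_norm ?subr_ge0// lerB.
have [c] := MVT_segment ba (fun x _ => hk x) (ck _); rewrite in_itv/= => /andP[h1 h2] e.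
exists c; last by rewrite -opprB e -mulrN opprB.
by rewrite !ler0_norm ?subr_le0// lerN2 lerB.
Qed.

Lemma continuous_fst_arg (k : R * R -> R) t : continuous k -> continuous (fun x => k (x, t)).
Proof.
move=> ck x; have h : (z, t) @[z --> x] --> (x, t) by exact: (cvg_pair cvg_id (cvg_cst t)).
exact: cvg_comp h (ck _).
Qed.

Lemma continuous_snd_arg (k : R * R -> R) x : continuous k -> continuous (fun t => k (x, t)).
Proof.
move=> ck t; have h : (x, z) @[z --> t] --> (x, t) by exact: (cvg_pair (cvg_cst x) cvg_id).
exact: cvg_comp h (ck _).
Qed.

Lemma continuous_plane_measurable (k : R * R -> R) : continuous k ->
  measurable_fun setT (k : T * T -> R).
Proof.
move=> ck; rewrite (_ : k = fun p => (fun x t => k (x, t)) p.1 p.2); last first.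
  by apply/funext => -[].
apply: (@separately_continuous_measurable R (fun x t => k (x, t))) => [x|t].
  exact: (continuous_measurable_fun (@continuous_snd_arg k x ck)).
exact: continuous_fst_arg.
Qed.

Lemma compactly_supported_bounded (k : R * R -> R) L : continuous k ->
  (forall p, L <= `|p| -> k p = 0) -> exists C, forall p, `|k p| <= C.
Proof.
move=> ck kL; have [C [_ hC]] : bounded_set (k @` (square L : set (R * R))).
  apply: compact_bounded; apply: continuous_compact; last exact: square_compact.
  exact: continuous_subspaceT.
exists (`|C| + 1) => p; have [Lp|pL] := leP L `|p|; first by rewrite kL// normr0 addr_ge0.
apply: hC; first by rewrite ltr_pwDr// ler_norm.
by exists p => //; apply/squareP; exact: ltW.
Qed.

Section Test.
Variable phi : R * R -> R.
Hypothesis Cphi : C1c2 phi.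
Local Notation Dx := (fun p => 'D_(1, 0) phi p).
Local Notation Dt := (fun p => 'D_(0, 1) phi p).

Lemma C1c2_dx (x t : R) : is_derive x (1 : R) (fun z => phi (z, t)) (Dx (x, t)).
Proof. by case: Cphi => d _ _ _; apply: derivable_fst; apply: d; rewrite inE eqxx. Qed.

Lemma C1c2_dt (x t : R) : is_derive t (1 : R) (fun z => phi (x, z)) (Dt (x, t)).
Proof. by case: Cphi => d _ _ _; apply: derivable_snd; apply: d; rewrite !inE eqxx orbT. Qed.

Lemma C1c2_support : exists2 L : R, 0 < L &
  forall p, L <= `|p| -> [/\ phi p = 0, Dx p = 0 & Dt p = 0].
Proof.
have [_ _ _ /compactly_supported_far[L L0 far]] := Cphi.
exists L => // p /far nz; by rewrite -(nbhs_singleton nz) -!(near_eq_derive _ nz) !derive_cst.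
Qed.

Lemma C1c2_section t : C1c (fun x => phi (x, t)) /\
  derive1 (fun x => phi (x, t)) = (fun x => Dx (x, t)).
Proof.
have E : derive1 (fun x => phi (x, t)) = (fun x => Dx (x, t)).
  by apply/funext => x; rewrite derive1E; have [] := C1c2_dx x t.
split=> //; have [_ cx _ _] := Cphi; split.
- by move=> x; have [] := C1c2_dx x t.
- by rewrite E; exact: continuous_fst_arg cx.
have [L _ hL] := C1c2_support.
apply: (@compactly_supported_segment _ _ (- L) L) => x /negP.
rewrite /= in_itv/= -ler_norml -ltNge => xL.
by have [] := hL (x, t) _; rewrite // prod_normE le_max ltW.
Qed.

Lemma C1c2_measurable : measurable_fun setT (phi : T * T -> R).
Proof.
rewrite (_ : phi = fun p => (fun x t => phi (x, t)) p.1 p.2); last first.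
  by apply/funext => -[].
apply: (@separately_continuous_measurable R (fun x t => phi (x, t))) => [x|t].
  have : continuous (fun t => phi (x, t)).
    move=> t; apply/differentiable_continuous/derivable1_diffP.
    by have [] := C1c2_dt x t.
  exact: continuous_measurable_fun.
move=> x; apply/differentiable_continuous/derivable1_diffP.
by have [] := C1c2_dx x t.
Qed.

Lemma C1c2_bounded : exists C, forall p,
  [/\ `|phi p| <= C, `|Dx p| <= C & `|Dt p| <= C].
Proof.
have [L L0 hL] := C1c2_support; have [_ cx ct _] := Cphi.
have [C1 h1] : exists C, forall p, `|Dx p| <= C.
  by apply: (compactly_supported_bounded (L := L) cx) => p /hL[].
have [C2 h2] : exists C, forall p, `|Dt p| <= C.
  by apply: (compactly_supported_bounded (L := L) ct) => p /hL[].
have C10 : 0 <= C1 by exact: le_trans (h1 0).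
have C20 : 0 <= C2 by exact: le_trans (h2 0).
(* For [|x| < L] the function [phi] is compared with its zero value at abscissa [L], at distance at
   most [2 * L], by the mean value theorem. *)
exists (C1 * (2 * L) + C1 + C2) => -[x t].
have p0 : 0 <= C1 * (2 * L) by rewrite !mulr_ge0// ltW.
split; last 2 first.
- by apply: le_trans (h1 _) _; rewrite addrAC lerDr addr_ge0.
- by apply: le_trans (h2 _) _; rewrite lerDr addr_ge0.
apply: (@le_trans _ _ (C1 * (2 * L))); last by rewrite -addrA lerDl addr_ge0.
have [Lx|xL] := leP L `|x|.
  by have [-> _ _] : [/\ phi (x, t) = 0, Dx (x, t) = 0 & Dt (x, t) = 0];
    [apply: hL; rewrite prod_normE le_max Lx|rewrite normr0].
have [c _] := mean_value L x (fun z => C1c2_dx z t).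
have [-> _ _] : [/\ phi (L, t) = 0, Dx (L, t) = 0 & Dt (L, t) = 0].
  by apply: hL; rewrite prod_normE le_max ler_norm.
rewrite subr0 => ->; rewrite normrM ler_pM//.
by move: xL; rewrite ltr_norml => /andP[xl xr]; rewrite ler_norml; apply/andP; split; lra.
Qed.

(** The increment is split into a horizontal one at time [h + t] and a vertical one at abscissa
    [p t]. The mean value theorem evaluates the partial derivatives at intermediate points, which
    converge to [(p t, t)]; continuity of the partial derivatives concludes. *)
Lemma C1c2_chain (p : R -> R) (dp t : R) : is_derive t (1 : R) p dp ->
  is_derive t (1 : R) (fun s => phi (p s, s)) (Dx (p t, t) * dp + Dt (p t, t)).
Proof.
move=> hp; have [_ cx ct _] := Cphi.
have cp : {for t, continuous p}.
  by apply/differentiable_continuous/derivable1_diffP; have [] := hp.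
have /choice[c hc] : forall h : R, exists c, `|c - p t| <= `|p (h + t) - p t| /\
    phi (p (h + t), h + t) - phi (p t, h + t) = Dx (c, h + t) * (p (h + t) - p t).
  move=> h; have [c c1 c2] := mean_value (p t) (p (h + t)) (fun z => C1c2_dx z (h + t)).
  by exists c.
have /choice[d hd] : forall h : R, exists d, `|d - t| <= `|h| /\
    phi (p t, h + t) - phi (p t, t) = Dt (p t, d) * h.
  move=> h; have [d d1 d2] := mean_value t (h + t) (fun z => C1c2_dt (p t) z).
  by exists d; move: d1 d2; rewrite addrK.
have cht : (h + t @[h --> 0^'] --> t).
  rewrite -[X in _ --> X]add0r; apply: cvgD; last exact: cvg_cst.
  exact: (nbhs_dnbhs (x := 0)).
have cc : c h @[h --> 0^'] --> p t.
  have /cvgrPdist_le h1 : p (h + t) @[h --> 0^'] --> p t by exact: cvg_comp cht cp.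
  apply/cvgrPdist_le => eps eps0; apply: filterS (h1 _ eps0) => h; rewrite distrC => h2.
  by rewrite distrC; apply: le_trans (hc h).1 h2.
have cd : d h @[h --> 0^'] --> t.
  have /cvgrPdist_le h1 : h @[h --> 0^'] --> (0 : R) by exact: (nbhs_dnbhs (x := 0)).
  apply/cvgrPdist_le => eps eps0; apply: filterS (h1 _ eps0) => h; rewrite sub0r normrN => h2.
  by rewrite distrC; apply: le_trans (hd h).1 h2.
apply: is_derive_cvg.
have e : {near 0^', (fun h : R => Dx (c h, h + t) * (h^-1 *: ((p \o shift t) (h *: 1) - p t)) +
    Dt (p t, d h)) =1 (fun h => h^-1 *: (((fun s => phi (p s, s)) \o shift t) (h *: 1) - phi (p t, t)))}.
  near=> h; have h0 : h != 0 by near: h; exact: nbhs_dnbhs_neq.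
  rewrite /= ![h *: 1]mulr1 -(subrKA (phi (p t, h + t)) (phi (p (h + t), h + t))).
  rewrite (hc h).2 (hd h).2.
  rewrite -![h^-1 *: _]/(h^-1 * _); by field.
apply: cvg_trans (near_eq_cvg e) _; apply: cvgD.
  apply: cvgM; last by have [dp' <-] := hp; exact: dp'.
  apply: (@cvg_comp _ _ _ (fun h => (c h, h + t)) Dx _ (nbhs (p t, t))); last exact: cx.
  exact: (cvg_pair cc cht).
apply: (@cvg_comp _ _ _ (fun h => (p t, d h)) Dt _ (nbhs (p t, t))); last exact: ct.
exact: (cvg_pair (cvg_cst _) cd).
Unshelve. all: by end_near. Qed.

End Test.
End PlanarTestFunctions.

(** * The Eulerian velocity *)

Section SpaceTimeVelocity.
Context {R : realType}.
Local Notation leb := (@lebesgue_measure R).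
Local Notation T := (measurableTypeR R).
Variables (ubar ubarx : R -> R) (mubar : {finmeas R}).
Hypothesis hD : calD ubar ubarx mubar.
Variable S : set T.
Hypothesis hS : carries_singular ubarx mubar S.

Local Notation X := (xbar mubar).
Local Notation M := (fine (mubar setT)).
Local Notation e := (energy_density ubarx mubar S).
Local Notation hh := (flow_jac ubarx mubar S).
Local Notation ww := (flow_slope ubarx mubar S).
Local Notation W := (flow_velocity ubar mubar).
Local Notation Y t := (y ubar mubar ^~ t).

Let mh t := flow_jac_measurable hD hS t.
Let h0 t := flow_jac_ge0 ubarx mubar S t.
Let hH t := flow_jac_bound ubarx mubar S t.
Let inc t := fun a b (ab : a <= b) => flow_increment hD hS t ab.
Let mw t := flow_slope_measurable hD hS t.
Let wE t := flow_slope_sqr ubarx mubar S t.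
Let incW t := fun a b (ab : a <= b) => flow_velocity_increment hD hS t ab.
Let me := energy_density_measurable hD hS.
Let e0 := energy_density_ge0 ubarx mubar S.
Let efin := energy_finite hD hS.

Let M0 : 0 <= M. Proof. exact: fine_ge0. Qed.

Variable u : R -> R -> R.
Hypothesis hu : is_velocity ubar mubar u.
Let uY t a : u (Y t a) t = W t a. Proof. exact: hu. Qed.

Definition velocity_slope (x t : R) : R := eulerian_slope (Y t) (hh t) (ww t) x.
Local Notation ux := velocity_slope.

Lemma velocity_increment t a b : a <= b ->
  u b t - u a t = \int[leb]_(x in `[a, b]) ux x t.
Proof.
have [C hC] := flow_gap_at hD t => ab.
exact: (eulerian_increment (mh t) (h0 t) (hH t) (inc t) hC me e0 efin (mw t)
  (wE t) (incW t) (u := u ^~ t) (uY t)).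
Qed.

Lemma velocity_continuous t : continuous (u ^~ t).
Proof.
have [C hC] := flow_gap_at hD t.
exact: (eulerian_continuous (mh t) (h0 t) (hH t) (inc t) hC me e0 efin (mw t)
  (wE t) (incW t) (u := u ^~ t) (uY t)).
Qed.

Lemma velocity_weak_derivative t : weak_derivative (u ^~ t) (ux ^~ t).
Proof.
have [C hC] := flow_gap_at hD t.
exact: (eulerian_weak_derivative (mh t) (h0 t) (hH t) (inc t) hC me e0 efin (mw t)
  (wE t) (incW t) (u := u ^~ t) (uY t)).
Qed.

Lemma velocity_slope_L2 t : L2 (ux ^~ t).
Proof.
have [C hC] := flow_gap_at hD t.
exact: (eulerian_L2 (mh t) (h0 t) (hH t) (inc t) hC me e0 efin (mw t) (wE t)).
Qed.

Let mux t : @measurable_fun _ _ T R setT (ux ^~ t).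
Proof. by have [] := (L2P _).1 (velocity_slope_L2 t). Qed.

Lemma velocity_slope_total t : (\int[leb]_x (ux x t ^+ 2)%:E <= M%:E)%E.
Proof.
have [C hC] := flow_gap_at hD t.
rewrite fineK ?finmeas_fin_num// -(energy_total hD hS).
exact: (eulerian_slope_L2 (mh t) (h0 t) (hH t) (inc t) hC me e0 (mw t) (wE t)).
Qed.

Let ux2fin t : (\int[leb]_x (ux x t ^+ 2)%:E < +oo)%E.
Proof. exact: le_lt_trans (velocity_slope_total t) (ltry _). Qed.

Lemma velocity_slope_density t (A : set T) : measurable A ->
  density (fun x => ux x t ^+ 2) A =
  (\int[leb]_(x in Y t @^-1` A) (e x * \1_(not_flat (hh t)) x)%:E)%E.
Proof.
have [C hC] := flow_gap_at hD t => mA.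
exact: (eulerian_slope_density (mh t) (h0 t) (hH t) (inc t) hC me e0 (mw t) (wE t) mA).
Qed.

Lemma velocity_globally_ac t : globally_absolutely_continuous (u ^~ t).
Proof.
exact: (L2_globally_absolutely_continuous (mux t) (ux2fin t) (@velocity_increment t)).
Qed.

Lemma flow_time_measurable : measurable_fun setT (fun p : T * T => y ubar mubar p.1 p.2).
Proof.
apply: (@separately_continuous_measurable R (y ubar mubar)) => [a|t].
  exact: (continuous_measurable_fun (flow_time_continuous (a := a))).
exact: (mono_continuous (mh t) (h0 t) (hH t) (inc t)).
Qed.

(** By the Galois connection, the pseudo-inverse exceeds [c] exactly where [y c t < x], and this
    inequality is measurable in [(x, t)]. *)
Lemma fiber_inf_jointly_measurable :
  @measurable_fun _ _ (T * T)%type T setT (fun p => fiber_inf (Y p.2) p.1).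
Proof.
move=> mT; apply: (measurability _ (RGenOInfty.measurableE R)) => //.
move=> /= _ [_ [c ->] <-]; rewrite setTI.
have mYc : @measurable_fun _ _ (T * T)%type T setT (fun p => p.1 - y ubar mubar c p.2).
  apply: measurable_funB; first exact: measurable_fst.
  apply: (measurableT_comp (f := y ubar mubar c)); last exact: measurable_snd.
  exact: (continuous_measurable_fun (flow_time_continuous (a := c))).
have := mYc mT `]0, +oo[%classic (measurable_itv _); rewrite setTI.
congr (measurable _); apply/seteqP; split=> -[x t] /=; rewrite !in_itv/= !andbT;
  have [C hC] := flow_gap_at hD t.
  by rewrite subr_gt0 !ltNge (fiber_infP (mh t) (h0 t) (hH t) (inc t) hC).
by rewrite subr_gt0 !ltNge (fiber_infP (mh t) (h0 t) (hH t) (inc t) hC).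
Qed.

Lemma velocity_slope_jointly_measurable :
  measurable_fun setT (fun p : T * T => ux p.1 p.2).
Proof.
have mz := fiber_inf_jointly_measurable.
have mg := jac_measurable hD hS; have mv := vel_measurable hD hS.
have mgz := measurableT_comp mg mz; have mvz := measurableT_comp mv mz.
have mez := measurableT_comp me mz.
have mt : @measurable_fun _ _ (T * T)%type R setT snd by exact: measurable_snd.
apply: measurable_funM.
  apply: measurable_funD; first exact: mvz.
  by apply: measurable_funM => //; exact: measurable_funM.
apply: (measurableT_comp (@measurable_inv R)).
apply: measurable_funD.
  by apply: measurable_funD; [exact: mgz|exact: measurable_funM].
apply: measurable_funM; last exact: mez.
by apply: measurable_funM => //; exact: measurable_funX.
Qed.

Lemma velocity_slope_ess_sup :
  (ess_sup leb (fun t : T =>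
     'N[leb]_2%:E [(fun x : T => (ux x t)%:E)]) < +oo)%E.
Proof.
(* From [r ^ 2 <= M] one gets [r <= M + 1] without extracting a root. *)
apply: (@le_lt_trans _ _ (M + 1)%:E); last exact: ltry.
apply/ess_supP; apply: aeW => t.
have := velocity_slope_total t; rewrite -Lnorm2_sqr.
have := Lnorm_ge0 leb 2%:E (fun x : T => (ux x t)%:E).
case: (Lnorm _ _ _) => [r||]; rewrite ?lee_fin//.
by move=> r0 h; nra.
Qed.

Lemma velocity_holder x x' t : `|u x' t - u x t| <= Num.sqrt ((M + 1) * `|x' - x|).
Proof.
wlog xx' : x x' / x <= x'.
  move=> h; have [|/ltW] := leP x x'; first exact: h.
  by rewrite distrC [`|x' - x|]distrC; exact: h.
have M1 : 0 < M + 1 by rewrite ltr_wpDl.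
move: xx'; rewrite le_eqVlt => /orP[/eqP ->|xx'].
  by rewrite !subrr normr0 mulr0 sqrtr0.
have d0 : 0 < x' - x by rewrite subr_gt0.
(* This weight balances the two terms of [increment_young]; [M + 1] replaces [M] so that it makes
   sense when the energy is zero. *)
pose l := Num.sqrt ((x' - x) / (M + 1)).
have l0 : 0 < l by rewrite sqrtr_gt0 divr_gt0.
have l2 : l ^+ 2 = (x' - x) / (M + 1) by rewrite sqr_sqrtr// divr_ge0// ltW.
have r0 : Num.sqrt ((M + 1) * `|x' - x|) = l * (M + 1).
  rewrite gtr0_norm//; apply/eqP; rewrite -(@eqrXn2 _ 2)// ?mulr_ge0 ?sqrtr_ge0 ?ltW//.
  by rewrite sqr_sqrtr ?mulr_ge0 ?ltW// exprMn l2; apply/eqP; field; rewrite lt0r_neq0.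
apply: le_trans (increment_young (mux t) (ux2fin t) (@velocity_increment t) (ltW xx') l0) _.
rewrite r0.
have E : (x' - x) / l = l * (M + 1).
  apply: (@mulIf _ l); first exact: lt0r_neq0.
  rewrite divfK ?lt0r_neq0// mulrAC -expr2 l2; by field; rewrite lt0r_neq0.
rewrite E ler_pdivrMr// [leRHS]mulr_natr mulr2n lerD2r ler_pM2l//.
apply: (@le_trans _ _ M); last by rewrite lerDl.
have sub : (\int[leb]_(z in `[x, x']) (ux z t ^+ 2)%:E <= \int[leb]_z (ux z t ^+ 2)%:E)%E.
  by apply: le_nnintegral_subset => // z; rewrite lee_fin sqr_ge0.
rewrite /Rintegral -lee_fin fineK; first exact: le_trans sub (velocity_slope_total t).
rewrite ge0_fin_numE; first exact: le_lt_trans sub (ux2fin t).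
by apply: integral_ge0 => z _; rewrite lee_fin sqr_ge0.
Qed.

Lemma flow_surj t x : exists a, Y t a = x.
Proof.
by have [C hC] := flow_gap_at hD t; exact: (mono_surj (mh t) (h0 t) (hH t) (inc t) hC x).
Qed.

Lemma velocity_bounded : exists B : R, 0 <= B /\ forall x t, `|u x t| <= B + `|t| / 2 * M.
Proof.
have [B [B0 [hB _]]] := flow_gap hD; exists B; split=> // x t.
have [a <-] := flow_surj t x; rewrite uY.
apply: le_trans (ler_normD _ _) _; apply: lerD => //.
have /andP[F0 F1] := xbar_gap mubar a.
by rewrite !normrM (ger0_norm F0) (gtr0_norm (_ : 0 < 2^-1)) ?invr_gt0// ler_wpM2l// divr_ge0.
Qed.

Lemma velocity_Cb t : Cb (u ^~ t).
Proof.
split; first exact: velocity_continuous.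
have [B [_ hB]] := velocity_bounded; exists (B + `|t| / 2 * M); split; first exact: num_real.
by move=> r /ltW rB x _; apply: le_trans (hB x t) rB.
Qed.

(** The two points are joined through the characteristic that passes through [x] at time [t]: at
    time [s] the spatial Hölder bound compares [x'] with its position, which has moved at bounded
    speed, and along the characteristic the velocity is Lipschitz in time. *)
Lemma velocity_modulus : exists B : R, 0 <= B /\ forall x x' t s L,
  `|t| <= L -> `|s| <= L ->
  `|u x' s - u x t| <=
    Num.sqrt ((M + 1) * (`|x' - x| + (B + L / 2 * M) * `|s - t|)) + M / 2 * `|s - t|.
Proof.
have [B [B0 [hB _]]] := flow_gap hD; exists B; split=> // x x' t s L tL sL.
have L0 : 0 <= L by exact: le_trans tL.
have [a <-] := flow_surj t x.
have /andP[F0 F1] := xbar_gap mubar a.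
rewrite -(subrKA (u (Y s a) s)); apply: le_trans (ler_normD _ _) _; apply: lerD.
  apply: le_trans (velocity_holder _ _ _) _; apply: ler_wsqrtr.
  apply: ler_wpM2l; first by rewrite addr_ge0.
  rewrite -(subrKA (Y t a)); apply: le_trans (ler_normD _ _) _; apply: lerD => //.
  rewrite (_ : Y t a - Y s a =
    - ((ubar (X a) + (s + t) / 4 * (a - X a)) * (s - t))); last first.
    by rewrite /y; field.
  rewrite normrN normrM ler_wpM2r//.
  apply: le_trans (ler_normD _ _) _; apply: lerD => //.
  rewrite !normrM (ger0_norm F0) (gtr0_norm (_ : 0 < 4^-1)) ?invr_gt0//.
  apply: ler_pM => //.
  have := ler_normD s t; lra.
rewrite !uY (_ : _ - _ = (s - t) / 2 * (a - X a)); last by rewrite /flow_velocity; field.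
rewrite !normrM (ger0_norm F0) (gtr0_norm (_ : 0 < 2^-1)) ?invr_gt0//.
have := normr_ge0 (s - t); nra.
Qed.

Lemma velocity_holder_loc : holder_half_loc u.
Proof.
move=> K /compact_bounded[L0 [_ hL]]; pose L := `|L0| + 1.
have KL p : K p -> `|p.1| <= L /\ `|p.2| <= L.
  move=> Kp; have : `|p| <= L by apply: (hL L) => //; rewrite ltr_pwDr// ler_norm.
  by rewrite prod_normE ge_max => /andP.
have Lp : 0 <= L by rewrite addr_ge0.
have [B [B0 hB]] := velocity_modulus.
pose C1 := (M + 1) * (1 + (B + L / 2 * M)).
have C10 : 0 <= C1.
  by rewrite mulr_ge0 ?addr_ge0// mulr_ge0// divr_ge0.
(* The first constant comes from the square root in [velocity_modulus]; the second converts its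
   linear term, since the distance [d] is at most [2 * L] and hence at most
   [sqrt (2 * L) * sqrt d]. *)
exists (Num.sqrt C1 + M / 2 * Num.sqrt (2 * L)) => -[x t] [x' s] Kp Kq.
have [x1 t1] := KL _ Kp; have [x2 s2] := KL _ Kq; rewrite /= in x1 t1 x2 s2 *.
set d := `|_ - _ : R * R|.
have dx : `|x - x'| <= d by rewrite /d prod_normE le_max lexx.
have dt : `|t - s| <= d by rewrite /d prod_normE le_max lexx orbT.
have d0 : 0 <= d by exact: normr_ge0.
have dL : d <= 2 * L.
  rewrite /d prod_normE ge_max; apply/andP; split.
    by apply: le_trans (ler_normB _ _) _; rewrite mulr_natl mulr2n lerD.
  by apply: le_trans (ler_normB _ _) _; rewrite mulr_natl mulr2n lerD.
apply: le_trans (hB _ _ _ _ _ s2 t1) _; rewrite [leRHS]mulrDl; apply: lerD.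
  rewrite -sqrtrM//; apply: ler_wsqrtr; rewrite /C1 -[leRHS]mulrA; apply: ler_wpM2l; first by rewrite addr_ge0.
  rewrite [leRHS]mulrDl mul1r; apply: lerD => //; apply: ler_wpM2l => //.
  by rewrite addr_ge0// mulr_ge0// divr_ge0.
rewrite -[leRHS]mulrA; apply: ler_wpM2l; first by rewrite divr_ge0.
apply: le_trans dt _; rewrite -{1}(sqr_sqrtr d0) expr2 ler_wpM2r ?sqrtr_ge0//.
exact: ler_wsqrtr.
Qed.

Lemma velocity_time_uniform t : {uniform, (fun s => u ^~ s) @ t --> u ^~ t}.
Proof.
move=> P /uniform_nbhs[E [/= entE EP]].
move: entE; rewrite -entourage_ballE => -[eps /= eps0 epsE].
have [B [B0 hB]] := velocity_modulus.
pose L := `|t| + 1; have L0 : 0 <= L by rewrite addr_ge0.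
(* The bound of [velocity_modulus] at [x' = x]; it does not involve [x], whence uniformity. *)
pose m d := Num.sqrt ((M + 1) * (0 + (B + L / 2 * M) * d)) + M / 2 * d.
have m0 : m 0 = 0 by rewrite /m !(mulr0, addr0) sqrtr0.
have cm : m d @[d --> (0 : R)] --> m 0.
  apply: cvgD; last by apply: cvgM; [exact: cvg_cst|exact: cvg_id].
  apply: (@cvg_comp _ _ _ (fun d => (M + 1) * (0 + (B + L / 2 * M) * d)) Num.sqrt);
    last exact: sqrt_continuous.
  apply: cvgM; first exact: cvg_cst.
  apply: cvgD; first exact: cvg_cst.
  by apply: cvgM; [exact: cvg_cst|exact: cvg_id].
have cst_ : `|s - t| @[s --> t] --> (0 : R).
  rewrite -(normr0 R) -(subrr t); apply: cvg_norm; apply: cvgB; [exact: cvg_id|exact: cvg_cst].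
have /cvgrPdist_lt/(_ eps eps0) c1 : m `|s - t| @[s --> t] --> m 0 by exact: cvg_comp cst_ cm.
have /cvgrPdist_lt/(_ _ ltr01) c2 := cst_.
near=> s; apply: EP => x _; apply: epsE; rewrite /= /ball /=.
have sL : `|s| <= L.
  have : `|0 - `|s - t| | < 1 by near: s.
  rewrite sub0r normrN normr_id => h.
  by rewrite -(subrK t s) /L addrC; apply: le_trans (ler_normD _ _) _; rewrite lerD2l ltW.
rewrite distrC; apply: le_lt_trans (hB x x t s L _ sL) _; first by rewrite lerDl.
have : `|m 0 - m `|s - t| | < eps by near: s.
by rewrite m0 sub0r normrN subrr normr0; apply: le_lt_trans; exact: ler_norm.
Unshelve. all: by end_near. Qed.

End SpaceTimeVelocity.

(** * The weak time derivative *)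

Lemma is_derive_quadratic (R : realType) (p q r t : R) :
  is_derive t (1 : R) (fun s : R => p + q * s + s ^+ 2 / 4 * r) (q + t / 2 * r).
Proof.
have e : {near 0^', (fun h : R => (q + t / 2 * r) + h * (r / 4)) =1
   (fun h => h^-1 *: (((fun s : R => p + q * s + s ^+ 2 / 4 * r) \o shift t) (h *: 1) -
      (p + q * t + t ^+ 2 / 4 * r)))}.
  near=> h; have h0 : h != 0 by near: h; exact: nbhs_dnbhs_neq.
  rewrite /= ![h *: 1]mulr1 -![h^-1 *: _]/(h^-1 * _); by field.
have lim : q + t / 2 * r + h * (r / 4) @[h --> 0^'] --> q + t / 2 * r + 0 * (r / 4).
  apply: cvgD; first exact: cvg_cst.
  by apply: cvgM; [exact: (nbhs_dnbhs (x := 0))|exact: cvg_cst].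
by rewrite mul0r addr0 in lim; apply: is_derive_cvg; exact: cvg_trans (near_eq_cvg e) lim.
Unshelve. all: by end_near. Qed.

Lemma is_derive_mul (R : realType) (k l : R -> R) (dk dl t : R) :
  is_derive t (1 : R) k dk -> is_derive t (1 : R) l dl ->
  is_derive t (1 : R) (fun s => k s * l s) (dk * l t + k t * dl).
Proof.
move=> hk hl; have -> : dk * l t + k t * dl = k t *: dl + l t *: dk.
  by rewrite addrC [dk * _]mulrC.
exact: is_deriveM.
Qed.

Lemma is_derive_continuous (R : realType) (k : R -> R) (dk : R -> R) :
  (forall t : R, is_derive t (1 : R) k (dk t)) -> continuous k.
Proof.
by move=> hk t; apply/differentiable_continuous/derivable1_diffP; have [] := hk t.
Qed.

Section LocallyBounded.
Context {R : realType}.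
Local Notation leb := (@lebesgue_measure R).
Local Notation leb2 := (leb \x leb)%E.
Local Notation T := (measurableTypeR R).
Implicit Types k l : R * R -> R.

Definition locally_bounded k := forall L, exists C, forall p, `|p| <= L -> `|k p| <= C.

Lemma locally_boundedD k l : locally_bounded k -> locally_bounded l ->
  locally_bounded (fun p => k p + l p).
Proof.
move=> hk hl L; have [C1 h1] := hk L; have [C2 h2] := hl L; exists (C1 + C2) => p pL.
by apply: le_trans (ler_normD _ _) _; apply: lerD; [exact: h1|exact: h2].
Qed.

Lemma locally_boundedM k l : locally_bounded k -> locally_bounded l ->
  locally_bounded (fun p => k p * l p).
Proof.
move=> hk hl L; have [C1 h1] := hk L; have [C2 h2] := hl L; exists (C1 * C2) => p pL.
by rewrite normrM ler_pM//; [exact: h1|exact: h2].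
Qed.

Lemma L2loc2D k l : L2loc2 k -> L2loc2 l -> L2loc2 (fun p => k p + l p).
Proof.
move=> [mk k2] [ml l2]; have mkl : measurable_fun setT (fun p : T * T => k p + l p).
  exact: measurable_funD.
apply: L2loc2_square => // L.
have mS := square_measurable L.
have msq (q : R * R -> R) : measurable_fun setT (q : T * T -> R) ->
    measurable_fun (square L) (fun p : T * T => (2 * q p ^+ 2)%:E).
  move=> mq; apply: measurable_funTS; apply/measurable_EFinP.
  by apply: measurable_funM => //; exact: measurable_funX.
apply: (@le_lt_trans _ _ (\int[leb2]_(p in square L) ((2 * k p ^+ 2)%:E + (2 * l p ^+ 2)%:E))%E).
  apply: le_nnintegral => p _; rewrite -?EFinD lee_fin ?sqr_ge0//.
  by have := sqr_ge0 (k p - l p); nra.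
rewrite ge0_integralD//; last 4 first.
- by move=> p _; rewrite lee_fin mulr_ge0// sqr_ge0.
- exact: msq.
- by move=> p _; rewrite lee_fin mulr_ge0// sqr_ge0.
- exact: msq.
have fin (q : R * R -> R) : measurable_fun setT (q : T * T -> R) ->
    (\int[leb2]_(p in square L) (q p ^+ 2)%:E < +oo)%E ->
    (\int[leb2]_(p in square L) (2 * q p ^+ 2)%:E < +oo)%E.
  move=> mq q2; under eq_integral do rewrite EFinM.
  rewrite ge0_integralZl_EFin//.
  - by rewrite lte_mul_pinfty.
  - by move=> p _; rewrite lee_fin sqr_ge0.
  - by apply: measurable_funTS; apply/measurable_EFinP; exact: measurable_funX.
by rewrite lte_add_pinfty// fin//; [exact: k2 (@square_compact _ L)|exact: l2 (@square_compact _ L)].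
Qed.

Lemma L2loc2_mul_bounded k l : measurable_fun setT (l : T * T -> R) ->
  locally_bounded l -> L2loc2 k -> L2loc2 (fun p => l p * k p).
Proof.
move=> ml bl [mk k2]; have mlk : measurable_fun setT (fun p : T * T => l p * k p).
  exact: measurable_funM.
apply: L2loc2_square => // L; have [C hC] := bl L.
have mS := square_measurable L.
apply: (@le_lt_trans _ _ (\int[leb2]_(p in square L) ((C ^+ 2)%:E * (k p ^+ 2)%:E))%E).
  apply: le_nnintegral => p Lp; rewrite -?EFinM lee_fin ?sqr_ge0//.
  rewrite exprMn ler_wpM2r ?sqr_ge0// -[_ ^+ 2]real_normK ?num_real//.
  have lC := hC p ((squareP _ _).1 Lp).
  by rewrite ler_pXn2r ?nnegrE// (le_trans _ lC).
rewrite ge0_integralZl_EFin//.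
- by rewrite lte_mul_pinfty ?lee_fin ?sqr_ge0//; exact: k2 (@square_compact _ L).
- by move=> p _; rewrite lee_fin sqr_ge0.
- by apply: measurable_funTS; apply/measurable_EFinP; exact: measurable_funX.
- by rewrite sqr_ge0.
Qed.

End LocallyBounded.

Lemma locally_integrable_mul_supported (R : realType) (k psi : R -> R) (L : R) :
  locally_integrable setT k -> continuous psi -> (forall x, L <= `|x| -> psi x = 0) ->
  lebesgue_measure.-integrable setT (EFin \o (fun x : measurableTypeR R => k x * psi x)).
Proof.
move=> lk cpsi psiL.
have := integrable_patch_itv (- L) L (locally_integrable_mul_continuous lk cpsi).
rewrite (_ : _ \_ _ = (fun x => k x * psi x))//; apply/funext => x.
rewrite patchE; case: ifPn => // /negP h; rewrite psiL ?mulr0//.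
rewrite leNgt; apply/negP => xL; apply: h; apply/mem_set.
by rewrite /= in_itv/= -ler_norml ltW.
Qed.

Section WeakTimeDerivative.
Context {R : realType}.
Local Notation leb := (@lebesgue_measure R).
Local Notation leb2 := (leb \x leb)%E.
Local Notation T := (measurableTypeR R).
Variables (ubar ubarx : R -> R) (mubar : {finmeas R}).
Hypothesis hD : calD ubar ubarx mubar.
Variable S : set T.
Hypothesis hS : carries_singular ubarx mubar S.

Local Notation X := (xbar mubar).
Local Notation M := (fine (mubar setT)).
Local Notation g := (jac ubarx mubar S).
Local Notation v := (vel ubarx mubar S).
Local Notation e := (energy_density ubarx mubar S).
Local Notation hh := (flow_jac ubarx mubar S).
Local Notation ww := (flow_slope ubarx mubar S).
Local Notation W := (flow_velocity ubar mubar).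
Local Notation Y t := (y ubar mubar ^~ t).

Let mh t := flow_jac_measurable hD hS t.
Let h0 t := flow_jac_ge0 ubarx mubar S t.
Let hH t := flow_jac_bound ubarx mubar S t.
Let inc t := fun a b (ab : a <= b) => flow_increment hD hS t ab.
Let wE t := flow_slope_sqr ubarx mubar S t.
Let me := energy_density_measurable hD hS.
Let M0 : 0 <= M. Proof. exact: fine_ge0. Qed.

Variable u : R -> R -> R.
Hypothesis hu : is_velocity ubar mubar u.
Let uY t a : u (Y t a) t = W t a. Proof. exact: hu. Qed.
Local Notation ux := (velocity_slope ubar ubarx mubar S).

Lemma flow_time_derive a t : is_derive t (1 : R) (y ubar mubar a) (W t a).
Proof. exact: is_derive_quadratic. Qed.

Lemma flow_velocity_derive a t : is_derive t (1 : R) (W ^~ a) ((a - X a) / 2).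
Proof.
have := is_derive_quadratic (ubar (X a)) ((a - X a) / 2) 0 t.
rewrite mulr0 addr0; congr (is_derive _ _ _ _).
by apply/funext => s; rewrite /flow_velocity mulr0 addr0; ring.
Qed.

Lemma flow_jac_derive a t : is_derive t (1 : R) (hh ^~ a) (ww t a).
Proof.
have := is_derive_quadratic (g a) (v a) (e a) t.
congr (is_derive _ _ _ _).
by apply/funext => s; rewrite /flow_jac mulrC [s * v a]mulrC [_ * e a]mulrC.
Qed.

(** The quantity [a - xbar a], which is the energy to the left of [a], in Eulerian variables. Half
    of it is the acceleration of the characteristics. *)
Definition lagrangian_excess (p : R * R) : R :=
  fiber_inf (Y p.2) p.1 - X (fiber_inf (Y p.2) p.1).
Local Notation F := lagrangian_excess.

(** The Hunter-Saxton equation [u_t + u u_x = F / 2] solved for [u_t]. *)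
Definition velocity_time_slope (p : R * R) : R := F p / 2 + - u p.1 p.2 * ux p.1 p.2.
Local Notation ut := velocity_time_slope.

Let fz := fiber_inf_jointly_measurable hD hS.

Let mF : measurable_fun setT (F : T * T -> R).
Proof. by apply: measurable_funB => //; exact: (measurableT_comp (xbar_measurable mubar)). Qed.

Let F0M p : 0 <= F p <= M. Proof. exact: xbar_gap. Qed.

Let mu2 : measurable_fun setT (fun p : T * T => u p.1 p.2).
Proof.
have mub : @measurable_fun _ _ T R setT ubar.
  by have [[cu _] _ _ _] := hD; exact: (continuous_measurable_fun cu).
rewrite (_ : (fun p => u p.1 p.2) = (fun p => ubar (X (fiber_inf (Y p.2) p.1)) + p.2 / 2 * F p)).
  apply: measurable_funD.
    exact: (measurableT_comp mub (measurableT_comp (xbar_measurable mubar) fz)).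
  apply: measurable_funM => //; apply: measurable_funM => //.
apply/funext => -[x t] /=; have [C hC] := flow_gap_at hD t.
by rewrite -{1}(fiber_infK (mh t) (h0 t) (hH t) (inc t) hC x) uY.
Qed.

Let bu : locally_bounded (fun p => u p.1 p.2).
Proof.
have [B [B0 hB]] := velocity_bounded hD hS hu => L; exists (B + L / 2 * M) => p.
rewrite prod_normE ge_max => /andP[_ p2]; apply: le_trans (hB _ _) _.
by rewrite lerD2l ler_wpM2r// ler_pM2r// invr_gt0.
Qed.

(** By Tonelli, each time slice contributes at most [M], over a bounded range of times. *)
Lemma velocity_slope_L2loc2 : L2loc2 (fun p => ux p.1 p.2).
Proof.
have mux := velocity_slope_jointly_measurable hD hS.
apply: L2loc2_square => // L.
pose k (p : T * T) := (ux p.1 p.2 ^+ 2 * \1_`[- L, L]%classic p.2)%:E.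
have mk : measurable_fun setT k.
  apply/measurable_EFinP; apply: measurable_funM; first exact: measurable_funX.
  have mi : @measurable_fun _ _ T R setT \1_`[- L, L]%classic by exact: measurable_indic.
  exact: (measurableT_comp mi (@measurable_snd _ _ T T)).
have k0 p : (0 <= k p)%E by rewrite lee_fin mulr_ge0// ?sqr_ge0// indicE.
apply: (@le_lt_trans _ _ (\int[leb2]_p k p)%E).
  rewrite integral_mkcond; apply: le_nnintegral => p _.
    by rewrite patchE; case: ifP; rewrite ?lee_fin ?sqr_ge0.
  rewrite patchE; case: ifPn => // /set_mem [_ p2].
  by rewrite /k indicE mem_set// mulr1.
rewrite fubini_tonelli2//.
apply: (@le_lt_trans _ _ (\int[leb]_t (M * \1_`[- L, L]%classic t)%:E)%E).
  apply: le_nnintegral => t _; first by apply: integral_ge0.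
  rewrite /fubini_G /k /=; under eq_integral do rewrite EFinM.
  have mt2 : measurable_fun setT (fun x : T => (ux x t ^+ 2)%:E).
    by apply/measurable_EFinP; apply: measurable_funX; have [] := (L2P _).1 (velocity_slope_L2 hD hS t).
  have pt2 (x : T) : setT x -> (0 <= (ux x t ^+ 2)%:E)%E by rewrite lee_fin sqr_ge0.
  rewrite ge0_integralZr//.
  rewrite EFinM; apply: lee_wpmul2r; first by rewrite lee_fin indicE.
  exact: (velocity_slope_total hD hS t).
under eq_integral do rewrite EFinM.
rewrite ge0_integralZl_EFin//; last first.
  by apply/measurable_EFinP; exact: measurable_indic.
rewrite integral_indic// setIT; apply: lte_mul_pinfty => //.
have h : (leb `[(- L)%R, L]%classic < +oo)%E.
  by rewrite lebesgue_measure_itv/=; case: ifP; rewrite ?ltry.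
exact: h.
Qed.

Lemma velocity_time_slope_L2loc2 : L2loc2 ut.
Proof.
apply: (@L2loc2D R (fun p => F p / 2) (fun p => - u p.1 p.2 * ux p.1 p.2)).
  apply: L2loc2_bounded; first exact: measurable_funM.
  move=> L; exists M => p _; have /andP[f0 f1] := F0M p.
  rewrite ger0_norm ?divr_ge0// ler_pdivrMr//; apply: le_trans f1 _.
  by rewrite mulr_natr mulr2n lerDl.
apply: (@L2loc2_mul_bounded R (fun p => ux p.1 p.2) (fun p => - u p.1 p.2)).
- exact: measurable_funN.
- by move=> L; have [C hC] := bu L; exists C => p /hC; rewrite normrN.
- exact: velocity_slope_L2loc2.
Qed.

Section Testing.
Variable phi : R * R -> R.
Hypothesis Cphi : C1c2 phi.
Local Notation Dx := (fun p => 'D_(1, 0) phi p).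
Local Notation Dt := (fun p => 'D_(0, 1) phi p).

(* The time derivative of [u phi h] along the characteristic issued from [a]. *)
Definition lagrangian_rate (p : R * R) : R :=
  W p.2 p.1 * hh p.2 p.1 * Dt (Y p.2 p.1, p.2) +
  ((p.1 - X p.1) / 2 * hh p.2 p.1 + W p.2 p.1 * ww p.2 p.1) * phi (Y p.2 p.1, p.2) +
  W p.2 p.1 * W p.2 p.1 * hh p.2 p.1 * Dx (Y p.2 p.1, p.2).
Local Notation K := lagrangian_rate.

Lemma lagrangian_rate_time a : \int[leb]_t K (a, t) = 0.
Proof.
pose G t := W t a * (phi (Y t a, t) * hh t a).
have dG t : is_derive t (1 : R) G (K (a, t)).
  have := is_derive_mul (flow_velocity_derive a t)
    (is_derive_mul (C1c2_chain Cphi (flow_time_derive a t)) (flow_jac_derive a t)).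
  congr (is_derive _ _ _ _); rewrite /K/=; ring.
have GE : derive1 G = (fun t => K (a, t)).
  by apply/funext => t; rewrite derive1E; have [] := dG t.
have cY := flow_time_continuous (ubar := ubar) (mubar := mubar) (a := a).
have cp (k : R * R -> R) : continuous k -> continuous (fun t => k (Y t a, t)).
  move=> ck t; have h : (Y s a, s) @[s --> t] --> (Y t a, t).
    exact: (cvg_pair (cY t) cvg_id).
  exact: cvg_comp h (ck _).
have [_ cx ct _] := Cphi.
have cW := is_derive_continuous (flow_velocity_derive a).
have ch := is_derive_continuous (flow_jac_derive a).
have cf := is_derive_continuous (fun t => C1c2_chain Cphi (flow_time_derive a t)).
have cw : continuous (ww ^~ a).
  move=> t; apply: cvgD; first exact: cvg_cst.
  by apply: cvgM; [apply: cvgM; [exact: cvg_id|exact: cvg_cst]|exact: cvg_cst].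
have cK : continuous (fun t => K (a, t)).
  move=> t; apply: cvgD; first apply: cvgD.
  - apply: cvgM; first by apply: cvgM; [exact: cW|exact: ch].
    exact: (cp _ ct).
  - apply: cvgM; last exact: cf.
    apply: cvgD; first exact: (cvgM (cvg_cst ((a - X a) / 2)) (ch t)).
    by apply: cvgM; [exact: cW|exact: cw].
  - apply: cvgM; last exact: (cp _ cx).
    by apply: cvgM; [apply: cvgM; exact: cW|exact: ch].
have CG : C1c G.
  split; first by move=> t; have [] := dG t.
    by rewrite GE.
  have [L _ hL] := C1c2_support Cphi.
  apply: (@compactly_supported_segment _ _ (- L) L) => t /negP.
  rewrite /= in_itv/= -ler_norml -ltNge => tL.
  have [p0 _ _] : [/\ phi (Y t a, t) = 0, Dx (Y t a, t) = 0 & Dt (Y t a, t) = 0].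
    by apply: hL; rewrite prod_normE le_max (ltW tL) orbT.
  by rewrite /G p0 mul0r mulr0.
(* That the derivative of the compactly supported [G] has integral zero is the weak derivative of
   the constant 1 tested against [G]. *)
have [_ /(_ _ CG)] : weak_derivative (cst 1 : R -> R) (cst 0).
  apply: increment_weak_derivative => [t||a' b ab]; first exact: cvg_cst.
    by apply: (@locally_integrable_bounded _ _ 0) => // x; rewrite normr0.
  by rewrite subrr Rintegral_cst_itv// mul0r.
rewrite GE (@eq_Rintegral _ _ _ leb _ (fun t => K (a, t))); last by move=> t _; rewrite mul1r.
move=> ->; rewrite (@eq_Rintegral _ _ _ leb _ (cst 0)); last by move=> t _; rewrite mul0r.
by rewrite /Rintegral (eq_integral (cst 0%E))// integral0 oppr0.
Qed.

Lemma lagrangian_rate_integrable : leb2.-integrable setT (EFin \o K).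
Proof.
have [L L0 hL] := C1c2_support Cphi; have [C hC] := C1c2_bounded Cphi.
have [_ cx ct _] := Cphi.
have [B [B0 [hB gap]]] := flow_gap hD.
(* While [|t| <= L], a characteristic stays within the bracket of its label by [flow_gap]; so points
   outside the square of radius [L'] are sent outside the support of [phi]. *)
pose L' := L + (M + B * L + L ^+ 2 / 4 * M).
have far p : L' <= `|p| -> L <= `|(Y p.2 p.1, p.2)|.
  rewrite !prod_normE le_max /= => /orP[p1|p2]; rewrite le_max; last first.
    rewrite orbC; apply/orP; left; apply: le_trans p2.
    by rewrite /L' lerDl !addr_ge0// !mulr_ge0// ?ltW// divr_ge0// sqr_ge0.
  have [Lp2|p2L] := leP L `|p.2|; first by rewrite orbT.
  rewrite orbF; have := gap p.2 p.1.
  have : `|p.1| <= `|Y p.2 p.1| + `|Y p.2 p.1 - p.1|.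
    by rewrite -{1}(subKr (Y p.2 p.1) p.1); exact: ler_normB.
  have q1 : B * `|p.2| <= B * L by rewrite ler_wpM2l// ltW.
  have q2 : p.2 ^+ 2 / 4 * M <= L ^+ 2 / 4 * M.
    rewrite ler_wpM2r// ler_pM2r ?invr_gt0// -real_normK ?num_real//.
    by rewrite ler_pXn2r ?nnegrE ?(ltW L0)// ltW.
  by rewrite /L' in p1; lra.
have mY2 := flow_time_measurable hD hS.
have mYp : @measurable_fun _ _ (T * T)%type (T * T)%type setT
    (fun p : T * T => (Y p.2 p.1 : T, p.2 : T)).
  exact: (measurable_fun_pair mY2 (@measurable_snd _ _ T T)).
have fin (k q : R * R -> R) : measurable_fun setT (k : T * T -> R) -> locally_bounded k ->
    measurable_fun setT (q : T * T -> R) -> (forall p, `|q p| <= C) ->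
    (forall p, L <= `|p| -> q p = 0) ->
    leb2.-integrable setT (EFin \o (fun p => k p * q (Y p.2 p.1, p.2))).
  move=> mk bk mq qC qL.
  apply: (L2loc2_mul_integrable (L := L') (C := C) (L2loc2_bounded mk bk)) => //.
  - exact: (measurableT_comp mq mYp).
  - by move=> p /far /qL.
have mub : @measurable_fun _ _ T R setT ubar.
  by have [[cu _] _ _ _] := hD; exact: (continuous_measurable_fun cu).
have mt : @measurable_fun _ _ (T * T)%type R setT snd by exact: measurable_snd.
have ma : @measurable_fun _ _ (T * T)%type T setT fst by exact: measurable_fst.
have mX1 : @measurable_fun _ _ (T * T)%type T setT (X \o fst).
  exact: (measurableT_comp (xbar_measurable mubar) ma).
have mE : @measurable_fun _ _ (T * T)%type R setT (fun p => p.1 - X p.1) by exact: measurable_funB.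
have mE2 : @measurable_fun _ _ (T * T)%type R setT (fun p => (p.1 - X p.1) / 2).
  exact: measurable_funM.
have mW : @measurable_fun _ _ (T * T)%type R setT (fun p => W p.2 p.1).
  apply: measurable_funD; first exact: (measurableT_comp mub mX1).
  by apply: measurable_funM => //; exact: measurable_funM.
have mg1 := measurableT_comp (jac_measurable hD hS) ma.
have mv1 := measurableT_comp (vel_measurable hD hS) ma.
have me1 := measurableT_comp me ma.
have mh2 : @measurable_fun _ _ (T * T)%type R setT (fun p => hh p.2 p.1).
  apply: measurable_funD.
    by apply: measurable_funD; [exact: mg1|exact: measurable_funM].
  apply: measurable_funM; last exact: me1.
  by apply: measurable_funM => //; exact: measurable_funX.
have mw2 : @measurable_fun _ _ (T * T)%type R setT (fun p => ww p.2 p.1).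
  apply: measurable_funD; first exact: mv1.
  by apply: measurable_funM => //; exact: measurable_funM.
have bE : locally_bounded (fun p => (p.1 - X p.1) / 2).
  move=> L1; exists M => p _; have /andP[f0 f1] := xbar_gap mubar p.1.
  rewrite ger0_norm ?divr_ge0// ler_pdivrMr//; apply: le_trans f1 _.
  by rewrite mulr_natr mulr2n lerDl.
have bW : locally_bounded (fun p => W p.2 p.1).
  move=> L1; exists (B + L1 / 2 * M) => p; rewrite prod_normE ge_max => /andP[_ p2].
  have /andP[f0 f1] := xbar_gap mubar p.1.
  apply: le_trans (ler_normD _ _) _; apply: lerD => //.
  rewrite !normrM (ger0_norm f0) (gtr0_norm (_ : 0 < 2^-1)) ?invr_gt0//.
  by apply: ler_pM => //; rewrite ?ler_pM2r ?invr_gt0// divr_ge0.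
have bh : locally_bounded (fun p => hh p.2 p.1).
  move=> L1; exists (1 + L1 + L1 ^+ 2 / 4) => p; rewrite prod_normE ge_max => /andP[_ p2].
  rewrite ger0_norm ?h0//; apply: le_trans (hH _ _) _; apply: lerD; first by rewrite lerD2l.
  rewrite ler_pM2r ?invr_gt0// -real_normK ?num_real//.
  by rewrite ler_pXn2r ?nnegrE// (le_trans _ p2).
have bw : locally_bounded (fun p => ww p.2 p.1).
  move=> L1; exists (1 + L1) => p; rewrite prod_normE ge_max => /andP[_ p2].
  by apply: le_trans (flow_slope_bound _ _ _ _ _) _; rewrite lerD2l.
have i1 := fin (fun p => W p.2 p.1 * hh p.2 p.1) Dt (measurable_funM mW mh2)
  (locally_boundedM bW bh) (continuous_plane_measurable ct) (fun p => let: And3 _ _ h := hC p in h)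
  (fun p pL => let: And3 _ _ h := hL p pL in h).
have i2 := fin (fun p => (p.1 - X p.1) / 2 * hh p.2 p.1 + W p.2 p.1 * ww p.2 p.1) phi
  (measurable_funD (measurable_funM mE2 mh2)
    (measurable_funM mW mw2))
  (locally_boundedD (locally_boundedM bE bh) (locally_boundedM bW bw))
  (C1c2_measurable Cphi) (fun p => let: And3 h _ _ := hC p in h)
  (fun p pL => let: And3 h _ _ := hL p pL in h).
have i3 := fin (fun p => W p.2 p.1 * W p.2 p.1 * hh p.2 p.1) Dx
  (measurable_funM (measurable_funM mW mW) mh2)
  (locally_boundedM (locally_boundedM bW bW) bh) (continuous_plane_measurable cx)
  (fun p => let: And3 _ h _ := hC p in h)
  (fun p pL => let: And3 _ h _ := hL p pL in h).
exact: (integrableD measurableT (integrableD measurableT i1 i2) i3).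
Qed.

(* Adding the null integral of the derivative of [u^2 phi] in [x] turns the
   Eulerian integrand into the Lagrangian rate. *)
Lemma velocity_section_rate t :
  \int[leb]_x (u x t * Dt (x, t) + ut (x, t) * phi (x, t)) = \int[leb]_a K (a, t).
Proof.
have [L L0 hL] := C1c2_support Cphi.
have [Cpsi psi'] := C1c2_section Cphi t.
have [dpsi cpsi' _] := Cpsi; rewrite psi' in cpsi'.
have cpsi : continuous (fun x => phi (x, t)).
  by move=> x; apply/differentiable_continuous/derivable1_diffP.
have [_ _ ct _] := Cphi.
have cu : continuous (u ^~ t) by exact: (velocity_continuous hD hS hu).
have lux := (velocity_weak_derivative hD hS hu t).1.
have lu := locally_integrable_continuous cu.
have incu := velocity_increment hD hS hu t.
have inL (x : R) : L <= `|x| -> L <= `|(x, t) : R * R| by move=> h; rewrite prod_normE le_max h.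
have mzt : @measurable_fun _ _ T R setT (fun x => F (x, t) / 2).
  by apply: measurable_funM => //; exact: (measurableT_comp mF (@pair2_measurable _ _ T T t)).
have lF : locally_integrable setT (fun x => F (x, t) / 2).
  apply: (@locally_integrable_bounded _ _ M) => // x; have /andP[f0 f1] := F0M (x, t).
  rewrite ger0_norm ?divr_ge0// ler_pdivrMr//; apply: le_trans f1 _.
  by rewrite mulr_natr mulr2n lerDl.
have luux : locally_integrable setT (fun x => ux x t * u x t).
  exact: locally_integrable_mul_continuous lux cu.
have cuu : continuous (fun x => u x t * u x t) by move=> x; apply: cvgM; exact: cu.
have lsq : locally_integrable setT (fun x => ux x t * u x t + ux x t * u x t).
  exact: locally_integrableD.
have wsq : weak_derivative (fun x => u x t * u x t) (fun x => ux x t * u x t + ux x t * u x t).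
  by apply: increment_weak_derivative => // a b ab; exact: product_rule.
(* Added to [k1] below, it turns [- u ux phi] into [u ux phi + u ^ 2 Dx], which match the terms
   [W * ww * phi] and [W * W * hh * Dx] of the rate. *)
pose k2 x := u x t * u x t * Dx (x, t) + (ux x t * u x t + ux x t * u x t) * phi (x, t).
pose k1 x := u x t * Dt (x, t) + (F (x, t) / 2 * phi (x, t) - ux x t * u x t * phi (x, t)).
have ia := locally_integrable_mul_supported lu (continuous_fst_arg (t := t) ct)
  (fun x xL => let: And3 _ _ h := hL _ (inL x xL) in h).
have sphi x (xL : L <= `|x|) : phi (x, t) = 0 by have [] := hL _ (inL x xL).
have ib := locally_integrable_mul_supported lF cpsi sphi.
have ic := locally_integrable_mul_supported luux cpsi sphi.
have id := locally_integrable_mul_supported (locally_integrable_continuous cuu) cpsi'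
  (fun x xL => let: And3 _ h _ := hL _ (inL x xL) in h).
have ie := locally_integrable_mul_supported lsq cpsi sphi.
have i2 : leb.-integrable setT (EFin \o (k2 : T -> R)) by exact: (integrableD measurableT id ie).
have i1 : leb.-integrable setT (EFin \o (k1 : T -> R)).
  exact: (integrableD measurableT ia (integrableB measurableT ib ic)).
have k20 : \int[leb]_x k2 x = 0.
  rewrite /k2 RintegralD//; have [_ /(_ _ Cpsi)] := wsq; rewrite psi' => ->.
  by rewrite addNr.
transitivity (\int[leb]_x (k1 x + k2 x)).
  rewrite [RHS]RintegralD// k20 addr0; apply: eq_Rintegral => x _.
  by rewrite /k1 /velocity_time_slope /=; ring.
have [C hC] := flow_gap_at hD t.
have i12 : leb.-integrable setT (EFin \o (fun x : T => k1 x + k2 x)).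
  exact: (integrableD measurableT i1 i2).
have mk12 : measurable_fun setT (fun x : T => k1 x + k2 x).
  by case/integrableP : i12 => /measurable_EFinP.
have mY := mono_measurable (mh t) (h0 t) (hH t) (inc t).
have push := mono_push (mh t) (h0 t) (hH t) (inc t) hC.
have := @Rintegral_change_of_variables _ _ T T R leb leb (Y t) (hh t) mY (mh t) (h0 t) push
  setT _ measurableT mk12 i12.
rewrite preimage_setT => ->.
rewrite /Rintegral; congr fine; apply/esym; apply: ae_eq_integral_any => //.
  apply/measurable_EFinP; apply: measurable_funM => //; exact: (measurableT_comp mk12 mY).
have slope : {ae leb, forall a : T, ux (Y t a) t * hh t a = ww t a}.
  exact: (eulerian_slope_ae (mh t) (h0 t) (hH t) (inc t) hC (wE t)).
have plat : {ae leb, forall a : T, plateau_values (Y t) (Y t a) -> hh t a = 0}.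
  exact: (ae_plateau_flat (mh t) (h0 t) (hH t) (inc t) hC).
apply: (ae_mono2 _ slope plat) => a uxa pla _.
congr EFin; rewrite /k1 /k2 uY /K /=.
(* On a plateau [F] is read at the left end of the fibre instead of [a], but there the factor [hh]
   vanishes almost everywhere. *)
have Fa : F (Y t a, t) * hh t a = (a - X a) * hh t a.
  have [/pla ->|/(not_plateauP (mh t) (h0 t) (hH t) (inc t) hC) E] :=
    pselect (plateau_values (Y t) (Y t a)); first by rewrite !mulr0.
  by rewrite /F /= E.
rewrite -uxa.
transitivity (W t a * hh t a * Dt (Y t a, t) + (F (Y t a, t) * hh t a) / 2 * phi (Y t a, t) +
  W t a * (ux (Y t a) t * hh t a) * phi (Y t a, t) + W t a * W t a * hh t a * Dx (Y t a, t)).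
  by field.
by rewrite Fa; field.
Qed.

End Testing.

(** At fixed time the Eulerian slice becomes a Lagrangian one; Fubini then exchanges the order, so
    that the inner integral runs in time at fixed [a], where it is zero. *)
Lemma velocity_weak_time_derivative : weak_time_derivative u ut.
Proof.
move=> phi Cphi.
have [L L0 hL] := C1c2_support Cphi; have [C hC] := C1c2_bounded Cphi.
have [_ _ ct _] := Cphi.
have i1 := L2loc2_mul_integrable (L2loc2_bounded mu2 bu) (continuous_plane_measurable ct)
  (fun p => let: And3 _ _ h := hC p in h) (fun p pL => let: And3 _ _ h := hL p pL in h).
have i2 := L2loc2_mul_integrable velocity_time_slope_L2loc2 (C1c2_measurable Cphi)
  (fun p => let: And3 h _ _ := hC p in h) (fun p pL => let: And3 h _ _ := hL p pL in h).
apply/eqP; rewrite -addr_eq0 -RintegralD//.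
rewrite Rintegral_fubini2; last exact: (integrableD measurableT i1 i2).
rewrite (@eq_Rintegral _ _ _ leb _ (fun t => \int[leb]_a lagrangian_rate phi (a, t))); last first.
  by move=> t _; exact: velocity_section_rate.
rewrite -(Rintegral_fubini2 (lagrangian_rate_integrable Cphi)).
rewrite Rintegral_fubini1; last exact: lagrangian_rate_integrable.
rewrite (@eq_Rintegral _ _ _ leb _ (cst 0)); last by move=> a _; exact: lagrangian_rate_time.
by rewrite /Rintegral (eq_integral (cst 0%E))// integral0.
Qed.

End WeakTimeDerivative.

(** * Limits at infinity and absolutely continuous times *)

Section LimitsAtInfinity.
Context {R : realType}.
Local Notation T := (measurableTypeR R).
Variables (ubar ubarx : R -> R) (mubar : {finmeas R}).
Hypothesis hD : calD ubar ubarx mubar.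

Local Notation X := (xbar mubar).
Local Notation M := (fine (mubar setT)).
Local Notation Y t := (y ubar mubar ^~ t).
Local Notation Gm x := (fine (mubar `]-oo, x[%classic)).
Local Notation Gp x := (fine (mubar `]-oo, x]%classic)).

Lemma dist_right_vanishes (eps : R) : 0 < eps -> exists A, forall x, x <= A -> Gp x < eps.
Proof.
move=> eps0.
pose F n : set T := `]-oo, (- n%:R : R)]%classic.
have mF n : measurable (F n) by exact: measurable_itv.
have F0 : \bigcap_n F n = set0.
  apply/seteqP; split=> // x h; have := h (Num.truncn `|x|).+1 I; rewrite /F/= in_itv/=.
  apply/negP; rewrite -ltNge; have := truncnS_gt `|x|.
  by have := ler_norm (- x); rewrite normrN => h1 h2; rewrite ltrNl (le_lt_trans h1).
have ndF : nonincreasing_seq F.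
  move=> n m nm; apply/subsetPset => x; rewrite /F/= !in_itv/= => h.
  by apply: le_trans h _; rewrite lerN2 ler_nat.
have Ffin : (mubar (F 0%N) < +oo)%E by rewrite ltey_eq finmeas_fin_num.
have := nonincreasing_cvg_mu (mu := mubar) Ffin mF (bigcapT_measurable mF) ndF.
rewrite F0 measure0 => /fine_cvgP[_ /cvgrPdist_lt/(_ _ eps0)[N _ /(_ N (leqnn N))]] /=.
rewrite sub0r normrN ger0_norm ?fine_ge0// => h.
exists (- N%:R) => x xN; apply: le_lt_trans h.
apply: finmeas_le => // z; rewrite /F/= !in_itv/= => zx; exact: le_trans zx xN.
Qed.

Lemma dist_left_total (eps : R) : 0 < eps -> exists A, forall x, A <= x -> M - eps < Gm x.
Proof.
move=> eps0.
pose F n : set T := `]-oo, (n%:R : R)[%classic.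
have mF n : measurable (F n) by exact: measurable_itv.
have FT : \bigcup_n F n = setT.
  apply/seteqP; split=> // x _; exists (Num.truncn `|x|).+1 => //; rewrite /F/= in_itv/=.
  by apply: le_lt_trans (ler_norm x) _; exact: truncnS_gt.
have ndF : nondecreasing_seq F.
  move=> n m nm; apply/subsetPset => x; rewrite /F/= !in_itv/= => h.
  by apply: lt_le_trans h _; rewrite ler_nat.
have cv := nondecreasing_cvg_mu (mu := mubar) mF (bigcupT_measurable F mF) ndF.
rewrite FT in cv.
have : mubar \o F @ \oo --> M%:E by rewrite fineK ?finmeas_fin_num//; exact: cv.
move=> /fine_cvgP[_ /cvgrPdist_lt/(_ _ eps0)[N _ /(_ N (leqnn N))]] /= h.
exists N%:R => x Nx; apply: (@lt_le_trans _ _ (fine (mubar (F N)))).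
  by rewrite ltrBlDr -ltrBlDl; apply: le_lt_trans h; exact: ler_norm.
apply: finmeas_le => // z; rewrite /F/= !in_itv/= => zx; exact: lt_le_trans zx Nx.
Qed.

Variable u : R -> R -> R.
Hypothesis hu : is_velocity ubar mubar u.

(** At fixed [t] every [x] is reached by a characteristic issued within a bounded distance, so [x]
    and [X a] tend to infinity together. *)
Let drift t : exists C, forall x, exists a,
  [/\ Y t a = x, x - C <= X a, X a <= x + C & u x t = ubar (X a) + t / 2 * (a - X a)].
Proof.
have [S hS] := calD_singular_set hD.
have [C hC] := flow_gap_at hD t; exists (C + M) => x.
have [a ax] := flow_surj hD hS t x; exists a.
have /andP[f0 f1] := xbar_gap mubar a.
have := hC a; rewrite ax ler_norml => /andP[h1 h2].
by split=> //; [lra|lra|rewrite -ax; exact: hu].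
Qed.

(** The excess [a - X a] is at most the mass of the closed half-line at [X a], which tends to 0;
    only [ubar (X a)] survives. *)
Lemma velocity_limit_left (l : R) t : ubar x @[x --> -oo] --> l -> u x t @[x --> -oo] --> l.
Proof.
move=> /cvgrPdist_lt hl; apply/cvgrPdist_lt => eps eps0.
have t0 : 0 < 1 + `|t| by rewrite ltr_pwDl.
have d0 : 0 < eps / (1 + `|t|) by rewrite divr_gt0.
have [A1 [_ h1]] := hl _ d0; have [A2 h2] := dist_right_vanishes d0.
have [C hC] := drift t.
exists (Num.min A1 A2 - C); split; first exact: num_real.
move=> x; rewrite ltrBrDr lt_min => /andP[x1 x2].
have [a [_ _ Xa ->]] := hC x.
have u1 := h1 (X a) (le_lt_trans Xa x1).
have g1 := h2 (X a) (ltW (le_lt_trans Xa x2)).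
have /andP[f0 _] := xbar_gap mubar a.
have /andP[_ f1] := xbar_bounds mubar a.
rewrite opprD addrA; apply: le_lt_trans (ler_normB _ _) _.
have w1 : `|t / 2 * (a - X a)| <= `|t| * (eps / (1 + `|t|)).
  rewrite normrM (ger0_norm f0) ler_pM//; last by rewrite (le_trans f1)// ltW.
  rewrite normrM (gtr0_norm (_ : 0 < 2^-1)) ?invr_gt0// ler_pdivrMr//.
  by rewrite mulr_natr mulr2n lerDl.
have E : eps = eps / (1 + `|t|) + `|t| * (eps / (1 + `|t|)).
  by field; exact: lt0r_neq0.
by rewrite [ltRHS]E ltr_leD.
Qed.

(** Here [a - X a] lies between the mass of the open half-line at [X a] and the total mass, hence
    tends to the latter. *)
Lemma velocity_limit_right (l : R) t : ubar x @[x --> +oo] --> l ->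
  u x t @[x --> +oo] --> l + 2^-1 * M * t.
Proof.
move=> /cvgrPdist_lt hl; apply/cvgrPdist_lt => eps eps0.
have t0 : 0 < 1 + `|t| by rewrite ltr_pwDl.
have d0 : 0 < eps / (1 + `|t|) by rewrite divr_gt0.
have [A1 [_ h1]] := hl _ d0; have [A2 h2] := dist_left_total d0.
have [C hC] := drift t.
exists (Num.max A1 A2 + C); split; first exact: num_real.
move=> x; rewrite -ltrBrDr gt_max => /andP[x1 x2].
have [a [_ Xa _ ->]] := hC x.
have u1 := h1 (X a) (lt_le_trans x1 Xa).
have g1 := h2 (X a) (ltW (lt_le_trans x2 Xa)).
have /andP[_ f0] := xbar_gap mubar a.
have /andP[f1 _] := xbar_bounds mubar a.
rewrite (_ : _ - _ = (l - ubar (X a)) + t / 2 * (M - (a - X a))); last by field.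
apply: le_lt_trans (ler_normD _ _) _.
have m0 : 0 <= M - (a - X a) by rewrite subr_ge0.
have w1 : `|t / 2 * (M - (a - X a))| <= `|t| * (eps / (1 + `|t|)).
  rewrite normrM (ger0_norm m0) ler_pM//; last by lra.
  rewrite normrM (gtr0_norm (_ : 0 < 2^-1)) ?invr_gt0// ler_pdivrMr//.
  by rewrite mulr_natr mulr2n lerDl.
have E : eps = eps / (1 + `|t|) + `|t| * (eps / (1 + `|t|)).
  by field; exact: lt0r_neq0.
by rewrite [ltRHS]E ltr_leD.
Qed.

End LimitsAtInfinity.

(** * Restarting the flow at a time of absolutely continuous energy *)

Section AbsolutelyContinuousTimes.
Context {R : realType}.
Local Notation leb := (@lebesgue_measure R).
Local Notation T := (measurableTypeR R).
Variables (ubar ubarx : R -> R) (mubar : {finmeas R}).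
Hypothesis hD : calD ubar ubarx mubar.
Variable S : set T.
Hypothesis hS : carries_singular ubarx mubar S.

Local Notation X := (xbar mubar).
Local Notation g := (jac ubarx mubar S).
Local Notation e := (energy_density ubarx mubar S).
Local Notation hh := (flow_jac ubarx mubar S).
Local Notation W := (flow_velocity ubar mubar).
Local Notation Y t := (y ubar mubar ^~ t).
Local Notation Gm x := (fine (mubar `]-oo, x[%classic)).

Let mh t := flow_jac_measurable hD hS t.
Let h0 t := flow_jac_ge0 ubarx mubar S t.
Let hH t := flow_jac_bound ubarx mubar S t.
Let inc t := fun a b (ab : a <= b) => flow_increment hD hS t ab.
Let me := energy_density_measurable hD hS.
Let e0 := energy_density_ge0 ubarx mubar S.
Let e1 := energy_density_le1 ubarx mubar S.

(** If [e a = 0] then [g a = 1] and the velocity density vanishes, so that [h = 1]. *)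
Lemma energy_density_flat t a : hh t a = 0 -> 0 < e a.
Proof.
move=> ha; rewrite lt_neqAle e0 andbT eq_sym; apply/eqP => ea.
have g1 : g a = 1 by move: ea; rewrite /energy_density; lra.
have v0 : vel ubarx mubar S a = 0.
  by apply/eqP; rewrite -sqrf_eq0 vel_sqr g1 subrr mulr0.
by move: ha; rewrite /flow_jac ea v0 g1 !mulr0 !addr0 => /eqP; rewrite oner_eq0.
Qed.

Let ie : leb.-integrable setT (EFin \o (e : T -> R)).
Proof.
apply/integrableP; split; first exact/measurable_EFinP.
rewrite (eq_integral (fun a : T => (e a)%:E)); last by move=> a _; rewrite /= ger0_norm.
exact: (energy_finite hD hS).
Qed.

Lemma energy_cumulative a : \int[leb]_(z in `]-oo, a[%classic) e z = a - X a.
Proof.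
(* The point [b] is the left end of the fibre of [X] over [x]: up to [b] the energy is that of a
   half-line in the datum, and from [b] to [a] it is given by [energy_increment]. *)
pose x := X a; pose b := x + Gm x.
have /andP[ba _] := xbarP mubar a; rewrite -/x -/b in ba.
have Xb : X b = x by exact: xbar_dist_left.
have mx : measurable (`]-oo, x[%classic : set T) by exact: measurable_itv.
have h1 : \int[leb]_(z in `]-oo, b[%classic) e z = b - X b.
  rewrite Xb (_ : b - x = Gm x); last by rewrite /b addrC addKr.
  have := energy_push hD hS mx; rewrite xbar_preimage_lt -/b => h.
  by rewrite /Rintegral h.
have h2 : \int[leb]_(z in `[b, a[%classic) e z = \int[leb]_(z in `[b, a]%classic) e z.
  by apply: Rintegral_itv_bndo_bndc; apply: integrableS ie => //.
have -> : `]-oo, a[%classic = `]-oo, b[%classic `|` `[b, a[%classic.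
  apply/seteqP; split => z /=; rewrite !in_itv/=; last by
    case=> [zb|/andP[]//]; exact: lt_le_trans zb ba.
  by move=> za; case: (ltP z b) => zb; [left|right].
rewrite Rintegral_setU//.
- by rewrite h1 h2 -(energy_increment hD hS ba); ring.
- apply: integrableS ie => //; apply: measurableU; exact: measurable_itv.
- by apply/disj_setPS => z []/=; rewrite !in_itv/= => h /andP[]; rewrite leNgt h.
Qed.

Variable mu : R -> {finmeas R}.
Hypothesis hmu : is_energy ubar mubar mu.
Let muE t (A : set T) : measurable A -> mu t A = (\int[leb]_(x in Y t @^-1` A) (e x)%:E)%E.
Proof. exact: (is_energyE hD hS hmu). Qed.

Variable s : R.
Hypothesis mus : mu s `<< leb.

(** Flat points are sent into the null set of flat and plateau values, which [mu s] does not charge;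
    hence [e = 0] almost everywhere on its preimage, whereas [e > 0] at flat points. *)
Lemma flow_jac_ae_gt0 : {ae leb, forall a : T, 0 < hh s a}.
Proof.
have [C hC] := flow_gap_at hD s.
pose N := flat_values (Y s) (hh s) `|` plateau_values (Y s).
have mFv := flat_values_measurable (mh s) (h0 s) (hH s) (inc s) hC.
have mPv := plateau_measurable (mh s) (h0 s) (hH s) (inc s) hC.
have mN : measurable (N : set T) by exact: measurableU.
have N0 : leb N = 0%E.
  apply: lebesgue_setU0 => //; first exact: (flat_values_null (mh s) (h0 s) (hH s) (inc s) hC).
  apply: countable_lebesgue_measure0.
  exact: (plateau_countable (mh s) (h0 s) (hH s) (inc s) hC).
have : mu s N = 0%E by exact: ((null_content_dominatesP _ _).1 mus _ mN N0).
rewrite muE// => /(ge0_integral_eq0P leb (measurable_preim (mh s) (h0 s) (hH s) (inc s) mN) me e0).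
apply: ae_mono => a h; rewrite lt_neqAle h0 andbT eq_sym; apply/eqP => ha.
have aN : N (Y s a).
  have [p|/(not_plateauP (mh s) (h0 s) (hH s) (inc s) hC) p] :=
    pselect (plateau_values (Y s) (Y s a)); first by right.
  by left; rewrite /flat_values/= p.
by have := energy_density_flat ha; rewrite (h aN) ltxx.
Qed.

(** Equal values would make the integral of [h] over []a, b]] vanish, against its positivity almost
    everywhere. *)
Lemma flow_strict a b : a < b -> Y s a < Y s b.
Proof.
move=> ab; rewrite lt_neqAle (mono_nd (h0 s) (inc s) (ltW ab)) andbT.
apply/eqP => E.
have mI : measurable (`]a, b]%classic : set T) by exact: measurable_itv.
have := integral_increment (mh s) (h0 s) (hH s) (inc s) (ltW ab).
rewrite E subrr => /(ge0_integral_eq0P leb mI (mh s) (h0 s)) h1.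
have [N [mN N0 hN]] : {ae leb, forall z : T, ~ `]a, b]%classic z}.
  by apply: ae_mono2 h1 flow_jac_ae_gt0 => z hz z0 /hz z1; move: z0; rewrite z1 ltxx.
have : (leb `]a, b]%classic <= leb N)%E.
  by apply: le_measure; rewrite ?inE// => z hz; apply: hN => /=; exact.
by rewrite N0 lebesgue_itvoc// lee_fin leNgt subr_gt0 ab.
Qed.

Variable u : R -> R -> R.
Hypothesis hu : is_velocity ubar mubar u.
Let uY t a : u (Y t a) t = W t a. Proof. exact: hu. Qed.
Local Notation ux := (velocity_slope ubar ubarx mubar S).

Variable utx : R -> R.
Hypothesis wutx : weak_derivative (u ^~ s) utx.

Let mutx : @measurable_fun _ _ T R setT utx.
Proof. by case: wutx => -[]. Qed.

Let utx_ae : {ae leb, forall x : T, utx x = ux x s}.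
Proof.
have wux := velocity_weak_derivative hD hS hu s.
apply: (@increment_ae_unique _ (u ^~ s)); [by case: wutx|by case: wux| |].
  by apply: weak_derivative_increment wutx; exact: (velocity_continuous hD hS hu).
exact: (velocity_increment hD hS hu s).
Qed.

(** Almost every point is [not_flat] at time [s], so the absolutely continuous part is the whole
    energy. *)
Lemma slope_density (A : set T) : measurable A ->
  density (fun x => utx x ^+ 2) A = (\int[leb]_(x in Y s @^-1` A) (e x)%:E)%E.
Proof.
move=> mA; rewrite /density.
transitivity (density (fun x => ux x s ^+ 2) A).
  apply: ae_eq_integral_any => //.
    apply: measurable_funTS; apply/measurable_EFinP; apply: measurable_funX.
    by have [] := (L2P _).1 (velocity_slope_L2 hD hS s).
  by apply: ae_mono utx_ae => x ->.
rewrite (velocity_slope_density hD hS s mA).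
apply: ae_eq_integral_any.
- exact: (measurable_preim (mh s) (h0 s) (hH s) (inc s) mA).
- by apply: measurable_funTS; exact/measurable_EFinP.
apply: ae_mono flow_jac_ae_gt0 => a ha _.
by rewrite indicE mem_set ?mulr1.
Qed.

Lemma slope_L2 : L2 utx.
Proof.
apply/L2P; split=> //.
have := slope_density measurableT; rewrite /density => ->.
by rewrite preimage_setT; exact: (energy_finite hD hS).
Qed.

Lemma slope_norm :
  ('N[leb]_2%:E [(EFin \o utx : T -> \bar R)] ^+ 2)%E = mubar setT.
Proof.
rewrite Lnorm2_sqr; have := slope_density measurableT; rewrite /density => ->.
by rewrite preimage_setT; exact: (energy_total hD hS).
Qed.

(** Since [Y s] is strictly increasing, the energy to the left of [Y s a] is the energy to the left
    of [a]. *)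
Lemma slope_cumulative a : Fac utx (Y s a) = a - X a.
Proof.
have mI : measurable (`]-oo, Y s a[%classic : set T) by exact: measurable_itv.
rewrite /Fac /Rintegral; have := slope_density mI; rewrite /density => ->.
rewrite (_ : Y s @^-1` _ = `]-oo, a[%classic); first exact: energy_cumulative.
apply/seteqP; split => z /=; rewrite !in_itv/=; last exact: flow_strict.
rewrite !ltNge; apply: contra => az.
exact: (mono_nd (h0 s) (inc s) az).
Qed.

(** The trajectory is a quadratic polynomial in time and the right side is its Taylor expansion at
    [s], once [slope_cumulative] has identified the second order coefficient. *)
Lemma flow_composition a t : Y t a = Xac (u ^~ s) utx (Y s a) (t - s).
Proof.
by rewrite /Xac slope_cumulative uY /flow_velocity /y; field.
Qed.

Lemma energy_transport t (A : set T) : measurable A ->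
  mu t A = pushforward (density (fun x => utx x ^+ 2)) (Xac (u ^~ s) utx ^~ (t - s)) A.
Proof.
move=> mA; have [C hC] := flow_gap_at hD s.
(* This factorization through the pseudo-inverse at time [s] is how measurability of the map is
   obtained. *)
have XacE : Xac (u ^~ s) utx ^~ (t - s) = (Y t) \o (fiber_inf (Y s)).
  apply/funext => x /=.
  by rewrite flow_composition (fiber_infK (mh s) (h0 s) (hH s) (inc s) hC).
have mXac : measurable (Xac (u ^~ s) utx ^~ (t - s) @^-1` A : set T).
  rewrite XacE -[X in measurable X]setTI.
  apply: (measurableT_comp (mono_measurable (mh t) (h0 t) (hH t) (inc t))) => //.
  exact: (fiber_inf_measurable (mh s) (h0 s) (hH s) (inc s) hC).
rewrite muE// /pushforward slope_density//; congr (integral _ _ _).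
by apply/seteqP; split => a /=; rewrite -flow_composition.
Qed.

Lemma velocity_transport xi t :
  u (Xac (u ^~ s) utx xi (t - s)) t = u xi s + (t - s) / 2 * Fac utx xi /\
  is_derive (t : R) 1 (fun tau : R => Xac (u ^~ s) utx xi (tau - s))
    (u (Xac (u ^~ s) utx xi (t - s)) t).
Proof.
have [a <-] := flow_surj hD hS s xi.
rewrite -flow_composition !uY slope_cumulative; split.
  by rewrite /flow_velocity; field.
rewrite (_ : (fun tau => _) = y ubar mubar a); first exact: flow_time_derive.
by apply/funext => tau; rewrite -flow_composition.
Qed.

End AbsolutelyContinuousTimes.

(** The image of [AE t] depends on the representative [ubarx] and need not be closed. The inclusion
    of supports is therefore given in two forms: the singular parts are concentrated on the image,
    and their topological support lies in its closure. *)
Theorem theorem2p1 (R : realType) (ubar ubarx : R -> R) (mubar : {finmeas R})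
    (hD : calD ubar ubarx mubar) :
  (exists (u : R -> R -> R) (mu muac mupp musc : R -> {finmeas R}),
    [/\ is_velocity ubar mubar u, is_energy ubar mubar mu &
        forall t, lebesgue_decomposition (mu t) (muac t) (mupp t) (musc t)]) /\
  forall (u : R -> R -> R) (mu muac mupp musc : R -> {finmeas R}),
    is_velocity ubar mubar u ->
    is_energy ubar mubar mu ->
    (forall t, lebesgue_decomposition (mu t) (muac t) (mupp t) (musc t)) ->
  (forall a t : R, is_derive t 1 (y ubar mubar a) (u (y ubar mubar a t) t)) /\
  (* (i) *)
  [/\ forall phi : R -> R, Cb phi ->
        continuous (fun t : R => \int[mu t]_x phi x) &
      forall t, mu t setT = mubar setT] /\
  (* (ii) *)
  [/\ forall t (A : set (measurableTypeR R)), measurable A ->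
        [/\ mupp t A = pushforward
              (density (f mubar \* \1_(ALpp ubar mubar t))) (y ubar mubar ^~ t) A,
            musc t A = pushforward
              (density (f mubar \* \1_(ALsc ubar mubar t))) (y ubar mubar ^~ t) A &
            muac t A = pushforward
              (density (f mubar \* \1_(BL ubar mubar t))) (y ubar mubar ^~ t) A],
      forall t, t != 0 ->
        {ae lebesgue_measure, forall a : measurableTypeR R,
          (ALpp ubar mubar t `|` ALsc ubar mubar t) a <-> AL ubarx mubar t a},
      forall t, t != 0 ->
        forall A : set (measurableTypeR R), measurable A ->
          (mupp t A + musc t A)%E = pushforward
            (density ((fun x => ubarx x ^+ 2) \* \1_(AE ubarx t)))
            (XE ubar mubar t) A &
      forall t, t != 0 ->
        (measure_add (mupp t) (musc t)).-negligible
          (~` (XE ubar mubar t @` AE ubarx t)) /\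
        msupport (measure_add (mupp t) (musc t)) `<=`
          closure (XE ubar mubar t @` AE ubarx t)] /\
  (* (iii) *)
  [/\ countable [set t | exists2 A : set (measurableTypeR R),
                           measurable A & mupp t A != 0%E] &
      countable [set t | exists2 A : set (measurableTypeR R),
                           measurable A & musc t A != 0%E]] /\
  (* (iv) *)
  [/\ forall t, globally_absolutely_continuous (u ^~ t),
      exists ux : R -> R -> R,
        [/\ measurable_fun setT
              (fun p : measurableTypeR R * measurableTypeR R => ux p.1 p.2),
            forall t, weak_derivative (u ^~ t) (ux ^~ t) /\ L2 (ux ^~ t),
            forall t (A : set (measurableTypeR R)), measurable A ->
              muac t A = density (fun x => ux x t ^+ 2) A &
            (ess_sup lebesgue_measure (fun t : measurableTypeR R =>
               'N[lebesgue_measure]_2%:E [(fun x : measurableTypeR R => (ux x t)%:E)]) < +oo)%E],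
      (forall t, Cb (u ^~ t)) /\
        forall t, {uniform, (fun s => u ^~ s) @ t --> u ^~ t},
      holder_half_loc u &
      exists ut : R * R -> R, L2loc2 ut /\ weak_time_derivative u ut] /\
  (* (v) *)
  [/\ forall l : R, ubar x @[x --> -oo] --> l ->
        forall t, u x t @[x --> -oo] --> l &
      forall l : R, ubar x @[x --> +oo] --> l ->
        forall t, u x t @[x --> +oo] --> l + 2^-1 * fine (mubar setT) * t] /\
  (* (vi) *)
  forall s, mu s `<< lebesgue_measure ->
    Cb (u ^~ s) /\
    forall utx : R -> R, weak_derivative (u ^~ s) utx ->
    [/\ L2 utx,
        ('N[lebesgue_measure]_2%:E [(EFin \o utx : measurableTypeR R -> \bar R)]
           ^+ 2)%E = mubar setT &
        forall t,
        [/\ forall a, y ubar mubar a t =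
              Xac (u ^~ s) utx (y ubar mubar a s) (t - s),
            forall A : set (measurableTypeR R), measurable A ->
              mu t A = pushforward (density (fun x => utx x ^+ 2))
                         (Xac (u ^~ s) utx ^~ (t - s)) A &
            forall xi,
              u (Xac (u ^~ s) utx xi (t - s)) t = u xi s + (t - s) / 2 * Fac utx xi /\
              is_derive (t : R) 1 (fun tau : R => Xac (u ^~ s) utx xi (tau - s))
                (u (Xac (u ^~ s) utx xi (t - s)) t)]].
Proof.
have [S hS] := calD_singular_set hD.
split.
  have [u hu] := velocity_exists hD hS.
  have [mu hmu] := energy_exists hD hS.
  have /choice[ac /choice[pp /choice[sc dec]]] : forall t, exists ac pp sc : {finmeas R},
      lebesgue_decomposition (mu t) ac pp sc.
    move=> t; have [ac [pp [sc [dec _]]]] := decomposition_exists hD hS (is_energyE hD hS hmu t).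
    by exists ac, pp, sc.
  by exists u, mu, ac, pp, sc.
move=> u mu muac mupp musc hu hmu dec.
have parts t := energy_parts hD hS hmu (dec t).
split; first by move=> a t; rewrite hu; exact: flow_time_derive.
split.
  split; first exact: (energy_weak_continuous hD hS hmu).
  exact: (energy_conservation hD hS hmu).
split.
  split.
  - move=> t A mA; have [h1 h2 h3] := energy_parts_density hD hS hmu (dec t) mA.
    by split.
  - by move=> t t0; exact: (flat_AL hD hS t0).
  - by move=> t t0 A mA; exact: (singular_parts_density hD hS t0 (parts t) mA).
  - move=> t t0; split; first exact: (singular_parts_negligible hD hS t0 (parts t)).
    exact: (singular_parts_support hD hS t0 (parts t)).
split.
  (* At a nonzero time the sum of the singular parts is the image of [mubar] restricted to [AE t]
     off [S]; if either part is nonzero, [t] belongs to the set of [singular_times_countable]. *)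
  have key t (A : set (measurableTypeR R)) : measurable A ->
      (mupp t A + musc t A != 0)%E -> t = 0 \/ mubar (AE ubarx t `\` S) != 0%E.
    move=> mA nz; have [->|t0] := eqVneq t 0; [by left|right].
    apply: contra nz => /eqP m0; rewrite (singular_parts_mubar hD hS t0 (parts t) mA).
    have [mS _ _ _] := hS; apply/eqP; apply: (subset_measure0 _ _ _ m0).
    - apply: measurableI; first by apply: measurableD => //; exact: (AE_measurable hD).
      by rewrite -[X in measurable X]setTI; exact: (XE_measurable hD).
    - by apply: measurableD => //; exact: (AE_measurable hD).
    - exact: subIsetl.
  split; apply: sub_countable (singular_times_countable hD hS);
    apply: subset_card_le => t [A mA nz]; apply: (key t A mA).
    by rewrite padde_eq0// negb_and nz.
  by rewrite padde_eq0// negb_and nz orbT.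
split.
  split.
  - exact: (velocity_globally_ac hD hS hu).
  - exists (velocity_slope ubar ubarx mubar S); split.
    + exact: (velocity_slope_jointly_measurable hD hS).
    + move=> t; split; first exact: (velocity_weak_derivative hD hS hu).
      exact: (velocity_slope_L2 hD hS).
    + move=> t A mA; have [_ _ ->] := parts t A mA.
      by rewrite (velocity_slope_density hD hS).
    + exact: (velocity_slope_ess_sup hD hS).
  - split; first exact: (velocity_Cb hD hS hu).
    exact: (velocity_time_uniform hD hS hu).
  - exact: (velocity_holder_loc hD hS hu).
  - exists (velocity_time_slope ubar ubarx mubar S u); split.
      exact: (velocity_time_slope_L2loc2 hD hS hu).
    exact: (velocity_weak_time_derivative hD hS hu).
split.
  split=> l hl t; first exact: (velocity_limit_left hD hu).
  exact: (velocity_limit_right hD hu).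
move=> s mus; split; first exact: (velocity_Cb hD hS hu).
move=> utx wutx; split.
- exact: (slope_L2 hD hS hmu mus hu wutx).
- exact: (slope_norm hD hS hmu mus hu wutx).
- move=> t; split=> [a|A mA|xi].
  + exact: (flow_composition hD hS hmu mus hu wutx).
  + exact: (energy_transport hD hS hmu mus hu wutx).
  + exact: (velocity_transport hD hS hmu mus hu wutx).
Qed.
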